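(* Let $R$ be an infinite ribbon and let $\lambda/\mu$ be a skew shape compatible with $R$, with ending tuple $\bar a=(a_1,\dots,a_n)$ and starting tuple $\bar b=(b_1,\dots,b_n)$. Let $A_{\lambda/\mu,R}=\big(s_{[a_j,b_i)_R}\big)_{i,j=1}^n$ be the ribbon decomposition matrix. Then for every $321$-avoiding permutation $u\in S_n$, the Temperley--Lieb immanant $\operatorname{Imm}^{\operatorname{TL}}_u(A_{\lambda/\mu,R})$ is Schur positive, i.e. it is a linear combination of Schur functions $s_\nu$ with nonnegative coefficients.
   Context: Cells of $\mathbb{Z}^2$ are indexed $(i,j)$ with $i$ increasing downward and $j$ increasing rightward; the content of $(i,j)$ is $j-i$. A partition, Young diagram, skew shape $\lambda/\mu$ (a difference of Young diagrams), semistandard Young tableaux and skew Schur functions $s_{\lambda/\mu}$ are as usual; the skew Schur function of any finite set of cells that is a translate of a skew shape is the skew Schur function of that skew shape. A ribbon is a connected skew shape containing no $2\times 2$ block. An infinite ribbon $R$ is a ribbon with an extra infinite horizontal ($1\times\infty$) or vertical ($\infty\times 1$) block attached at its beginning and at its end; it contains exactly one cell $r_c$ of each content $c\in\mathbb{Z}$, and for each $c$ the cell $r_c$ lies either immediately to the right of or immediately above $r_{c-1}$. For integers $a\le b$, $[a,b)_R$ denotes the set of cells $r_c$ of $R$ with $a\le c<b$ (a finite ribbon). The plane is tiled by the copies (diagonal translates) of $R$. A skew shape $\lambda/\mu$ is compatible with $R$ if its intersection with each copy of $R$ is contiguous. Listing the nonempty intersections of $\lambda/\mu$ with copies of $R$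 from inside out (northwest to southeast) as $\theta_1,\dots,\theta_n$, each $\theta_k$ occupies the contents of an interval $[a_k,b_k)$ with $a_k<b_k$ (i.e. it is a copy of $[a_k,b_k)_R$); $\bar a=(a_1,\dots,a_n)$ is the ending tuple and $\bar b=(b_1,\dots,b_n)$ the starting tuple of $\lambda/\mu$. In the matrix $A_{\lambda/\mu,R}$ the convention is $s_{[a_j,b_i)_R}=1$ if $a_j=b_i$ and $s_{[a_j,b_i)_R}=0$ if $a_j>b_i$. Temperley--Lieb immanants: $TL_n(2)$ is the $\mathbb{C}$-algebra generated by $t_1,\dots,t_{n-1}$ with relations $t_i^2=2t_i$, $t_it_jt_i=t_i$ if $|i-j|=1$, $t_it_j=t_jt_i$ if $|i-j|>1$. A permutation is $321$-avoiding if no reduced word of it contains a factor $s_is_js_i$ with $|i-j|=1$; the elements $t_u=t_{i_1}\cdots t_{i_k}$ (for a reduced word $u=s_{i_1}\cdots s_{i_k}$), $u$ $321$-avoiding, form a basis of $TL_n(2)$. Let $\theta:\mathbb{C}[S_n]\to TL_n(2)$ be the algebra homomorphism with $\theta(s_i)=t_i-1$. For $w\in S_n$ and $321$-avoiding $u$, $f_u(w)$ is the coefficient of $t_u$ in $\theta(w)$. For an $n\times n$ matrix $X=(x_{ij})$, $\operatorname{Imm}^{\operatorname{TL}}_u(X)=\sum_{w\in S_n}f_u(w)\,x_{1,w(1)}\cdots x_{n,w(n)}$. *)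

(* Defs.v *)
From HB Require Import structures.
From mathcomp Require Import all_boot all_order all_algebra all_fingroup.
From mathcomp Require Import finmap boolp classical_sets.
(* The notations of monalg clash with those of mpoly. *)
From mathcomp Require Import -(notations) monalg.
From mathcomp Require Import mpoly.

Set Implicit Arguments.
Unset Strict Implicit.
Unset Printing Implicit Defensive.

Import Order.TTheory GRing.Theory Num.Theory.
Local Open Scope ring_scope.

(* Cells (i, j) of Z^2: i increases downward, j increases rightward. *)
Definition cell : Type := (int * int)%type.
Definition content (x : cell) : int := x.2 - x.1.
Definition diag_shift (k : int) (x : cell) : cell := (x.1 + k, x.2 + k).

Definition is_partition (nu : seq nat) : bool := sorted geq nu && (0%N \notin nu).

(* Rows and columns are numbered from 0; numbering them from 1 would only
   translate everything along the diagonal. *)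
Definition diagram (nu : seq nat) : {fset cell} :=
  [fset x in [seq (i%:Z, j%:Z) | i <- iota 0 (size nu),
                                 j <- iota 0 (nth 0%N nu i)]]%fset.

Definition skew_diagram (lambda mu : seq nat) : {fset cell} :=
  (diagram lambda `\` diagram mu)%fset.

Definition ssyt (D : {fset cell}) (N : nat) (T : {ffun D -> 'I_N}) : bool :=
  [forall x : D, forall y : D,
    (((val x).1 == (val y).1) && ((val x).2 <= (val y).2) ==> (T x <= T y)%N)
    && (((val x).2 == (val y).2) && ((val x).1 < (val y).1) ==> (T x < T y)%N)].

(* A symmetric function is represented by the family of its truncations to
   finitely many variables x_0, ..., x_(N-1), for all N. *)
Definition symfun (C : comNzRingType) : Type := forall N : nat, {mpoly C[N]}.

(* This is meant for D a translate of a skew shape; it depends on D only up to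
   translation. The empty D gives 1. *)
Definition skew_schur (C : comNzRingType) (D : {fset cell}) : symfun C :=
  fun N => \sum_(T : {ffun D -> 'I_N} | ssyt T) \prod_(x : D) 'X_(T x).

Definition schur (C : comNzRingType) (nu : seq nat) : symfun C :=
  skew_schur C (diagram nu).

(* The coefficients do not depend on the number N of variables. *)
Definition schur_positive (C : numClosedFieldType) (F : symfun C) : Prop :=
  exists (nus : seq (seq nat)) (c : seq nat -> C),
    [/\ all is_partition nus,
        forall nu, 0 <= c nu
      & forall N, F N = \sum_(nu <- nus) c nu *: schur C nu N].

Definition is_step_right (x y : cell) : Prop := y = (x.1, x.2 + 1).
Definition is_step_up (x y : cell) : Prop := y = (x.1 - 1, x.2).

(* rib c is the cell of content c. The last two fields say that the ribbon
   begins and ends with an infinite horizontal or vertical block. *)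
Record infinite_ribbon : Type := InfiniteRibbon {
  rib :> int -> cell;
  rib_content : forall c, content (rib c) = c;
  rib_step : forall c,
    is_step_right (rib (c - 1)) (rib c) \/ is_step_up (rib (c - 1)) (rib c);
  rib_beginning : exists c0,
    (forall c, c <= c0 -> is_step_right (rib (c - 1)) (rib c)) \/
    (forall c, c <= c0 -> is_step_up (rib (c - 1)) (rib c));
  rib_end : exists c0,
    (forall c, c0 <= c -> is_step_right (rib (c - 1)) (rib c)) \/
    (forall c, c0 <= c -> is_step_up (rib (c - 1)) (rib c))
}.

(* The cell of content c in the k-th copy of R; k increases from northwest to
   southeast. *)
Definition copy (R : infinite_ribbon) (k c : int) : cell := diag_shift k (R c).

(* [a, b)_R, for a <= b. *)
Definition ribbon_interval (R : infinite_ribbon) (a b : int) : {fset cell} :=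
  [fset x in [seq R (a + m%:Z)%R | m <- iota 0 `|b - a|%N]]%fset.

Definition compatible (R : infinite_ribbon) (D : {fset cell}) : Prop :=
  forall k c1 c2 c3 : int, c1 <= c2 -> c2 <= c3 ->
    copy R k c1 \in D -> copy R k c3 \in D -> copy R k c2 \in D.

(* k lists, from inside out, the copies of R which meet D; the i-th
   intersection occupies the contents [a_i, b_i). *)
Definition ending_starting_tuples (R : infinite_ribbon) (D : {fset cell})
    (n : nat) (a b : 'I_n -> int) : Prop :=
  exists k : 'I_n -> int,
    [/\ forall i j : 'I_n, (i < j)%N -> k i < k j,
        forall l c, copy R l c \in D -> exists i, l = k i,
        forall i, a i < b i
      & forall i c, (copy R (k i) c \in D) = (a i <= c < b i)].

Definition ribbon_matrix (C : comNzRingType) (R : infinite_ribbon) (n : nat)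
    (a b : 'I_n -> int) (N : nat) : 'M[{mpoly C[N]}]_n :=
  \matrix_(i < n, j < n)
    (if a j <= b i then skew_schur C (ribbon_interval R (a j) (b i)) N else 0).

Section TemperleyLieb.

(* C is any algebraically closed field with an order and a conjugation, such as
   the complex numbers R[i] over a realType R. *)
Variables (C : numClosedFieldType) (n : nat).

(* Generators are numbered from 0: i : 'I_n.-1 stands for s_(i+1), t_(i+1). *)
Lemma adj_transp_subproof (i : 'I_n.-1) : (i.+1 < n)%N.
Proof. by rewrite -ltn_predRL. Qed.

Definition adj_transp (i : 'I_n.-1) : 'S_n :=
  tperm (Ordinal (ltnW (adj_transp_subproof i)))
        (Ordinal (adj_transp_subproof i)).

(* (v * w)%g is v followed by w. With the opposite convention, a word would
   represent the inverse permutation and t_u would be reversed, so that the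
   coefficients f_u(w) would be unchanged. *)
Definition perm_of_word (w : seq 'I_n.-1) : 'S_n :=
  (\prod_(i <- w) adj_transp i)%g.

Definition reduced_word (w : seq 'I_n.-1) (u : 'S_n) : Prop :=
  perm_of_word w = u /\
  forall w', perm_of_word w' = u -> (size w <= size w')%N.

Definition gen_dist (i j : 'I_n.-1) : nat := `|i%:Z - j%:Z|%N.

Definition avoids321 (u : 'S_n) : Prop :=
  forall (w : seq 'I_n.-1) (i j : 'I_n.-1),
    reduced_word w u -> gen_dist i j = 1%N -> ~~ infix [:: i; j; i] w.

(* TL_n(2) is the quotient of the free algebra by the two-sided ideal TL_ideal;
   equality in TL_n(2) is the congruence TL_eq. *)
Definition free_alg : lalgType C := malg (fmonom 'I_n.-1) C.

Definition TL_gen (i : 'I_n.-1) : free_alg := mkmalgU (fmu i) 1.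

Inductive TL_ideal : free_alg -> Prop :=
| TL_ideal_sq i : TL_ideal (TL_gen i ^+ 2 - 2%:R *: TL_gen i)
| TL_ideal_adj i j : gen_dist i j = 1%N ->
    TL_ideal (TL_gen i * TL_gen j * TL_gen i - TL_gen i)
| TL_ideal_far i j : (1 < gen_dist i j)%N ->
    TL_ideal (TL_gen i * TL_gen j - TL_gen j * TL_gen i)
| TL_ideal_0 : TL_ideal 0
| TL_ideal_add x y : TL_ideal x -> TL_ideal y -> TL_ideal (x + y)
| TL_ideal_mul x y z : TL_ideal y -> TL_ideal (x * y * z).

Definition TL_eq (x y : free_alg) : Prop := TL_ideal (x - y).

(* A reduced word of u; for u avoiding 321, the class of TL_basis u in TL_n(2)
   does not depend on the choice. *)
Definition some_reduced_word (u : 'S_n) : seq 'I_n.-1 :=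
  xget [::] [set w | reduced_word w u]%classic.

Definition TL_basis (u : 'S_n) : free_alg :=
  \prod_(i <- some_reduced_word u) TL_gen i.

(* th lifts to the free algebra the restriction to S_n of the algebra
   homomorphism C[S_n] -> TL_n(2) mapping s_i to t_i - 1. *)
Definition is_theta (th : 'S_n -> free_alg) : Prop :=
  [/\ TL_eq (th 1%g) 1,
      forall v w, TL_eq (th (v * w)%g) (th v * th w)
    & forall i, TL_eq (th (adj_transp i)) (TL_gen i - 1)].

(* f w u is the coefficient of t_u in theta(w). *)
Definition is_TL_coefs (f : {ffun 'S_n -> {ffun 'S_n -> C}}) : Prop :=
  exists2 th, is_theta th &
    forall w, TL_eq (th w) (\sum_(u | `[< avoids321 u >]) f w u *: TL_basis u).

(* As the t_u form a basis of TL_n(2), such an f exists, and its values f w u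
   for u avoiding 321 are uniquely determined. *)
Definition TL_coef (u w : 'S_n) : C :=
  xget [ffun=> [ffun=> 0]] [set f | is_TL_coefs f]%classic w u.

Definition TL_imm (B : algType C) (u : 'S_n) (X : 'M[B]_n) : B :=
  \sum_(w : 'S_n) TL_coef u w *: \prod_(i < n) X i (w i).

End TemperleyLieb.

(* Main.v *)
(** Let [f_u (w)] be the coefficient of [t_u] in [theta w]. Multiplying [theta w] by
    [t_k] replaces it by [f_u (w) + f_u (s_k w)], so [f_u] and all the functions
    obtained in this way take nonnegative values at 1 and satisfy the relations of
    TL_n(2). This uses only the action of TL_n(2) on perfect matchings: a word maps
    a matching to a positive multiple of a matching, and the matchings of distinct
    321-avoiding permutations are distinct (orient their arcs along exceedances).

    An immanant attached to such a function [g] is multilinear in the rows,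
    symmetrizing two adjacent rows replaces [g] by another such function, and it
    vanishes on three equal adjacent rows. Row [i] of the ribbon matrix is computed
    content by content from rows [z_h], where [h] is the entry of the next cell of
    the ribbon. By induction on the content, the antisymmetrization of [x^kap] times
    an immanant in the rows [z_h] is a nonnegative combination of alternants [a_nu];
    convexity of the skew shape says which ribbons are active at a given content.
    For [kap = rho] the immanant of the ribbon matrix is symmetric, so that [a_rho]
    times it is such a combination, and [a_rho * s_nu = a_(nu + rho)] concludes. *)
Require Import Defs.
From HB Require Import structures.
From mathcomp Require Import all_boot all_order all_algebra all_fingroup.
From mathcomp Require Import finmap boolp classical_sets.
From mathcomp Require Import -(notations) monalg.
From mathcomp Require Import mpoly.
From mathcomp Require Import zify ring.

Set Implicit Arguments.
Unset Strict Implicit.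
Unset Printing Implicit Defensive.

Import Order.TTheory GRing.Theory Num.Theory.
Local Open Scope ring_scope.

(** * Immanants of lists of rows *)

(** The exponents [kap] start from rho and collect the entries of cells in order of decreasing
    content, so keeping them strictly decreasing plays the part of the lattice condition in the
    Littlewood-Richardson rule. The obstacle is that the rows [z h] are not symmetric in the
    variables. Only one symmetry fails, however: exchanging [x i] and [x i.+1] fixes every [z h]
    with [h <> i], and it fixes [x i *: z i + x i.+1 *: z i.+1]. A term with [kap i = kap i.+1] is
    thus killed by antisymmetrization as soon as no row [z i] occurs, and the invariant kept between
    contents asks for a gap of at least two between [kap h] and [kap h.+1] when a row [z h] occurs.
    Expanding rows can violate this invariant. The offending terms vanish, except that two equal
    rows combined with a gap of one leave a correction term with two rows [z i.+1]. As three equal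
    rows contribute nothing, each entry has only a few cases. *)

Section Positive.
Variables (C : numClosedFieldType) (n : nat).
Implicit Types (g : 'S_n -> C) (k : 'I_n.-1).

(* If [g w] is the coefficient of [t_u] in [theta w], then [tl_act k g w] is its
   coefficient in [t_k * theta w]. *)
Definition tl_act k g : 'S_n -> C := fun w => g w + g (adj_transp k * w)%g.

Definition tl_acts (ks : seq 'I_n.-1) g : 'S_n -> C := foldr tl_act g ks.

(** The second condition is what kills three equal rows. The relations [t_i ^ 2 = 2 t_i] and
    [t_i t_j = t_j t_i] for distant generators hold for [tl_act] on every function. *)
Definition tl_positive g : Prop :=
  (forall ks, 0 <= tl_acts ks g 1%g) /\
  (forall ks (i j : 'I_n.-1), j = i.+1 :> nat ->
     tl_act i (tl_act j (tl_act i (tl_acts ks g))) =1 tl_act i (tl_acts ks g)).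

Lemma tl_positive_act k g : tl_positive g -> tl_positive (tl_act k g).
Proof.
have E ks : tl_acts ks (tl_act k g) = tl_acts (rcons ks k) g.
  by rewrite /tl_acts foldr_rcons.
by case=> h1 h2; split=> [ks|ks i j ij]; rewrite E; [apply: h1|apply: h2].
Qed.

Variable B : comAlgType C.
Implicit Types (r : 'rV[B]_n) (l : seq 'rV[B]_n).

(* Junk value 0 for lists of the wrong length, so that the identities below
   need no hypothesis on lengths. *)
Definition imm g l : B :=
  if size l == n then \sum_(w : 'S_n) g w *: \prod_(i < n) nth 0 l i 0 (w i)
  else 0.

Lemma prod_row l1 r l2 (lt : (size l1 < n)%N) (w : 'S_n) :
  \prod_(i < n) nth 0 (l1 ++ r :: l2) i 0 (w i) =
  r 0 (w (Ordinal lt)) *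
  \prod_(i < n | i != Ordinal lt) nth 0 (l1 ++ 0 :: l2) i 0 (w i).
Proof.
rewrite (bigD1 (Ordinal lt)) //= nth_cat ltnn subnn; congr (_ * _).
apply: eq_bigr => i; rewrite -val_eqE /= => ne; rewrite !nth_cat.
by case: ltnP => // le; have -> : (i - size l1 = (i - size l1).-1.+1)%N by lia.
Qed.

Lemma immD g l1 r r' l2 :
  imm g (l1 ++ (r + r') :: l2) = imm g (l1 ++ r :: l2) + imm g (l1 ++ r' :: l2).
Proof.
rewrite /imm !size_cat /=; case: eqP => [sz|_]; last by rewrite addr0.
have lt : (size l1 < n)%N by lia.
rewrite -big_split /=; apply: eq_bigr => w _; rewrite -scalerDr; congr (_ *: _).
by rewrite 3!(prod_row _ _ lt) mxE mulrDl.
Qed.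

Lemma immZ g b l1 r l2 : imm g (l1 ++ (b *: r) :: l2) = b * imm g (l1 ++ r :: l2).
Proof.
rewrite /imm !size_cat /=; case: eqP => [sz|_]; last by rewrite mulr0.
have lt : (size l1 < n)%N by lia.
rewrite mulr_sumr; apply: eq_bigr => w _; rewrite -scalerAr; congr (_ *: _).
by rewrite 2!(prod_row _ _ lt) mxE mulrA.
Qed.

Lemma imm0 g l1 l2 : imm g (l1 ++ 0 :: l2) = 0.
Proof. by rewrite -[X in X :: _](scale0r (0 : 'rV[B]_n)) immZ mul0r. Qed.

Lemma immB g l1 r r' l2 :
  imm g (l1 ++ (r - r') :: l2) = imm g (l1 ++ r :: l2) - imm g (l1 ++ r' :: l2).
Proof. by rewrite -scaleN1r immD immZ mulN1r. Qed.

Definition swapn (k i : nat) : nat :=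
  if i == k then k.+1 else if i == k.+1 then k else i.

Lemma adj_transp_val k (i : 'I_n) : adj_transp k i = swapn k i :> nat.
Proof.
rewrite /adj_transp /swapn.
case: tpermP => [->|->|/eqP + /eqP] /=; rewrite ?eqxx //.
  by rewrite -[_ == _ in RHS](inj_eq succn_inj) /= ifF //; apply/eqP; lia.
by rewrite -!val_eqE /= => /negPf-> /negPf->.
Qed.

Lemma adj_transpK k : involutive (adj_transp k).
Proof. exact: tpermK. Qed.

Lemma imm_swap k g l1 r r' l2 : size l1 = k ->
  imm g (l1 ++ r' :: r :: l2) = imm (fun w => g (adj_transp k * w)%g) (l1 ++ r :: r' :: l2).
Proof.
move=> sz; rewrite /imm !size_cat /=; case: eqP => // szn.
rewrite (reindex_inj (mulgI (adj_transp k))) /=; apply: eq_bigr => w _.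
congr (_ *: _).
rewrite (reindex_inj (@perm_inj _ (adj_transp k))) /=; apply: eq_bigr => i _.
rewrite permM adj_transpK; congr (fun_of_matrix _ _ _).
rewrite adj_transp_val /swapn -sz !nth_cat.
have [->|ne0] := eqVneq (i : nat) (size l1).
  by rewrite ltnn subnn ltnNge leqnSn subSnn.
have [->|ne1] := eqVneq (i : nat) (size l1).+1.
  by rewrite ltnn subnn ltnNge leqnSn subSnn.
case: ltnP => // le.
by have -> : (i - size l1 = (i - size l1).-2.+2)%N by lia.
Qed.

Lemma imm_exchange g p : tl_positive g -> exists2 g', tl_positive g' &
  forall l1 r r' l2, size l1 = p ->
    imm g (l1 ++ r :: r' :: l2) + imm g (l1 ++ r' :: r :: l2) =
    imm g' (l1 ++ r :: r' :: l2).
Proof.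
move=> gP; have [lt|le] := ltnP p n.-1; last first.
  (* Two rows at positions [p] and [p.+1] do not fit in a list of length [n], so all three immanants
     have the junk value 0. *)
  exists g => // l1 r r' l2 sz; rewrite /imm !size_cat /=; case: eqP => [|_]; [lia|exact: addr0].
exists (tl_act (Ordinal lt) g); first exact: tl_positive_act.
move=> l1 r r' l2 sz; rewrite [X in _ + X](imm_swap (k := Ordinal lt)) // /imm.
case: ifP => _; last by rewrite addr0.
by rewrite -big_split; apply: eq_bigr => w _; rewrite /tl_act scalerDl.
Qed.

Lemma mulr2_eq0 (b : B) : b + b = 0 -> b = 0.
Proof.
move=> h; apply: (@scalerI _ _ (2%:R : C)); first by rewrite pnatr_eq0.
by rewrite scaler0 scaler_nat.
Qed.

(* With three equal rows, [t_i t_j t_i] multiplies by 8 and [t_i] by 2. *)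
Lemma imm_triple g l1 r l2 : tl_positive g -> imm g (l1 ++ [:: r, r, r & l2]) = 0.
Proof.
move=> [_ /(_ [::])]; rewrite [tl_acts _ _]/= => h.
have [sz|] := eqVneq (size (l1 ++ [:: r, r, r & l2])) n; last first.
  by rewrite /imm => /negPf->.
have lt0 : (size l1 < n.-1)%N by move: sz; rewrite size_cat /=; lia.
have lt1 : ((size l1).+1 < n.-1)%N by move: sz; rewrite size_cat /=; lia.
have E0 g' : imm (tl_act (Ordinal lt0) g') (l1 ++ [:: r, r, r & l2]) =
    imm g' (l1 ++ [:: r, r, r & l2]) *+ 2.
  rewrite mulr2n [X in _ = _ + X](imm_swap (k := Ordinal lt0)) // /imm.
  case: ifP => _; last by rewrite addr0.
  by rewrite -big_split; apply: eq_bigr => w _; rewrite /tl_act scalerDl.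
have E1 g' : imm (tl_act (Ordinal lt1) g') (l1 ++ [:: r, r, r & l2]) =
    imm g' (l1 ++ [:: r, r, r & l2]) *+ 2.
  rewrite mulr2n -cat_rcons [X in _ = _ + X](imm_swap (k := Ordinal lt1)) ?size_rcons //.
  rewrite /imm; case: ifP => _; last by rewrite addr0.
  by rewrite -big_split; apply: eq_bigr => w _; rewrite /tl_act scalerDl.
have : imm g (l1 ++ [:: r, r, r & l2]) *+ 2 *+ 2 *+ 2 = imm g (l1 ++ [:: r, r, r & l2]) *+ 2.
  rewrite -E0 -E1 -E0 /imm; case: ifP => // _.
  by apply: eq_bigr => w _; rewrite h.
move: (imm g _) => b /eqP; rewrite -!mulrnA -subr_eq0 -mulrnBr //.
have -> : (2 * 2 * 2 - 2 = 2 * 3)%N by [].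
rewrite -scaler_nat => /eqP/(canRL (scalerK _)) -> //; first by rewrite scaler0.
by rewrite pnatr_eq0.
Qed.

Lemma imm_ge3 g l1 m r l2 : tl_positive g -> (2 < m)%N ->
  imm g (l1 ++ nseq m r ++ l2) = 0.
Proof. by move=> gP; case: m => [|[|[|m]]] //= _; rewrite imm_triple. Qed.

Lemma imm_map (f : {lrmorphism B -> B}) g l :
  f (imm g l) = imm g (map (map_mx f) l).
Proof.
rewrite /imm size_map; case: eqP => [sz|]; last by rewrite raddf0.
rewrite raddf_sum; apply: eq_bigr => w _ /=.
rewrite linearZ rmorph_prod /=; congr (_ *: _); apply: eq_bigr => i _.
by rewrite (nth_map 0) ?sz // mxE.
Qed.

End Positive.

(** * Processing rows one variable at a time *)

Section MoreImm.
Variables (C : numClosedFieldType) (n : nat) (B : comAlgType C).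
Implicit Types (g : 'S_n -> C) (r : 'rV[B]_n) (l : seq 'rV[B]_n).

(** An exchange brings the isolated [q] one row closer to the pair; the other two terms vanish by
    induction, hence so does this one. *)
Lemma imm_triple_far g l1 q l3 l2 : tl_positive g ->
  imm g (l1 ++ q :: l3 ++ q :: q :: l2) = 0.
Proof.
elim: l3 l1 g => [|r l3 IH] l1 g gP; first exact: imm_triple.
have [g' g'P /(_ l1 r q (l3 ++ q :: q :: l2) erefl)] := imm_exchange B (size l1) gP.
rewrite -!(cat_rcons r l1) !IH // add0r => e.
by rewrite /= e.
Qed.

(** By multilinearity: every term in [y] contains a third row [q]. *)
Lemma imm_absorb g l1 m (M q : 'rV[B]_n) (y : B) l2 : tl_positive g ->
  imm g (l1 ++ nseq m (M - y *: q) ++ q :: q :: l2) =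
  imm g (l1 ++ nseq m M ++ q :: q :: l2).
Proof.
move=> gP; elim: m l1 => [|m IH] l1 //=.
by rewrite immB immZ imm_triple_far // mulr0 subr0 -!(cat_rcons M) IH.
Qed.

End MoreImm.

Definition addk (f : nat -> nat) (k u : nat) : nat -> nat :=
  fun h => if h == k then (f h + u)%N else f h.
Definition setk (f : nat -> nat) (k u : nat) : nat -> nat :=
  fun h => if h == k then u else f h.

Section Column.
Variables (C : numClosedFieldType) (n : nat) (B : comAlgType C).
Variables (N : nat) (x : nat -> B) (z : nat -> 'rV[B]_n).
Variables (tau : nat -> {lrmorphism B -> B}) (Alt : {additive B -> B}).
Variable Pos : B -> Prop.
Hypothesis tau_x : forall i h, (i.+1 < N)%N -> tau i (x h) = x (swapn i h).
Hypothesis tau_z : forall i h, (i.+1 < N)%N -> h != i -> map_mx (tau i) (z h) = z h.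
Hypothesis tau_m : forall i, (i.+1 < N)%N ->
  map_mx (tau i) (x i *: z i + x i.+1 *: z i.+1) = x i *: z i + x i.+1 *: z i.+1.
Hypothesis Alt_tau : forall i b, (i.+1 < N)%N -> Alt (tau i b) = - Alt b.
Hypothesis Pos0 : Pos 0.
Hypothesis PosD : forall b c, Pos b -> Pos c -> Pos (b + c).

(** [src] is the contribution of a ribbon starting at the next content; [P] and [Q] are the rows of
    ribbons inactive on both sides of the step, standing before and after the active ones. *)
Variables (src : 'rV[B]_n) (P Q : seq 'rV[B]_n).

Definition symr i (r : 'rV[B]_n) : bool := map_mx (tau i) r == r.
Definition syml i (l : seq 'rV[B]_n) := all (symr i) l.

Lemma syml_cat i l1 l2 : syml i (l1 ++ l2) = syml i l1 && syml i l2.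
Proof. exact: all_cat. Qed.

Lemma syml_cons i r l : syml i (r :: l) = symr i r && syml i l.
Proof. by []. Qed.

Lemma symr_z i h : (i.+1 < N)%N -> h != i -> symr i (z h).
Proof. by move=> lt ne; rewrite /symr tau_z. Qed.

Hypothesis src_sym : forall i, (i.+1 < N)%N -> symr i src.
Hypothesis P_sym : forall i, (i.+1 < N)%N -> syml i P.
Hypothesis Q_sym : forall i, (i.+1 < N)%N -> syml i Q.

Definition mon (kap : nat -> nat) : B := \prod_(h < N) x h ^+ kap h.
Definition altimm kap (g : 'S_n -> C) l : B := Alt (mon kap * imm g l).

Lemma mon_addk kap k u : (k < N)%N -> mon (addk kap k u) = mon kap * x k ^+ u.
Proof.
move=> lt; rewrite /mon (bigD1 (Ordinal lt)) //= [in RHS](bigD1 (Ordinal lt)) //=.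
rewrite /addk eqxx exprD mulrAC; congr (_ * _ * _).
by apply: eq_bigr => h; rewrite -val_eqE /= => /negPf->.
Qed.

Lemma tau_mon kap i : (i.+1 < N)%N -> kap i = kap i.+1 -> tau i (mon kap) = mon kap.
Proof.
move=> lt e; rewrite rmorph_prod /=.
have lt0 := ltnW lt.
rewrite (bigD1 (Ordinal lt0)) //= (bigD1 (Ordinal lt)) /= -?val_eqE /=; last by lia.
rewrite /mon [in RHS](bigD1 (Ordinal lt0)) //= [in RHS](bigD1 (Ordinal lt)) /= -?val_eqE /=;
  last by lia.
rewrite !rmorphXn /= !tau_x // /swapn !eqxx ifF; last by lia.
rewrite e mulrCA; do 2!congr (_ * _).
apply: eq_bigr => h /andP[]; rewrite -!val_eqE /= => h1 h2.
by rewrite rmorphXn /= tau_x // /swapn (negPf h1) (negPf h2).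
Qed.

Lemma imm_sym i g l : syml i l -> tau i (imm g l) = imm g l.
Proof.
move=> h; rewrite imm_map; congr imm.
by elim: l h => //= r l IH /andP[/eqP-> /IH->].
Qed.

Lemma Alt_sym i b : (i.+1 < N)%N -> tau i b = b -> Alt b = 0.
Proof.
move=> lt e; apply: mulr2_eq0; move: (Alt_tau b lt); rewrite e => {1}->.
by rewrite addNr.
Qed.

Lemma altimm_sym i kap g l : (i.+1 < N)%N -> kap i = kap i.+1 -> syml i l ->
  altimm kap g l = 0.
Proof.
move=> lt e s; apply: (Alt_sym lt).
by rewrite rmorphM /= tau_mon // imm_sym.
Qed.

Lemma altimmZ kap g l1 k r l2 : (k < N)%N ->
  altimm kap g (l1 ++ x k *: r :: l2) = altimm (addk kap k 1) g (l1 ++ r :: l2).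
Proof. by move=> lt; rewrite /altimm immZ mon_addk // expr1 mulrA. Qed.

Lemma altimmD kap g l1 r r' l2 :
  altimm kap g (l1 ++ (r + r') :: l2) =
  altimm kap g (l1 ++ r :: l2) + altimm kap g (l1 ++ r' :: l2).
Proof. by rewrite /altimm immD mulrDr raddfD. Qed.

Lemma altimm_ge3 kap g l1 m r l2 : tl_positive g -> (2 < m)%N ->
  altimm kap g (l1 ++ nseq m r ++ l2) = 0.
Proof. by move=> gP lt; rewrite /altimm imm_ge3 // mulr0 raddf0. Qed.

Lemma addk_addk f k u v : addk (addk f k u) k v =1 addk f k (u + v).
Proof. by move=> h; rewrite /addk; case: eqP => // _; rewrite addnA. Qed.

Lemma eq_altimm kap kap' g l : kap =1 kap' -> altimm kap g l = altimm kap' g l.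
Proof.
by move=> e; rewrite /altimm /mon; under eq_bigr do rewrite e.
Qed.

(* In the sorted order, smaller rows come first. *)
Lemma altimm_expand kap g l1 a k r l2 f (b : bool) : tl_positive g -> (k < N)%N ->
  let bx u := if b then nseq (f - u) a ++ nseq u r else nseq u r ++ nseq (f - u) a in
  (forall g' u, tl_positive g' -> (u <= f <= 2)%N ->
     Pos (altimm (addk kap k u) g' (l1 ++ bx u ++ l2))) ->
  Pos (altimm kap g (l1 ++ nseq f (a + x k *: r) ++ l2)).
Proof.
move=> gP lt; case: f => [|[|[|f]]] /= H.
- by have := H g 0%N gP isT; rewrite (@eq_altimm _ kap) ?if_same // => h;
  rewrite /addk addn0 if_same.
- rewrite altimmD altimmZ //; apply: PosD.
    have := H g 0%N gP isT; rewrite (@eq_altimm _ kap) ?cats0 ?if_same // => h.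
    by rewrite /addk addn0 if_same.
  by have := H g 1%N gP isT; rewrite /= if_same.
- have [g' g'P ex] := imm_exchange B (size l1) gP.
  rewrite altimmD -!(cat_rcons a) -!(cat_rcons (x k *: r)) !altimmD !cat_rcons.
  rewrite !altimmZ // -!(cat_rcons a) -!(cat_rcons r) !altimmZ // !cat_rcons.
  rewrite (eq_altimm _ _ (addk_addk _ _ _ _)).
  rewrite addrA -[X in Pos (X + _)]addrA; apply: PosD; last first.
    by have := H g 2%N gP isT; rewrite /= if_same.
  apply: PosD.
    have := H g 0%N gP isT; rewrite (@eq_altimm _ kap) ?cats0 ?if_same // => h.
    by rewrite /addk addn0 if_same.
  (* The two mixed terms add up to one immanant for [g'], written in the order that [b] asks for. *)
  have := H g' 1%N g'P isT; rewrite /altimm -raddfD -mulrDr; case: b {H} => /=.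
    by rewrite ex.
  by rewrite addrC ex.
- by rewrite -[_ :: _]/(nseq f.+3 _ ++ l2) altimm_ge3.
Qed.

(* [M] collects both [x i *: z i] and [x i.+1 *: z i.+1]; removing the latter
   from two equal rows costs a term in which both remaining rows are [z i.+1]. *)
Lemma altimm_tight i kap g l1 M l2 : tl_positive g -> (i.+1 < N)%N -> kap i = (kap i.+1).+1 ->
  syml i l1 -> syml i l2 -> symr i M ->
  altimm kap g (l1 ++ M :: M :: l2) =
  altimm kap g (l1 ++ (M - x i.+1 *: z i.+1) :: (M - x i.+1 *: z i.+1) :: l2) +
  altimm (addk (addk kap i 1) i.+1 1) g (l1 ++ z i.+1 :: z i.+1 :: l2).
Proof.
move=> gP lt kE s1 s2 sM; set q := z i.+1; set y := x i.+1.
have sq : symr i q by rewrite /symr tau_z //; lia.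
rewrite /altimm !mon_addk ?(ltnW lt) // !expr1.
have -> : imm g (l1 ++ (M - y *: q) :: (M - y *: q) :: l2) =
    imm g (l1 ++ M :: M :: l2) - y * (imm g (l1 ++ M :: q :: l2) + imm g (l1 ++ q :: M :: l2))
    + y * y * imm g (l1 ++ q :: q :: l2).
  rewrite immB immZ -!(cat_rcons M) -!(cat_rcons q) !immB !immZ !cat_rcons.
  by ring.
set F0 := imm g (l1 ++ M :: M :: l2); set F1 := _ + imm g (l1 ++ q :: M :: l2).
set F2 := imm g (l1 ++ q :: q :: l2); set m := mon kap.
(* The factor [y] closes the gap of one between the exponents. The term linear in [y] is therefore
   antisymmetrized to 0, and in the quadratic term one [y] turns into [x i] at the cost of a
   sign. *)
have mE : tau i (m * y) = m * y.
  rewrite -[y]expr1 -mon_addk // tau_mon // /addk eqxx ifF; last by lia.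
  by rewrite kE addn1.
have Fs1 : tau i F1 = F1.
  by rewrite rmorphD /= !imm_sym // /syml all_cat /= sM sq; apply/and3P.
have Fs2 : tau i F2 = F2 by rewrite imm_sym // /syml all_cat /= sq; apply/and3P.
have e1 : Alt (m * y * F1) = 0 by apply: (Alt_sym lt); rewrite rmorphM /= mE Fs1.
have e2 : Alt (m * y * (y * F2)) = - Alt (m * y * (x i * F2)).
  rewrite -(Alt_tau _ lt); congr (Alt _).
  rewrite [RHS]rmorphM /= mE [in RHS]rmorphM /= Fs2 tau_x // /swapn eqxx.
  by congr (_ * (_ * _)).
have -> : m * (F0 - y * F1 + y * y * F2) = m * F0 - m * y * F1 + m * y * (y * F2) by ring.
rewrite raddfD raddfB /= e1 e2 subr0 -addrA addrC.
have -> : m * x i * y * F2 = m * y * (x i * F2) by ring.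
by rewrite addNr add0r.
Qed.

(* Two copies of [z i.+1] absorb everything that is not symmetric in the rows
   that precede them. *)
Lemma altimm_absorb i kap g l1 m (M : 'rV[B]_n) (b : B) l2 : tl_positive g -> (i.+1 < N)%N ->
  kap i = kap i.+1 -> syml i l1 -> syml i l2 -> symr i M ->
  altimm kap g (l1 ++ nseq m (M - b *: z i.+1) ++ z i.+1 :: z i.+1 :: l2) = 0.
Proof.
move=> gP lt kE s1 s2 sM; rewrite /altimm imm_absorb //.
have sq : symr i (z i.+1) by rewrite /symr tau_z //; lia.
apply: (altimm_sym _ lt) => //; move: s1 s2; rewrite /syml !all_cat /= all_nseq sM orbT.
by move=> -> ->; rewrite sq.
Qed.

Definition zl U a b : seq 'rV[B]_n := flatten [seq nseq (U h) (z h) | h <- index_iota a b].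

Definition dominant (kap S : nat -> nat) : Prop :=
  forall h, (h.+1 < N)%N -> (kap h.+1 + (S h != 0%N) < kap h)%N.

Lemma zl_recl U a b : (a < b)%N -> zl U a b = nseq (U a) (z a) ++ zl U a.+1 b.
Proof. by move=> lt; rewrite /zl /index_iota -(subnSK lt). Qed.

Lemma zl_setk U k u a b : ~~ (a <= k < b)%N -> zl (setk U k u) a b = zl U a b.
Proof.
move=> nk; congr flatten; apply/eq_in_map => h; rewrite mem_index_iota /setk => hin.
by case: eqP => // hk; rewrite -hk hin in nk.
Qed.

Lemma zl_set U k u b : (k < b)%N -> zl (setk U k u) k b = nseq u (z k) ++ zl U k.+1 b.
Proof. by move=> lt; rewrite zl_recl // zl_setk ?ltnn // /setk eqxx. Qed.

Lemma syml_zl i U a b : (i.+1 < N)%N -> ~~ (a <= i < b)%N || (U i == 0%N) -> syml i (zl U a b).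
Proof.
move=> lt nk; apply/allP => r /flatten_mapP[h]; rewrite mem_index_iota => hin.
rewrite mem_nseq => /andP[Uh /eqP->]; rewrite /symr tau_z //.
apply/eqP => hi; move: nk Uh; rewrite -hi hin /= => /eqP->; lia.
Qed.

(** On a right step, the row of entry [h] at the next content is [Yv h.+1], since entries [h' <= h]
    may come before [h]. *)
Definition Yv k : 'rV[B]_n := src + \sum_(0 <= h < k) x h *: z h.
Definition Yl S k : seq 'rV[B]_n := flatten [seq nseq (S h) (Yv h.+1) | h <- index_iota 0 k].

Lemma YvS k : Yv k.+1 = Yv k + x k *: z k.
Proof. by rewrite /Yv big_nat_recr //= addrA. Qed.

Lemma YlS S k : Yl S k.+1 = Yl S k ++ nseq (S k) (Yv k.+1).
Proof.
rewrite /Yl /index_iota !subn0; have -> : iota 0 k.+1 = iota 0 k ++ [:: k] by rewrite -addn1 iotaD.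
by rewrite map_cat flatten_cat /= cats0.
Qed.

(** Only for [k = i.+1] does the partial sum contain [x i *: z i] without [x i.+1 *: z i.+1]. *)
Lemma symr_Yv i k : (i.+1 < N)%N -> k != i.+1 -> symr i (Yv k).
Proof.
move=> lt; have low j : (j <= i)%N -> symr i (Yv j).
  elim: j => [|j IH] le; first by rewrite /Yv big_geq // addr0 src_sym.
  rewrite /symr YvS map_mxD (eqP (IH _)) ?(ltnW le) // map_mxZ /= tau_x // tau_z //; last lia.
  by rewrite /swapn !ifF //; lia.
case: (leqP k i) => [/low //|]; rewrite leq_eqVlt eq_sym => /orP[/eqP->|]; first by rewrite eqxx.
move=> + _; elim: k => // k IH; rewrite ltnS leq_eqVlt => /orP[/eqP<-|le].
  rewrite /symr 2!YvS -addrA map_mxD tau_m //.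
  by rewrite (eqP (low _ _)).
rewrite /symr YvS map_mxD (eqP (IH _)) // map_mxZ /= tau_x // tau_z //; last lia.
by rewrite /swapn !ifF //; lia.
Qed.

Lemma syml_Yl i S k : (i.+1 < N)%N -> (k <= i)%N || (S i == 0%N) -> syml i (Yl S k).
Proof.
move=> lt nk; apply/allP => r /flatten_mapP[h]; rewrite mem_index_iota => hin.
rewrite mem_nseq => /andP[Sh /eqP->]; apply: symr_Yv => //.
by apply/eqP => -[hi]; move: nk; rewrite -hi; move: Sh; case: eqP => [->|] //; lia.
Qed.

Lemma addk0 f k : addk f k 0 =1 f.
Proof. by move=> h; rewrite /addk addn0 if_same. Qed.

(** * One step of the ribbon to the right *)

Section StepRight.
Hypothesis final : forall g kap U f, tl_positive g -> dominant kap U ->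
  Pos (altimm kap g (P ++ nseq f src ++ zl U 0 N ++ Q)).

(** Entries are processed from [N.-1] down to 0. Rows of entries below [i] still have the form
    [Yv h.+1], the rows [z h] with [h >= i] have been taken out, and the [v] rows [Yv i] are what
    remains of the processed ones. The induction is strong because the correction term settles two
    entries at once. *)
Lemma up_state i g kap U S v : (i <= N)%N -> tl_positive g ->
  (forall h, (i <= h)%N -> (h.+1 < N)%N -> (kap h.+1 + (U h != 0%N) < kap h)%N) ->
  ((0 < i)%N -> (i < N)%N -> (kap i < kap i.-1)%N) ->
  (forall h, (h.+1 < i)%N -> (kap h.+1 + (S h != 0%N) < kap h)%N) ->
  Pos (altimm kap g (P ++ Yl S i ++ nseq v (Yv i) ++ zl U i N ++ Q)).
Proof.
elim/ltn_ind: i g kap U v => -[|k] IH g kap U v iN gP c1 c2 c3.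
  rewrite /Yl /Yv !big_geq //= addr0; apply: final => // h lt; exact: c1.
have good g' u v' : tl_positive g' -> ((0 < k)%N -> (kap k + u < kap k.-1)%N) ->
    Pos (altimm (addk kap k u) g' (P ++ Yl S k ++ nseq v' (Yv k) ++
           nseq u (z k) ++ zl U k.+1 N ++ Q)).
  move=> g'P lt; rewrite [nseq u _ ++ _]catA -zl_set //; apply: IH => //.
  - exact: ltnW.
  - move=> h; rewrite leq_eqVlt => /orP[/eqP<-|kh] hN.
      rewrite /addk /setk eqxx ifF; last by lia.
      by have := c2 isT hN => /=; lia.
    rewrite /addk /setk !ifF; first (by apply: c1); lia.
  - by move=> k0 _; rewrite /addk eqxx ifF; [exact: lt|lia].
  - by move=> h hk; rewrite /addk !ifF; first (by apply: c3; lia); lia.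
rewrite YlS -!catA [nseq _ _ ++ nseq _ _ ++ _]catA -nseqD.
move: {v}(S k + v)%N => f; rewrite [P ++ _]catA.
have expand : (forall g' u, tl_positive g' -> (u <= f <= 2)%N ->
    ~~ ((0 < k)%N ==> (kap k + u < kap k.-1)%N) ->
    Pos (altimm (addk kap k u) g' (P ++ Yl S k ++ nseq (f - u) (Yv k) ++
           nseq u (z k) ++ zl U k.+1 N ++ Q))) ->
  Pos (altimm kap g ((P ++ Yl S k) ++ nseq f (Yv k.+1) ++ zl U k.+1 N ++ Q)).
  move=> h; rewrite YvS; apply: (@altimm_expand _ _ _ _ _ _ _ f true) => //= g' u g'P uf.
  rewrite -!catA; have [/implyP lt|] := boolP ((0 < k)%N ==> (kap k + u < kap k.-1)%N).
    exact: good.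
  by move=> n'; apply: h.
case: k => [|j] in iN c1 c2 c3 IH good expand *.
  by apply: expand => g' u g'P uf; rewrite implyFb.
have c3j := c3 j (ltnSn _).
have [tight|loose] := eqVneq (kap j) (kap j.+1).+1; last first.
  (* With a gap of at least two, the exponents can only meet when two rows [z j.+1] are taken; these
     then absorb the asymmetric part of the rows [Yv j.+1]. *)
  apply: expand => g' u g'P uf /=; rewrite -leqNgt => ge.
  have u2 : u = 2%N by lia.
  have f2 : f = 2%N by lia.
  rewrite f2 u2 subnn /= YlS -!catA catA.
  have -> : Yv j.+1 = Yv j.+2 - x j.+1 *: z j.+1 by rewrite (YvS j.+1) addrK.
  rewrite (altimm_absorb (i := j)) //.
  - by rewrite /addk ifF ?eqxx; lia.
  - by rewrite /syml all_cat; apply/andP; split; [exact: P_sym|apply: syml_Yl; rewrite ?leqnn].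
  - rewrite /syml all_cat; apply/andP; split; [apply: syml_zl => //; lia|exact: Q_sym].
  - by apply: symr_Yv => //; lia.
(* A gap of one excludes rows of entry [j], so all other rows are fixed by [tau j]. *)
have Sj : S j = 0%N by move: c3j; rewrite tight; case: (S j) => // m; rewrite ltnS /=; lia.
have YS : Yl S j.+1 = Yl S j by rewrite YlS Sj cats0.
have symP : syml j (P ++ Yl S j.+1).
  by rewrite /syml all_cat; apply/andP; split; [exact: P_sym|apply: syml_Yl; rewrite ?Sj ?orbT].
have symQ : syml j (zl U j.+2 N ++ Q).
  by rewrite /syml all_cat; apply/andP; split; [apply: syml_zl => //; lia|exact: Q_sym].
have zero : forall f' g', tl_positive g' ->
    Pos (altimm kap g' ((P ++ Yl S j.+1) ++ nseq f' (Yv j.+1) ++ zl U j.+2 N ++ Q)).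
  move=> f' g' g'P; have := good g' 0%N f' g'P; rewrite (eq_altimm _ _ (addk0 _ _)) -catA.
  by apply=> _ /=; lia.
case: f => [|[|[|f]]] in expand *.
- exact: (zero 0%N).
- rewrite YvS altimmD altimmZ //; apply: PosD; first exact: (zero 1%N).
  rewrite (altimm_sym (i := j)) //.
    by rewrite /addk eqxx ifF ?addn1; lia.
  rewrite /syml all_cat /=; move: symP symQ; rewrite /syml => -> ->.
  by rewrite /symr tau_z ?eqxx //; lia.
- have sM : symr j (Yv j.+2) by apply: symr_Yv => //; lia.
  rewrite (altimm_tight gP iN tight symP symQ sM) (YvS j.+1) addrK.
  apply: PosD; first exact: (zero 2%N).
  (* The correction term raises the exponent of [x j]. Either it meets that of [x j.-1] and
     [tau j.-1] kills the term, or the induction hypothesis applies at [j], with no row [z j] and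
     two rows [z j.+1]. *)
  rewrite -catA YS; have [/andP[j0 /eqP tight']|nt] := boolP ((0 < j)%N && (kap j.-1 == (kap j).+1)).
    case: j j0 => // l _ in iN c1 c2 c3 IH tight Sj YS symP symQ tight' {c3j good zero expand sM} *.
    have Sl : S l = 0%N.
      by have := c3 l (ltnW (ltnSn _)); rewrite /= in tight'; case: (S l) => // m; lia.
    have lN : (l.+1 < N)%N by exact: ltnW.
    rewrite (altimm_sym (i := l)) //.
      by rewrite /addk !eqxx ifF ?ifF; rewrite /= in tight'; lia.
    rewrite syml_cat P_sym // syml_cat syml_Yl ?Sl ?orbT // 2!syml_cons syml_cat Q_sym //.
    by rewrite symr_z 1?syml_zl //; lia.
  have <- : zl (setk (setk U j 0) j.+1 2) j N ++ Q = [:: z j.+1, z j.+1 & zl U j.+2 N ++ Q].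
    rewrite zl_recl 1?ltnW // zl_set // zl_setk; last by lia.
    by rewrite /setk eqxx ifF //; lia.
  apply: (IH j (ltnW (ltnSn _)) g _ _ 0%N) => //.
  - by do 2!apply: ltnW.
  - have ne a b : (a < b)%N -> (a == b = false) * (b == a = false) by move=> ?; split; lia.
    move=> h jh hN; rewrite /addk /setk; have [->|hj] := eqVneq h j.
      by rewrite !eqxx !(ne j j.+1) //=; lia.
    have [->|hj1] := eqVneq h j.+1.
      by have := c2 isT; rewrite !(ne j j.+2) ?(ne j.+1 j.+2) //=; lia.
    have lt : (j.+1 < h)%N by lia.
    by have := c1 h lt hN; rewrite !(ne j _) ?(ne j.+1 h.+1) //; lia.
  - move=> j0 _; have := c3 j.-1; rewrite (prednK j0) => /(_ (ltnW (ltnSn _))).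
    by move: nt; rewrite j0 /addk eqxx !ifF /=; lia.
  - move=> h hj; have /c3 : (h.+1 < j.+2)%N by lia.
    by rewrite /addk !ifF; lia.
- by rewrite altimm_ge3.
Qed.
End StepRight.

(** * One step of the ribbon upwards *)

Lemma altimm_flip i kap g l : (i.+1 < N)%N -> kap i = (kap i.+1).+1 -> syml i l ->
  altimm (addk kap i.+1 2) g l = - altimm (addk (addk kap i 1) i.+1 1) g l.
Proof.
move=> lt kE sl; rewrite /altimm !mon_addk ?(ltnW lt) // -(Alt_tau _ lt); congr (Alt _).
have mE : tau i (mon kap * x i.+1) = mon kap * x i.+1.
  rewrite -[x i.+1]expr1 -mon_addk // tau_mon // /addk eqxx ifF; last by lia.
  by rewrite kE addn1.
have -> : mon kap * x i ^+ 1 * x i.+1 ^+ 1 * imm g l =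
  mon kap * x i.+1 * (x i * imm g l) by ring.
rewrite rmorphM /= mE rmorphM /= imm_sym // tau_x // /swapn eqxx.
by ring.
Qed.

(* Two rows [z i.+1] can be traded for a cap joining rows [z i] and [z i.+1]. *)
Lemma altimm_cap i kap g l1 l2 : tl_positive g -> (i.+1 < N)%N -> kap i = (kap i.+1).+1 ->
  syml i l1 -> syml i l2 -> exists2 g', tl_positive g' &
  altimm kap g (l1 ++ z i.+1 :: z i.+1 :: l2) *+ 2 =
  altimm kap g' (l1 ++ z i :: z i.+1 :: l2).
Proof.
move=> gP lt kE s1 s2; have [g' g'P ex] := imm_exchange B (size l1) gP.
exists g' => //; rewrite -raddfMn -mulrnAr /altimm -ex //.
set q := z i.+1; set p := z i; set y := x i.+1.
pose kap0 h := (kap h - (h == i))%N.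
have kap0E : kap =1 addk kap0 i 1.
  by move=> h; rewrite /addk /kap0; case: eqP => [->|] /=; lia.
have -> : mon kap = mon kap0 * x i.
  by rewrite -[x i]expr1 -mon_addk ?(ltnW lt) // /mon; apply: eq_bigr => h _; rewrite kap0E.
have m0E : tau i (mon kap0) = mon kap0.
  by rewrite tau_mon // /kap0 eqxx kE (_ : (i.+1 == i) = false) /=; lia.
(* [M] is fixed by [tau i], so after substituting [x i *: p = M - y *: q] only the term with two
   rows [q] survives antisymmetrization. *)
pose M := x i *: p + y *: q.
have xp : x i *: p = M - y *: q by rewrite /M addrK.
have -> : mon kap0 * x i * (imm g (l1 ++ p :: q :: l2) + imm g (l1 ++ q :: p :: l2)) =
  mon kap0 * (imm g (l1 ++ M :: q :: l2) + imm g (l1 ++ q :: M :: l2)) -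
  mon kap0 * (y * (imm g (l1 ++ q :: q :: l2) *+ 2)).
  rewrite mulrDr -mulrA -immZ -[in X in _ + X]mulrA -cat_rcons -immZ cat_rcons xp.
  by rewrite -[in X in _ + mon _ * imm _ X]cat_rcons !immB !immZ !cat_rcons; ring.
have sq : symr i q by rewrite symr_z //; lia.
have sM : symr i M by rewrite /symr tau_m.
rewrite raddfB /= [X in _ = X - _](Alt_sym lt); last first.
  by rewrite rmorphM /= m0E rmorphD /= !imm_sym // !(syml_cat, syml_cons) ?s1 ?s2 ?sq ?sM.
rewrite sub0r -(Alt_tau _ lt); congr (Alt _).
rewrite [RHS]rmorphM /= m0E [in RHS]rmorphM /= [in RHS]rmorphMn /= imm_sym; last first.
  by rewrite !(syml_cat, syml_cons) s1 s2 sq.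
have -> : tau i y = x i by rewrite /y tau_x // /swapn eqxx ifF //; lia.
by ring.
Qed.

(** Counterpart of [Yv]: on an upward step the row of entry [h] at the next content is [Wv h.+1],
    since only entries [h' > h] may come before [h]. *)
Definition Wv k : 'rV[B]_n := src + \sum_(k <= h < N) x h *: z h.
Definition Wl S k : seq 'rV[B]_n := flatten [seq nseq (S h) (Wv h.+1) | h <- index_iota k N].

Lemma WvS k : (k < N)%N -> Wv k = Wv k.+1 + x k *: z k.
Proof. by move=> lt; rewrite /Wv big_ltn // addrCA addrC. Qed.

Lemma Wv_end : Wv N = src.
Proof. by rewrite /Wv big_geq // addr0. Qed.

Lemma WlS S k : (k < N)%N -> Wl S k = nseq (S k) (Wv k.+1) ++ Wl S k.+1.
Proof. by move=> lt; rewrite /Wl /index_iota -(subnSK lt). Qed.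

Lemma Wl_end S : Wl S N = [::].
Proof. by rewrite /Wl /index_iota subnn. Qed.

Lemma zlSr U b : zl U 0 b.+1 = zl U 0 b ++ nseq (U b) (z b).
Proof.
rewrite /zl /index_iota !subn0; have -> : iota 0 b.+1 = iota 0 b ++ [:: b] by rewrite -addn1 iotaD.
by rewrite map_cat flatten_cat /= cats0.
Qed.

Lemma symr_Wv i k : (i.+1 < N)%N -> (k <= N)%N -> k != i.+1 -> symr i (Wv k).
Proof.
move=> lt kN ne; have E : Wv k = src + (Yv N - Yv k).
  by rewrite /Wv /Yv [in RHS](big_cat_nat (n := k)) //= opprD addrACA subrr add0r addrAC subrr add0r.
rewrite /symr E map_mxD map_mxB (eqP (src_sym lt)).
by rewrite (eqP (symr_Yv lt ne)) (eqP (symr_Yv (k := N) lt _)) //; lia.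
Qed.

Lemma syml_Wl i S k : (i.+1 < N)%N -> (i < k)%N || (S i == 0%N) -> syml i (Wl S k).
Proof.
move=> lt nk; apply/allP => r /flatten_mapP[h]; rewrite mem_index_iota => hin.
rewrite mem_nseq => /andP[Sh /eqP->]; apply: symr_Wv => //; first by lia.
by apply/eqP => -[hi]; move: nk; rewrite -hi; move: Sh; case: eqP => [->|] //; lia.
Qed.

Section StepUp.
Hypothesis final : forall g kap U f, tl_positive g -> dominant kap U ->
  Pos (altimm kap g (P ++ zl U 0 N ++ nseq f src ++ Q)).

(* What is known about rows [i.-1] and [i] when rows below [i] have been
   processed and [v] copies of [Wv i] are left. *)
Definition down_pre i (kap U : nat -> nat) v : Prop :=
  [\/ v = 0%N /\ (kap i + (U i.-1 != 0%N) < kap i.-1)%N,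
      (kap i + 2 + U i.-1 <= kap i.-1)%N,
      [/\ kap i.-1 = (kap i).+1, U i.-1 = 0%N &
          (v < 2)%N \/ [/\ (1 < i)%N, kap i.-2 = (kap i.-1).+1 & U i.-2 = 0%N]]
    | [/\ U i.-1 = 2%N, kap i.-1 = (kap i).+3, (1 < i)%N,
          kap i.-2 = (kap i.-1).+1 & U i.-2 = 0%N]].

(** Going upwards, the pair [kap j], [U j] is already fixed when rows [z j.+1] are taken. The cases
    of [down_pre] are those in which every choice that breaks dominance gives 0. *)
Lemma down_zero j kap U v u g R : (j.+1 < N)%N -> tl_positive g ->
  down_pre j.+1 kap U v -> (u <= v)%N -> (u <= 2)%N ->
  (forall i, (i <= j)%N -> (i.+1 < N)%N -> syml i R) ->
  (kap j <= kap j.+1 + u + (U j != 0%N))%N ->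
  altimm (addk kap j.+1 u) g (P ++ zl U 0 j.+1 ++ nseq u (z j.+1) ++ R) = 0.
Proof.
move=> jN gP pre uv u2 sR bad.
have sq : symr j (z j.+1) by rewrite symr_z //; lia.
have nej : (j == j.+1) = false by lia.
have nej' : (j.+1 == j) = false by lia.
case: pre => /=.
- by case=> v0 lt; exfalso; lia.
- move=> le; have -> : u = 2%N by move: bad; case: (U j) le => [|[|m]] /=; lia.
  rewrite zlSr; have : (U j <= 1)%N by move: bad; case: (U j) le => [|[|m]] /=; lia.
  have s0 : syml j (P ++ zl U 0 j).
    by rewrite syml_cat P_sym // syml_zl // ltnn andbF.
  have eU : kap j = (kap j.+1 + 2 + U j)%N by move: bad; case: (U j) le => [|[|m]] /=; lia.
  case: (U j) eU => [|[|m]] /= eU // _.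
    rewrite cats0 -[_ :: _]/([:: z j.+1; z j.+1] ++ R) catA.
    apply: (altimm_sym (i := j)) => //; first by rewrite /addk nej eqxx; lia.
    by rewrite !syml_cat -syml_cat s0 sR // /syml /= sq.
  (* One factor [x j] moves from the monomial to the row [z j], which equalizes the exponents;
     [x j *: z j] is symmetric up to a multiple of [z j.+1], which the two rows [z j.+1] absorb. *)
  pose kap0 h := (kap h - (h == j) + 2 * (h == j.+1))%N.
  rewrite -catA /= catA (@eq_altimm _ (addk kap0 j 1)); last first.
    move=> h; rewrite /addk /kap0; case: (h =P j) => [->|_] /=; first by rewrite nej; lia.
    by case: eqP => _ /=; lia.
  rewrite -altimmZ 1?ltnW //.
  have -> : x j *: z j = (x j *: z j + x j.+1 *: z j.+1) - x j.+1 *: z j.+1 by rewrite addrK.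
  apply: (@altimm_absorb j kap0 _ _ 1 _ _ _) => //.
  - by rewrite /kap0 eqxx nej nej' eqxx /=; lia.
  - exact: sR.
  - by rewrite /symr tau_m.
- move=> [kj Uj vv]; have szl : syml j (zl U 0 j.+1) by rewrite syml_zl // Uj eqxx orbT.
  case: u uv u2 bad vv => [|[|[|u]]] uv u2 bad vv //.
  + by exfalso; lia.
  + apply: (altimm_sym (i := j)) => //; first by rewrite /addk nej eqxx; lia.
    by rewrite 2!syml_cat P_sym // szl syml_cat sR // /syml /= sq.
  + case: vv => [|[j1 kj1 Uj1]]; first by lia.
    (* After exchanging [x j] and [x j.+1], the exponent of [x j] is raised by one and meets that of
       [x j.-1]. *)
    rewrite altimm_flip //; last first.
      by rewrite 2!syml_cat P_sym // szl syml_cat sR // /syml /= sq.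
    case: j j1 => // l _ in jN sR bad sq nej nej' kj Uj szl kj1 Uj1 *; rewrite /= in kj1 Uj1.
    rewrite (altimm_sym (i := l)) ?oppr0 1?ltnW //.
      have [n1 n2] : (l == l.+1) = false /\ (l == l.+2) = false by lia.
      by rewrite /addk nej n1 n2 eqxx; lia.
    have lN : (l.+1 < N)%N by exact: ltnW.
    rewrite 2!syml_cat P_sym // syml_zl ?Uj1 ?eqxx ?orbT // syml_cat sR //.
    by rewrite /syml /= symr_z //; lia.
- move=> [Uj kj j1 kj1 Uj1]; have -> : u = 2%N by move: bad; rewrite Uj /=; lia.
  case: j j1 => // l _ in jN sR bad sq nej nej' kj Uj kj1 Uj1 *; rewrite /= in kj1 Uj1.
  have lN : (l.+1 < N)%N by exact: ltnW.
  rewrite zlSr Uj zlSr Uj1 cats0 /= -catA /= catA.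
  have s1 : syml l (P ++ zl U 0 l) by rewrite syml_cat P_sym // syml_zl // ltnn andbF.
  have s1' : syml l.+1 (P ++ zl U 0 l) by rewrite syml_cat P_sym // syml_zl //; lia.
  have s2 : syml l (z l.+2 :: z l.+2 :: R) by rewrite 2!syml_cons sR // symr_z //; lia.
  have kt : addk kap l.+2 2 l = (addk kap l.+2 2 l.+1).+1.
    by rewrite /addk !ifF; lia.
  (* With [z l, z l.+1] in place of two rows [z l.+1], moving a single factor [x l.+1] equalizes the
     exponents, and the rows [z l.+2] absorb as before. *)
  have [g' g'P e] := altimm_cap gP lN kt s1 s2.
  suff e0 : altimm (addk kap l.+2 2) g' ((P ++ zl U 0 l) ++ z l :: z l.+1 :: z l.+2 :: z l.+2 :: R) = 0.
    by apply: mulr2_eq0; rewrite -mulr2n e.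
  pose kap0 h := (kap h - (h == l.+1) + 2 * (h == l.+2))%N.
  rewrite (@eq_altimm _ (addk kap0 l.+1 1)); last first.
    move=> h; rewrite /addk /kap0; case: (h =P l.+1) => [->|_] /=; first by rewrite nej; lia.
    by case: eqP => _ /=; lia.
  rewrite -cat_rcons -altimmZ 1?ltnW //.
  have -> : x l.+1 *: z l.+1 = (x l.+1 *: z l.+1 + x l.+2 *: z l.+2) - x l.+2 *: z l.+2 by rewrite addrK.
  apply: (@altimm_absorb l.+1 kap0 _ _ 1 _ _ _) => //.
  - by rewrite /kap0 eqxx nej nej' eqxx /=; lia.
  - by rewrite /syml all_rcons -/(syml _ _) s1' symr_z //; lia.
  - exact: sR.
  - by rewrite /symr tau_m.
Qed.

Lemma syml_nseq i m r : symr i r -> syml i (nseq m r).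
Proof. by move=> h; rewrite /syml all_nseq h orbT. Qed.

(** Counterpart of [up_state] with entries processed from 0 upwards. [down_pre] guarantees in
    advance that the choices closing the gap between [kap i.-1] and [kap i] contribute nothing. *)
Lemma down_state i g kap U S v : (i <= N)%N -> tl_positive g ->
  (forall h, (h.+1 < i)%N -> (kap h.+1 + (U h != 0%N) < kap h)%N) ->
  (forall h, (i <= h)%N -> (h.+1 < N)%N -> (kap h.+1 + (S h != 0%N) < kap h)%N) ->
  ((0 < i)%N -> (i < N)%N -> down_pre i kap U v) ->
  Pos (altimm kap g (P ++ zl U 0 i ++ nseq v (Wv i) ++ Wl S i ++ Q)).
Proof.
have [m le] := ubnP (N - i)%N; elim: m i le g kap U v => // m IH k le g kap U v.
rewrite leq_eqVlt => /orP[/eqP-> gP c1 c3 c2|kN gP c1 c3 c2].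
  by rewrite Wl_end Wv_end; apply: final.
rewrite WlS // -!catA.
pose pok u := (0 < k)%N ==> (kap k + u + (U k.-1 != 0%N) < kap k.-1)%N.
have zero g' u R : tl_positive g' -> ~~ pok u -> (u <= v)%N -> (u <= 2)%N ->
    (forall i, (i < k)%N -> (i.+1 < N)%N -> syml i R) ->
    Pos (altimm (addk kap k u) g' (P ++ zl U 0 k ++ nseq u (z k) ++ R)).
  rewrite /pok; case: k kN c2 {le c1 c3 pok} => // j jN c2 g'P /=; rewrite -leqNgt => bad uv u2 sR.
  by rewrite (down_zero jN g'P (c2 isT jN) uv).
have n1 h : (h == h.+1) = false by lia.
have n1' h : (h.+1 == h) = false by lia.
have step : (forall u, (u <= v)%N -> (u <= 2)%N -> pok u -> (k.+1 < N)%N ->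
      down_pre k.+1 (addk kap k u) (setk U k u) (v - u + S k)) ->
    Pos (altimm kap g (P ++ zl U 0 k ++ nseq v (Wv k) ++ nseq (S k) (Wv k.+1) ++ Wl S k.+1 ++ Q)).
  move=> pre; rewrite WvS // [P ++ _]catA.
  apply: (@altimm_expand _ _ _ _ _ _ _ v false) => //= g' u g'P uv; rewrite -!catA.
  have [ok|bad] := boolP (pok u); last first.
    apply: zero => //; try lia.
    move=> i ik iN; rewrite syml_cat syml_nseq ?symr_Wv //; try lia.
    rewrite syml_cat syml_nseq ?symr_Wv //; try lia.
    by rewrite syml_cat Q_sym // syml_Wl //; lia.
  rewrite [nseq (v - u) _ ++ _]catA -nseqD [zl U 0 k ++ _]catA.
  have -> : zl U 0 k ++ nseq u (z k) = zl (setk U k u) 0 k.+1.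
    by rewrite zlSr zl_setk ?ltnn ?andbF // /setk eqxx.
  apply: IH => //; first by lia.
  - move=> h hk; rewrite /setk /addk; have [hk'|hk'] := eqVneq h.+1 k.
      by rewrite -hk' n1; move: ok; rewrite /pok -hk' /=; lia.
    by rewrite (_ : (h == k) = false); [apply: c1|]; lia.
  - move=> h kh hN; rewrite /addk !ifF; [|lia..]; by apply: c3 => //; lia.
  - by move=> _ lt; apply: pre => //; lia.
have [kN1|kN1] := leqP N k.+1; first by apply: step => u _ _ _; lia.
have c3k := c3 k (leqnn _) kN1.
have [tight|loose] := eqVneq (kap k) (kap k.+1).+1; last first.
  by apply: step => u uv u2 ok _; constructor 2; rewrite /addk /setk /= n1' eqxx; lia.
have Sk : S k = 0%N by lia.
(* Entries [k] and [k.+1] are processed together, as the terms of [altimm_tight] require. *)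
have two g' e1 e2 u1 u2 v' : tl_positive g' ->
    ((0 < k)%N -> (kap k + e1 + (U k.-1 != 0%N) < kap k.-1)%N) ->
    (kap k.+1 + e2 + (u1 != 0%N) < kap k + e1)%N ->
    ((k.+2 < N)%N -> down_pre k.+2 (addk (addk kap k e1) k.+1 e2)
       (setk (setk U k u1) k.+1 u2) (v' + S k.+1)) ->
    Pos (altimm (addk (addk kap k e1) k.+1 e2) g' (P ++ zl U 0 k ++ nseq u1 (z k) ++
      nseq u2 (z k.+1) ++ nseq v' (Wv k.+2) ++ Wl S k.+1 ++ Q)).
  move=> g'P lt1 lt2 pre; rewrite WlS // -!catA.
  rewrite [nseq v' _ ++ _]catA -nseqD [nseq u1 _ ++ _]catA [zl U 0 k ++ _]catA.
  have -> : zl U 0 k ++ nseq u1 (z k) ++ nseq u2 (z k.+1) =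
      zl (setk (setk U k u1) k.+1 u2) 0 k.+2.
    rewrite zlSr zl_setk ?ltnn ?andbF // zlSr zl_setk ?ltnn ?andbF //.
    by rewrite /setk !eqxx -catA.
  apply: IH => //; first by lia.
  - move=> h hk; rewrite /setk /addk; have [->|hk'] := eqVneq h k.
      by rewrite n1 n1' eqxx; lia.
    rewrite (_ : (h == k.+1) = false) 1?(_ : (h.+1 == k.+1) = false); try lia.
    have [hk1|hk2] := eqVneq h.+1 k; first by rewrite -hk1 /= in lt1 *; lia.
    by apply: c1; lia.
  - move=> h kh hN; rewrite /addk !ifF; [|lia..]; by apply: c3 => //; lia.
case: v => [|[|[|v]]] in c2 zero step *.
- apply: step => u u0 _ _ _; constructor 1; rewrite Sk; split; first by lia.
  by rewrite /addk /setk /= n1' eqxx; lia.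
- apply: step => -[|[|//]] _ _ _ _.
    by constructor 3; rewrite /addk /setk /= n1' eqxx Sk; split=> //; lia.
  by constructor 1; rewrite /addk /setk /= n1' eqxx Sk; split=> //; lia.
(* Either the gaps below [k] are tight and only [u = 0] is admissible, or [u = 1] is admissible and
   the two equal rows are split by [altimm_tight]. *)
- have [] : [/\ (0 < k)%N, kap k.-1 = (kap k).+1, U k.-1 = 0%N & [/\ (1 < k)%N,
  kap k.-2 = (kap k.-1).+1 & U k.-2 = 0%N]] \/ pok 1%N.
  + rewrite /pok; case: (posnP k) c2 => [-> _|k0 /(_ isT kN)] /=; first by right.
    case=> [[//]|le'|[k1 U1 [//|?]]|[U1 k1 _ _ _]]; first by right; lia.
      by left.
    by right; rewrite U1 k1 /=; lia.
  + case=> k0 kk Uk [k1 kk1 Uk1]; apply: step => -[|u] _ _; last first.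
      by rewrite /pok k0 /= kk; lia.
    move=> _ _; have kp : (k.-1 == k) = false by lia.
    by constructor 3; rewrite /addk /setk /= n1' eqxx kp Sk addn0; split=> //; right;
      split=> //; lia.
  + move=> pok1; rewrite Sk /= catA.
    have sl1 : syml k (P ++ zl U 0 k).
      by rewrite syml_cat P_sym // syml_zl // ltnn andbF.
    have sl2 : syml k (Wl S k.+1 ++ Q) by rewrite syml_cat Q_sym // syml_Wl //; lia.
    have sM : symr k (Wv k) by apply: symr_Wv => //; lia.
    have c3k1 := c3 k.+1 (ltnW (ltnSn _)).
    rewrite (altimm_tight gP kN1 tight sl1 sl2 sM); apply: PosD; last first.
      (* The correction term has no row [z k], two rows [z k.+1] and both exponents raised by one.
         When the next gap becomes exactly three, this is the last case of [down_pre]. *)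
      rewrite -catA; apply: (two g 1 1 0 2 0)%N => //; try lia.
        by move=> k0; move: pok1; rewrite /pok k0 /= addn1.
      move=> lt; have := c3k1 lt; rewrite add0n /down_pre /addk /setk /= !eqxx n1 !n1'.
      rewrite (_ : (k.+2 == k) = false); last lia.
      have [->|_] := eqVneq (S k.+1) 0%N => lt'; first by constructor 1; split=> //; lia.
      have [e|ne] := eqVneq (kap k.+1) (kap k.+2).+2; last by constructor 2; lia.
      by constructor 4; split=> //; lia.
    (* Without [x k.+1 *: z k.+1], entry [k.+1] takes no row and the leftover rows pass directly to
       [Wv k.+2]. *)
    have -> : Wv k - x k.+1 *: z k.+1 = Wv k.+2 + x k *: z k.
      by rewrite WvS // WvS // addrAC addrK.
    apply: (@altimm_expand _ _ _ _ _ _ _ 2 false) => //= g' u g'P u2; rewrite -!catA.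
    have [ok|bad] := boolP (pok u); last first.
      apply: zero => //; try lia.
      move=> i ik iN; rewrite syml_cat syml_nseq ?symr_Wv //; try lia.
      by rewrite syml_cat Q_sym // syml_Wl //; lia.
    rewrite -(eq_altimm _ _ (addk0 _ k.+1)).
    apply: (two g' u 0 u 0 _)%N => //; try lia.
      by move=> k0; move: ok; rewrite /pok k0.
    move=> lt; have := c3k1 lt; rewrite /down_pre /addk /setk /= !eqxx n1 !n1' !addn0.
    rewrite (_ : (k.+2 == k) = false); last lia.
    have [e|ne] := eqVneq (kap k.+1) (kap k.+2).+1 => lt'; last by constructor 2; lia.
    constructor 3; split=> //; have [->|u0] := eqVneq u 0%N; last by left; lia.
    by right; rewrite addn0.
- by rewrite catA altimm_ge3.
Qed.

End StepUp.

End Column.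

(** * Induction on contents *)

Section Contents.
Variables (C : numClosedFieldType) (n : nat) (B : comAlgType C).
Variables (N : nat) (x : nat -> B).
Variables (tau : nat -> {lrmorphism B -> B}) (Alt : {additive B -> B}).
Variable Pos : B -> Prop.
Hypothesis tau_x : forall i h, (i.+1 < N)%N -> tau i (x h) = x (swapn i h).
Hypothesis Alt_tau : forall i b, (i.+1 < N)%N -> Alt (tau i b) = - Alt b.
Hypothesis Pos0 : Pos 0.
Hypothesis PosD : forall b c, Pos b -> Pos c -> Pos (b + c).

Variables (alpha beta : nat -> nat) (right : nat -> bool).

Definition unitv (i : nat) : 'rV[B]_n := \row_(j < n) (j == i :> nat)%:R.
Definition srcv (t : nat) : 'rV[B]_n := \row_(j < n) (alpha j == t)%:R.

(* [right t] tells whether the step from content [t] to [t.+1] goes right. The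
   [j]-th entry of [zrow t h] counts, for the source [j], the fillings of the
   contents from [alpha j] to [t.-1] that [h] can extend at content [t]. *)
Fixpoint zrow (t h : nat) : 'rV[B]_n :=
  if t is t'.+1 then
    srcv t + (if right t' then \sum_(0 <= h' < minn h.+1 N) x h' *: zrow t' h'
              else \sum_(h.+1 <= h' < N) x h' *: zrow t' h')
  else 0.

(** No condition is put on a next cell: for [t = beta i] this is row [i] of the ribbon matrix. *)
Definition sinkv (t : nat) : 'rV[B]_n :=
  if t is t'.+1 then srcv t + \sum_(0 <= h < N) x h *: zrow t' h else srcv 0.

Lemma zrow_right t h : right t -> zrow t.+1 h = Yv x (zrow t) (srcv t.+1) (minn h.+1 N).
Proof. by rewrite /= => ->. Qed.

Lemma zrow_up t h : ~~ right t -> zrow t.+1 h = Wv N x (zrow t) (srcv t.+1) h.+1.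
Proof. by rewrite /= => /negPf->. Qed.

Lemma map_unitv i k : map_mx (tau i) (unitv k) = unitv k.
Proof. by apply/rowP => j; rewrite !mxE rmorph_nat. Qed.

Lemma map_srcv i k : map_mx (tau i) (srcv k) = srcv k.
Proof. by apply/rowP => j; rewrite !mxE rmorph_nat. Qed.

(** By induction on [t]. At [t.+1] the second combination is [x i + x i.+1] times a symmetric row,
    plus or minus [x i * x i.+1] times the row of entry [i.+1] at content [t]. *)
Lemma zrow_sym t i : (i.+1 < N)%N ->
  (forall h, h != i -> map_mx (tau i) (zrow t h) = zrow t h) /\
  map_mx (tau i) (x i *: zrow t i + x i.+1 *: zrow t i.+1) =
    x i *: zrow t i + x i.+1 *: zrow t i.+1.
Proof.
elim: t i => [|t IH] i iN.
  by split=> [h _|]; rewrite /= ?scaler0 ?addr0 raddf0.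
have Hs j : (j.+1 < N)%N -> symr tau j (srcv t.+1) by move=> _; rewrite /symr map_srcv.
have sx : tau i (x i + x i.+1) = x i + x i.+1.
  by rewrite rmorphD /= !tau_x // /swapn !eqxx ifF 1?addrC //; lia.
have px : tau i (x i * x i.+1) = x i * x i.+1.
  by rewrite rmorphM /= !tau_x // /swapn !eqxx ifF 1?mulrC //; lia.
have Hz j h (lt : (j.+1 < N)%N) := (IH j lt).1 h.
have Hm j (lt : (j.+1 < N)%N) := (IH j lt).2.
have zi : map_mx (tau i) (zrow t i.+1) = zrow t i.+1 by apply: Hz; lia.
have [rt|rt] := boolP (right t).
  have sY k : k != i.+1 -> map_mx (tau i) (Yv x (zrow t) (srcv t.+1) k) = Yv x (zrow t) (srcv t.+1) k.
    by move=> ki; apply/eqP; apply: (symr_Yv tau_x Hz Hm Hs iN ki).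
  split=> [h hi|]; rewrite !zrow_right //; first by apply: sY; lia.
  have [-> ->] : minn i.+1 N = i.+1 /\ minn i.+2 N = i.+2 by lia.
  set Y2 := Yv _ _ _ i.+2.
  have -> : Yv x (zrow t) (srcv t.+1) i.+1 = Y2 - x i.+1 *: zrow t i.+1 by rewrite /Y2 [in RHS]YvS addrK.
  rewrite scalerBr scalerA addrAC -scalerDl map_mxB !map_mxZ /= sx px zi sY //; lia.
have sW k : k != i.+1 -> map_mx (tau i) (Wv N x (zrow t) (srcv t.+1) k) = Wv N x (zrow t) (srcv t.+1) k.
  move=> ki; have [kN|kN] := leqP k N; last by rewrite /Wv big_geq 1?ltnW // addr0 map_srcv.
  by apply/eqP; apply: (symr_Wv tau_x Hz Hm Hs iN kN ki).
split=> [h hi|]; rewrite !zrow_up //; first by apply: sW; lia.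
rewrite [Wv _ _ _ _ i.+1]WvS // scalerDr scalerA addrAC -scalerDl map_mxD !map_mxZ /= sx px zi sW //; lia.
Qed.

Lemma sinkv_sym t i : (i.+1 < N)%N -> map_mx (tau i) (sinkv t) = sinkv t.
Proof.
move=> iN; case: t => [|t]; first exact: map_srcv.
have Hs j : (j.+1 < N)%N -> symr tau j (srcv t.+1) by move=> _; rewrite /symr map_srcv.
apply/eqP; apply: (symr_Yv tau_x _ _ Hs iN (k := N)); try (by move=> *; apply: (zrow_sym _ _).1).
  by move=> j jN; apply: (zrow_sym _ jN).2.
by lia.
Qed.

Lemma zrow_supp t h (j : 'I_n) : (t < alpha j)%N -> zrow t h 0 j = 0.
Proof.
elim: t h => [|t IH] h lt; first by rewrite mxE.
rewrite /= !mxE (gtn_eqF lt) add0r.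
by case: ifP => _; rewrite summxE big1 // => k _; rewrite mxE IH ?mulr0 // ltnW.
Qed.

Lemma sinkv_supp t (j : 'I_n) : (t < alpha j)%N -> sinkv t 0 j = 0.
Proof.
case: t => [|t] lt; rewrite /= !mxE (gtn_eqF lt) // add0r summxE big1 // => k _.
by rewrite mxE zrow_supp ?mulr0 // ltnW.
Qed.

Lemma imm_col0 (g : 'S_n -> C) (l : seq 'rV[B]_n) (j : 'I_n) :
  {in l, forall r : 'rV[B]_n, r 0 j = 0} -> imm g l = 0.
Proof.
move=> h; rewrite /imm; case: eqP => // sz; apply: big1 => w _.
rewrite (bigD1 ((w^-1)%g j)) //= permKV h ?mul0r ?scaler0 //.
by apply: mem_nth; rewrite sz.
Qed.

Lemma imm_unit2 (g : 'S_n -> C) (l1 l2 : seq 'rV[B]_n) p :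
  imm g (l1 ++ unitv p :: unitv p :: l2) = 0.
Proof.
rewrite /imm size_cat /=; case: eqP => // sz; apply: big1 => w _.
have lt0 : (size l1 < n)%N by lia.
have lt1 : ((size l1).+1 < n)%N by lia.
have e0 : nth 0 (l1 ++ unitv p :: unitv p :: l2) (Ordinal lt0) = unitv p.
  by rewrite nth_cat /= ltnn subnn.
have e1 : nth 0 (l1 ++ unitv p :: unitv p :: l2) (Ordinal lt1) = unitv p.
  by rewrite nth_cat /= ltnNge leqnSn /= subSnn.
have [wp|wp] := eqVneq (w (Ordinal lt0) : nat) p.
  rewrite (bigD1 (Ordinal lt1)) //= e1 mxE -wp val_eqE (inj_eq perm_inj) -val_eqE /=.
  by rewrite gtn_eqF // mul0r scaler0.
by rewrite (bigD1 (Ordinal lt0)) //= e0 mxE (negPf wp) mul0r scaler0.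
Qed.

(** In the column of the starting ribbon only the rows [src] are nonzero, so exactly one must occur;
    when no ribbon starts, [src] is 0. *)
Lemma imm_src (g : 'S_n -> C) (l1 l2 : seq 'rV[B]_n) (src : 'rV[B]_n) (f : nat) (e : bool) (p : 'I_n) :
  src = (if e then unitv p else 0) ->
  (e -> {in l1 ++ l2, forall r : 'rV[B]_n, r 0 p = 0}) -> f != e :> nat ->
  imm g (l1 ++ nseq f src ++ l2) = 0.
Proof.
move=> ->; case: e => [h|_]; last first.
  by case: f => // f _; exact: imm0.
case: f => [|[|f]] //= _; first exact: imm_col0 (h isT).
exact: imm_unit2.
Qed.

Definition active t i : bool := (alpha i <= t < beta i)%N.
(** The induction goes down in content: a ribbon beyond its end still shows its row of the ribbon
    matrix, and one whose start has been passed has been matched with its own column. *)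
Definition inact t i : 'rV[B]_n := if (t < alpha i)%N then unitv i else sinkv (beta i).
Definition slots t a b : seq 'rV[B]_n := [seq inact t i | i <- index_iota a b].

Lemma slots_cat t a b c : (a <= b)%N -> (b <= c)%N -> slots t a b ++ slots t b c = slots t a c.
Proof.
move=> ab bc; rewrite /slots -map_cat /index_iota; congr map.
have -> : (c - a = (b - a) + (c - b))%N by lia.
by rewrite iotaD subnKC.
Qed.

Lemma size_slots t a b : size (slots t a b) = (b - a)%N.
Proof. by rewrite size_map size_iota. Qed.

Lemma slots1 t a : slots t a a.+1 = [:: inact t a].
Proof. by rewrite /slots /index_iota subSnn. Qed.

Lemma slotsP t a b r : r \in slots t a b -> exists2 i, (a <= i < b)%N & r = inact t i.
Proof. by case/mapP => i; rewrite mem_index_iota => hi ->; exists i. Qed.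

Lemma slots_sym t a b i : (i.+1 < N)%N -> syml tau i (slots t a b).
Proof.
move=> iN; apply/allP => r /slotsP[k _ ->]; rewrite /symr /inact.
by case: ifP => _; rewrite ?map_unitv ?sinkv_sym.
Qed.

Lemma zlP t (U : nat -> nat) a b r : r \in zl (zrow t) U a b -> exists h, r = zrow t h.
Proof. by case/flatten_mapP => h _; rewrite mem_nseq => /andP[_ /eqP->]; exists h. Qed.

Hypothesis alpha_beta : forall i, (i < n)%N -> (0 < alpha i < beta i)%N.

Lemma slots_eq t a b : (b <= n)%N ->
  (forall i, (a <= i < b)%N -> ~~ active t.+1 i) -> slots t.+1 a b = slots t a b.
Proof.
move=> bn na; apply/eq_in_map => i; rewrite mem_index_iota => hi.
have := na i hi; rewrite /active /inact.
have /alpha_beta : (i < n)%N by lia.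
by move=> h1 h2; have -> : (t.+1 < alpha i)%N = (t < alpha i)%N by lia.
Qed.

Lemma slots_supp t a b (p : 'I_n) : (t < alpha p)%N -> (b <= n)%N ->
  (forall i, (a <= i < b)%N -> ~~ active t i && (i != p)) ->
  {in slots t a b, forall r : 'rV[B]_n, r 0 p = 0}.
Proof.
move=> tp bn na r /slotsP[i hi ->]; rewrite /inact.
have /andP[na1 ne] := na i hi; case: ltnP => le.
  by rewrite mxE eq_sym (negPf ne).
by apply: sinkv_supp; move: na1; rewrite /active le /= -leqNgt => ?; lia.
Qed.

(** Among the ribbons that meet content [t] or [t.+1], on a right step only the first can start at
    [t.+1] and only the last can end after [t]; on an upward step the roles are exchanged. *)
Hypothesis chain_right : forall t i j, right t -> (i < j)%N -> (j < n)%N ->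
  active t i || active t.+1 i -> active t j || active t.+1 j ->
  active t.+1 i && active t j.
Hypothesis chain_up : forall t i j, ~~ right t -> (i < j)%N -> (j < n)%N ->
  active t i || active t.+1 i -> active t j || active t.+1 j ->
  active t i && active t.+1 j.
Hypothesis chain_mid : forall t i k j, (i < k)%N -> (k < j)%N -> (j < n)%N ->
  active t i || active t.+1 i -> active t j || active t.+1 j ->
  active t k && active t.+1 k.
Hypothesis Pos_mon : forall c kap, 0 <= c ->
  (forall h, (h.+1 < N)%N -> (kap h.+1 < kap h)%N) -> Pos (Alt (c *: mon N x kap)).

Definition interval t lo m : Prop :=
  (lo + m <= n)%N /\ forall i, (i < n)%N -> active t i = (lo <= i < lo + m)%N.

(** Nothing ties the number of rows [z h] to [m]: with any other number the list has the wrong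
    length and [imm] is 0. *)
Definition state t lo m S : seq 'rV[B]_n :=
  slots t 0 lo ++ zl (zrow t) S 0 N ++ slots t (lo + m) n.

(** With no active ribbon, [lo] can be moved to the place of the ribbon that becomes active at the
    previous content. *)
Lemma state_empty (g : 'S_n -> C) t lo lo' S : (lo <= n)%N -> (lo' <= n)%N ->
  imm g (state t lo 0 S) = imm g (state t lo' 0 S).
Proof.
move=> le le'; rewrite /state !addn0; case: (zl _ _ _ _) => [|r l].
  by rewrite !slots_cat.
by rewrite /imm !size_cat /= !size_slots !ifF //; lia.
Qed.

Lemma imm_units (g : 'S_n -> C) : imm g [seq unitv i | i <- index_iota 0 n] = (g 1%g)%:A.
Proof.
rewrite /imm size_map size_iota subn0 eqxx (bigD1 1%g) //= [X in _ + X]big1 ?addr0.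
  congr (_ *: _); apply: big1 => i _.
  by rewrite perm1 (nth_map 0%N) ?size_iota ?subn0 // nth_iota ?subn0 // mxE add0n eqxx.
move=> w w1; have [i wi] : exists i, w i != i.
  by apply/existsP; apply: contraR w1 => /existsPn h; apply/eqP/permP => i; rewrite perm1;
    apply/eqP; rewrite -[_ == _]negbK.
rewrite (bigD1 i) //= (nth_map 0%N) ?size_iota ?subn0 // nth_iota ?subn0 // mxE add0n.
by rewrite val_eqE (negPf wi) mul0r scaler0.
Qed.

(** All [alpha i] are positive, so at content 0 the rows are the unit rows, with immanant [g 1],
    unless some row [z h], which is 0, occurs. *)
Lemma content_base lo m g kap S : interval 0 lo m -> tl_positive g -> dominant N kap S ->
  Pos (altimm N x Alt kap g (state 0 lo m S)).
Proof.
move=> [le act] gP norm; have m0 : m = 0%N.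
  by have := act lo; have := @alpha_beta lo; rewrite /active; lia.
rewrite m0 /state addn0 in le *; case E : (zl _ _ _ _) => [|r l]; last first.
  have /zlP[h /= rE] : r \in zl (zrow 0) S 0 N by rewrite E mem_head.
  by rewrite /altimm rE /= imm0 mulr0 raddf0.
rewrite slots_cat // /altimm.
have -> : slots 0 0 n = [seq unitv i | i <- index_iota 0 n].
  apply/eq_in_map => i; rewrite mem_index_iota /inact => /andP[_ /alpha_beta /andP[-> _]] //.
rewrite imm_units mulrC -scalerAl mul1r; apply: Pos_mon; first exact: gP.1 [::].
by move=> h /norm; lia.
Qed.

(** [e] tells whether a ribbon starts at content [t.+1], necessarily the first active one, and [d]
    whether one has just ended, right after the active ones. The sink row of the latter is [Yv N],
    the leftover row with which [up_state] begins. *)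
Lemma content_right t lo m g kap S :
  (forall lo m g kap S, interval t lo m -> tl_positive g -> dominant N kap S ->
    Pos (altimm N x Alt kap g (state t lo m S))) ->
  right t -> interval t.+1 lo m -> tl_positive g -> dominant N kap S ->
  (forall i, (i < n)%N -> active t i -> ~~ active t.+1 i -> i = (lo + m)%N) ->
  Pos (altimm N x Alt kap g (state t.+1 lo m S)).
Proof.
move=> IH rt [le act] gP norm sink.
pose e := (0 < m)%N && ~~ active t lo.
pose d := (lo + m < n)%N && active t (lo + m)%N.
have source i : (i < n)%N -> active t.+1 i -> ~~ active t i -> (i = lo) /\ e.
  move=> lt a1 a0; have := a1; rewrite act // => hi.
  have ilo : i = lo.
    apply: contraNeq a0 => ne.
    suff /andP[] : active t.+1 lo && active t i by [].
    apply: (chain_right rt _ lt); [lia| |by rewrite a1 orbT].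
    by apply/orP; right; rewrite act; lia.
  by split=> //; rewrite /e -ilo a0 andbT; lia.
have actT i : (i < n)%N -> active t i = (lo + e <= i < lo + m + d)%N.
  move=> lt; have src := source i lt; have snk := sink i lt; have a1E := act i lt.
  case a0: (active t i) src snk; case a1: (active t.+1 i) => src snk.
  - have : (i == lo) -> ~~ e by move=> /eqP ilo; rewrite /e -ilo a0 andbF.
    by move: a1E; rewrite a1; lia.
  - have im := snk isT isT; have -> : d by rewrite /d -im a0 lt.
    by rewrite /e; lia.
  - by have [il ->] := src isT isT; lia.
  - have : (i == (lo + m)%N) -> ~~ d by move=> /eqP im; rewrite /d -im a0 andbF.
    by move: a1E; rewrite a1; lia.
have e_m : (e <= m)%N by rewrite /e; lia.
have d_n : (lo + m + d <= n)%N by rewrite /d; lia.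
have int : interval t (lo + e) (m - e + d).
  split=> [|i lt]; first by lia.
  by rewrite actT //; lia.
have na1 i : (i < n)%N -> ~~ (lo <= i < lo + m)%N -> ~~ active t.+1 i by move=> lt; rewrite act.
have eS : zl (zrow t.+1) S 0 N = Yl x (zrow t) (srcv t.+1) S N.
  congr flatten; apply/eq_in_map => h; rewrite mem_index_iota => hN.
  by rewrite zrow_right // (minn_idPl _) //; lia.
have eP : slots t.+1 0 lo = slots t 0 lo.
  by apply: slots_eq => [|i hi]; [lia|apply: na1; lia].
have eQ : slots t.+1 (lo + m) n = nseq d (Yv x (zrow t) (srcv t.+1) N) ++ slots t (lo + m + d) n.
  rewrite -[RHS](_ : slots t.+1 (lo + m) (lo + m + d) ++ slots t.+1 (lo + m + d) n = _); last first.
    congr (_ ++ _); last by apply: slots_eq => // i hi; apply: na1; lia.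
    case dE : d; last by rewrite /slots /index_iota addn0 subnn.
    rewrite addn1 slots1 /=; congr [:: _].
    move: dE; rewrite /d => /andP[lt]; rewrite /active /inact => a0.
    have := na1 (lo + m)%N lt; rewrite ltnn andbF /active => /(_ isT) a1.
    have -> : (t.+1 < alpha (lo + m))%N = false by lia.
    by have -> : beta (lo + m) = t.+1 by lia.
  by rewrite slots_cat //; lia.
rewrite /state eS eP eQ.
have srcE : srcv t.+1 = if e then unitv lo else 0.
  apply/rowP => j; rewrite mxE; case: ifP => eE; rewrite !mxE.
    congr (_%:R); congr nat_of_bool; apply/eqP/eqP => [aj|jl].
      by apply: (source j (ltn_ord j) _ _).1; have := alpha_beta (ltn_ord j);
        rewrite /active aj; lia.
    move: eE; rewrite /e => /andP[m0]; have lt : (lo < n)%N by lia.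
    have := act lo lt; rewrite jl /active; lia.
  case: eqP => // aj; suff : e by rewrite eE.
  by apply: (source j (ltn_ord j) _ _).2; have := alpha_beta (ltn_ord j); rewrite /active aj; lia.
have symz := zrow_sym t.
have ez : zl (zrow t) S N N = [::] by rewrite /zl /index_iota subnn.
rewrite -[slots t (lo + m + d) n]cat0s -ez.
apply: (up_state tau_x (fun i h lt => (symz i lt).1 h) (fun i lt =>
  (symz i lt).2) Alt_tau Pos0 PosD) => //.
- by move=> i iN; rewrite /symr map_srcv.
- by move=> i iN; apply: slots_sym.
- by move=> i iN; apply: slots_sym.
(* [up_state] leaves an arbitrary number [f] of rows [src]; only [f = e] contributes. *)
- move=> g' kap' U f g'P norm'; have [->|ne] := eqVneq f e.
    have := IH _ _ g' kap' U int g'P norm'; rewrite /state -(slots_cat t (leq0n lo)) ?leq_addr //.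
    have -> : slots t lo (lo + e) = nseq e (srcv t.+1).
      rewrite srcE; case eE : e; last by rewrite /slots /index_iota addn0 subnn.
      rewrite addn1 slots1 /=; congr [:: _].
      move: eE; rewrite /e => /andP[m0]; have lt : (lo < n)%N by lia.
      by have := act lo lt; rewrite /inact /active => a1 a0; rewrite ifT //; lia.
    by rewrite -!catA; have -> : (lo + e + (m - e + d) = lo + m + d)%N by lia.
  rewrite /altimm; case: (leqP n lo) => [le'|lt].
    have e0 : e = false by rewrite /e; lia.
    move: ne; rewrite srcE e0; case: f => // f _.
    by rewrite /= imm0 mulr0 raddf0.
  rewrite (imm_src g' (p := Ordinal lt) srcE) ?mulr0 ?raddf0 //= => eE r.
  have lot : (t < alpha lo)%N.
    move: eE; rewrite /e => /andP[m0]; have := act lo lt; rewrite /active; lia.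
  rewrite !mem_cat => /or3P[/slots_supp|/zlP[h ->]|/slots_supp].
  - by apply=> //= [|i hi]; [lia|rewrite actT; lia].
  - exact: (@zrow_supp t h (Ordinal lt)).
  - by apply=> //= i hi; rewrite actT; lia.
- by move=> h Nh hN; lia.
- by move=> N0; rewrite ltnn.
Qed.

(** Here the ribbon that starts is the last active one, [p], and the one that ends stands just
    before the active ones, with sink row [Wv 0]. *)
Lemma content_up t lo m g kap S :
  (forall lo m g kap S, interval t lo m -> tl_positive g -> dominant N kap S ->
    Pos (altimm N x Alt kap g (state t lo m S))) ->
  ~~ right t -> interval t.+1 lo m -> tl_positive g -> dominant N kap S ->
  (forall i, (i < n)%N -> active t i -> ~~ active t.+1 i -> i.+1 = lo) ->
  Pos (altimm N x Alt kap g (state t.+1 lo m S)).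
Proof.
move=> IH rt [le act] gP norm sink.
pose p := (lo + m).-1; have pE : p = (lo + m).-1 by [].
pose e := (0 < m)%N && ~~ active t p.
pose d := (0 < lo)%N && active t lo.-1.
have source i : (i < n)%N -> active t.+1 i -> ~~ active t i -> (i = p) /\ e.
  move=> lt a1 a0; have := a1; rewrite act // => hi.
  have ip : i = p.
    apply: contraNeq a0 => ne.
    have ltp : (p < n)%N by rewrite /p; lia.
    suff /andP[] : active t i && active t.+1 p by [].
    apply: (chain_up rt _ ltp); [by rewrite /p in ne *; lia|by rewrite a1 orbT|].
    by apply/orP; right; rewrite act // /p; lia.
  by split=> //; rewrite /e -ip a0 andbT; lia.
have actT i : (i < n)%N -> active t i = (lo - d <= i < lo + m - e)%N.
  move=> lt; have src := source i lt; have snk := sink i lt; have a1E := act i lt.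
  case a0: (active t i) src snk; case a1: (active t.+1 i) => src snk.
  - have : (i == p) -> ~~ e by move=> /eqP ip; rewrite /e -ip a0 andbF.
    by move: a1E; rewrite a1 /p; lia.
  - have im := snk isT isT; have -> : d by rewrite /d -im a0.
    by have em : (e <= m)%N; [rewrite /e; lia|lia].
  - by have [il ->] := src isT isT; rewrite /p in il; lia.
  - have : (i.+1 == lo) -> ~~ d by move=> /eqP im; rewrite /d -im a0 andbF.
    by move: a1E; rewrite a1; lia.
have e_m : (e <= m)%N by rewrite /e; lia.
have d_lo : (d <= lo)%N by rewrite /d; lia.
have int : interval t (lo - d) (m + d - e).
  split=> [|i lt]; first by lia.
  by rewrite actT //; lia.
have na1 i : (i < n)%N -> ~~ (lo <= i < lo + m)%N -> ~~ active t.+1 i by move=> lt; rewrite act.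
have eS : zl (zrow t.+1) S 0 N = Wl N x (zrow t) (srcv t.+1) S 0.
  congr flatten; apply/eq_in_map => h; rewrite mem_index_iota => hN.
  by rewrite zrow_up.
have eQ : slots t.+1 (lo + m) n = slots t (lo + m) n.
  by apply: slots_eq => // i hi; apply: na1; lia.
have eP : slots t.+1 0 lo = slots t 0 (lo - d) ++ nseq d (Wv N x (zrow t) (srcv t.+1) 0).
  rewrite -[RHS](_ : slots t.+1 0 (lo - d) ++ slots t.+1 (lo - d) lo = _); last first.
    congr (_ ++ _); first by apply: slots_eq => [|i hi]; [lia|apply: na1; lia].
    case dE : d; last by rewrite /slots /index_iota subn0 subnn.
    move: dE; rewrite /d => /andP[lo0]; rewrite subn1 -[X in slots _ _ X](prednK lo0) slots1.
    rewrite /active /inact => a0; congr [:: _].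
    have lt : (lo.-1 < n)%N by lia.
    have := na1 lo.-1 lt; rewrite /active => a1.
    have -> : (t.+1 < alpha lo.-1)%N = false by lia.
    by have -> : beta lo.-1 = t.+1 by lia.
  by rewrite slots_cat //; lia.
rewrite /state eS eP eQ -catA.
have srcE : srcv t.+1 = if e then unitv p else 0.
  apply/rowP => j; rewrite mxE; case: ifP => eE; rewrite !mxE.
    congr (_%:R); congr nat_of_bool; apply/eqP/eqP => [aj|jl].
      by apply: (source j (ltn_ord j) _ _).1; have := alpha_beta (ltn_ord j);
        rewrite /active aj; lia.
    move: eE; rewrite /e => /andP[m0]; have lt : (p < n)%N by rewrite /p; lia.
    by have := act p lt; rewrite jl /active; lia.
  case: eqP => // aj; suff : e by rewrite eE.
  by apply: (source j (ltn_ord j) _ _).2; have := alpha_beta (ltn_ord j); rewrite /active aj; lia.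
have symz := zrow_sym t.
have ez : zl (zrow t) S 0 0 = [::] by [].
rewrite -[nseq d _ ++ _]cat0s -ez.
apply: (down_state tau_x (fun i h lt => (symz i lt).1 h) (fun i lt =>
  (symz i lt).2) Alt_tau Pos0 PosD) => //.
- by move=> i iN; rewrite /symr map_srcv.
- by move=> i iN; apply: slots_sym.
- by move=> i iN; apply: slots_sym.
- move=> g' kap' U f g'P norm'; have [->|ne] := eqVneq f e.
    have := IH _ _ g' kap' U int g'P norm'; rewrite /state.
    have -> : (lo - d + (m + d - e) = lo + m - e)%N by lia.
    rewrite -(slots_cat t (leq_subr e (lo + m))) //.
    have -> : slots t (lo + m - e) (lo + m) = nseq e (srcv t.+1).
      rewrite srcE; case eE : e; last by rewrite /slots /index_iota subn0 subnn.
      move: eE; rewrite /e => /andP[m0]; have lt : (p < n)%N by rewrite /p; lia.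
      rewrite subn1 -[in X in slots _ _ X](@prednK (lo + m)); last by lia.
      rewrite -/p slots1 => a0; congr [:: _].
      by have := act p lt; rewrite /inact /active => a1; rewrite ifT //; move: a0;
        rewrite /active; lia.
    by [].
  rewrite /altimm; case: (leqP n p) => [le'|lt].
    have e0 : e = false by rewrite /e /p in le' *; lia.
    move: ne; rewrite srcE e0; case: f => // f _.
    by rewrite catA /= imm0 mulr0 raddf0.
  rewrite catA (imm_src g' (p := Ordinal lt) srcE) ?mulr0 ?raddf0 //= => eE r.
  have lot : (t < alpha p)%N.
    by move: eE; rewrite /e => /andP[m0]; have := act p lt; rewrite /active; lia.
  have em : (e : nat) = 1%N by rewrite eE.
  have m0 : (0 < m)%N by move: eE; rewrite /e => /andP[].
  rewrite -catA !mem_cat => /or3P[/slots_supp|/zlP[h ->]|/slots_supp].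
  - by apply=> //= [|i hi]; [lia|rewrite actT; lia].
  - exact: (@zrow_supp t h (Ordinal lt)).
  - by apply=> //= i hi; rewrite actT; lia.
- by move=> h _ hN; apply: norm.
Qed.

Lemma content_pos t lo m g kap S : interval t lo m -> tl_positive g -> dominant N kap S ->
  Pos (altimm N x Alt kap g (state t lo m S)).
Proof.
elim: t lo m g kap S => [|t IH] lo m g kap S; first exact: content_base.
move=> int gP dom; have [le act] := int.
have relo lo' : m = 0%N -> (lo' <= n)%N -> interval t.+1 lo' 0 /\
    imm g (state t.+1 lo m S) = imm g (state t.+1 lo' 0 S).
  move=> m0 le'; rewrite m0 in le act *; split; last by apply: state_empty => //; lia.
  by split=> [|i lt]; [lia|rewrite act //; lia].
have [rt|rt] := boolP (right t).
- have [m0|m0] := posnP m.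
    (* With no ribbon active at [t.+1], [lo] is moved to the ribbon that has just ended, if there is
       one. *)
    have [/existsP[r /andP[r0 r1]]|nor] := boolP [exists r : 'I_n, active t r && ~~ active t.+1 r].
      have [int' e] := relo r m0 (ltnW (ltn_ord r)).
      rewrite /altimm e; apply: (content_right IH rt int') => // i lt a0 a1; rewrite addn0.
      have [ir|ri|//] := ltngtP i r.
        by have := chain_right rt ir (ltn_ord r); rewrite a0 r0 (negPf a1) => /(_ isT isT).
      by have := chain_right rt ri lt; rewrite a0 r0 (negPf r1) => /(_ isT isT).
    apply: content_right => // i lt a0 a1; case/existsP: nor; exists (Ordinal lt).
    by rewrite a0.
  apply: content_right => // i lt a0 a1; have := act i lt; rewrite (negPf a1) => hi.
  have lo1 : active t.+1 lo by rewrite act; lia.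
  have le2 : (lo + m <= i)%N.
    rewrite leqNgt; apply/negP => lt2; have il : (i < lo)%N by lia.
    have lon : (lo < n)%N by lia.
    by have := chain_right rt il lon; rewrite a0 lo1 orbT (negPf a1) => /(_ isT isT).
  apply/eqP; rewrite eqn_leq le2 andbT leqNgt; apply/negP => gt.
  have := @chain_mid t (lo + m).-1 (lo + m) i; rewrite a0 [active t.+1 (lo + m)]act; last by lia.
  by rewrite [active t.+1 (lo + m).-1]act ?ltnn ?andbF; [rewrite (_ : (_ <= _ < _)%N); lia|lia].
- have [m0|m0] := posnP m.
    have [/existsP[r /andP[r0 r1]]|nor] := boolP [exists r : 'I_n, active t r && ~~ active t.+1 r].
      have [int' e] := relo r.+1 m0 (ltn_ord r).
      rewrite /altimm e; apply: (content_up IH rt int') => // i lt a0 a1; congr _.+1.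
      have [ir|ri|//] := ltngtP i r.
        by have := chain_up rt ir (ltn_ord r); rewrite a0 r0 (negPf r1) => /(_ isT isT).
      by have := chain_up rt ri lt; rewrite a0 r0 (negPf a1) => /(_ isT isT).
    apply: content_up => // i lt a0 a1; case/existsP: nor; exists (Ordinal lt).
    by rewrite a0.
  apply: content_up => // i lt a0 a1; have := act i lt; rewrite (negPf a1) => hi.
  have lo1 : active t.+1 lo by rewrite act; lia.
  have le2 : (i < lo)%N.
    rewrite ltnNge; apply/negP => lt2; have il : (lo < i)%N by lia.
    by have := chain_up rt il lt; rewrite a0 lo1 orbT (negPf a1) andbF => /(_ isT isT).
  apply/eqP; rewrite eqn_leq le2 /= leqNgt; apply/negP => gt.
  have := @chain_mid t i lo.-1 lo; rewrite a0 lo1 orbT [active t.+1 lo.-1]act; last by lia.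
  by rewrite (_ : (lo <= lo.-1 < _)%N = false) ?andbF; lia.
Qed.

(** Beyond all [beta i] every ribbon has ended, and the state consists of sink rows alone. *)
Lemma sink_pos g kap : tl_positive g -> (forall h, (h.+1 < N)%N -> (kap h.+1 < kap h)%N) ->
  Pos (altimm N x Alt kap g [seq sinkv (beta i) | i <- index_iota 0 n]).
Proof.
move=> gP dom; pose T := \max_(i < n) beta i.
have betaT i : (i < n)%N -> (beta i <= T)%N.
  by move=> lt; rewrite /T (leq_bigmax (Ordinal lt)).
have int : interval T 0 0.
  by split=> // i lt; rewrite /active; have := betaT i lt; lia.
have dom0 : dominant N kap (fun=> 0%N) by move=> h /dom; rewrite addn0.
have := content_pos int gP dom0; rewrite /state.
have -> : zl (zrow T) (fun=> 0%N) 0 N = [::].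
  by rewrite /zl; elim: (index_iota 0 N).
rewrite add0n /= (_ : slots T 0 n = [seq sinkv (beta i) | i <- index_iota 0 n]) //.
apply/eq_in_map => i; rewrite mem_index_iota /inact => /andP[_ lt].
have -> // : (T < alpha i)%N = false by have := alpha_beta lt; have := betaT i lt; lia.
Qed.

End Contents.

(** * Branching of tableaux and alternants *)

Section Tableaux.
Variables (B : comNzRingType) (x : nat -> B).
Implicit Types (N : nat) (nu f : nat -> nat) (D : {fset cell}).

Definition natcell (p : nat * nat) : cell := (p.1%:Z, p.2%:Z).

Lemma natcell_inj : injective natcell.
Proof. by case=> i j [i' j'] [-> ->]. Qed.

Definition rows_cells N nu : seq (nat * nat) :=
  [seq (i, j) | i <- iota 0 N, j <- iota 0 (nu i)].

Definition rows_diagram N nu : {fset cell} := [fset p in map natcell (rows_cells N nu)]%fset.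

Lemma rows_cells_uniq N nu : uniq (rows_cells N nu).
Proof.
apply: allpairs_uniq_dep; rewrite ?iota_uniq //; first by move=> i _; exact: iota_uniq.
by move=> [i j] [i' j'] _ _ /= [-> ->].
Qed.

Lemma mem_rows_cells N nu i j : ((i, j) \in rows_cells N nu) = (i < N)%N && (j < nu i)%N.
Proof.
apply/allpairsPdep/andP => [[i' [j' [+ + [-> ->]]]]|[hi hj]].
  by rewrite !mem_iota !add0n.
by exists i, j; rewrite !mem_iota !add0n.
Qed.

Lemma mem_rows_diagram N nu i j :
  (natcell (i, j) \in rows_diagram N nu) = (i < N)%N && (j < nu i)%N.
Proof. by rewrite inE /= mem_map ?mem_rows_cells //; apply: natcell_inj. Qed.

Lemma rows_diagramP N nu (c : cell) : c \in rows_diagram N nu ->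
  exists i j, [/\ c = natcell (i, j), (i < N)%N & (j < nu i)%N].
Proof.
rewrite inE /= => /mapP[[i j] h e]; move: h; rewrite mem_rows_cells => /andP[hi hj].
by exists i, j.
Qed.

Lemma prod_rows_diagram N nu (G : cell -> B) :
  \prod_(c : rows_diagram N nu) G (val c) =
  \prod_(i < N) \prod_(j < nu i) G (natcell (nat_of_ord i, nat_of_ord j)).
Proof.
rewrite -(big_seq_fsetE _ (rows_diagram N nu) xpredT G) /=.
rewrite (perm_big (map natcell (rows_cells N nu))); last first.
  apply: uniq_perm => [||c]; first exact: fset_uniq.
    by rewrite map_inj_uniq ?rows_cells_uniq //; apply: natcell_inj.
  by rewrite inE.
have iotaE m : iota 0 m = index_iota 0 m by rewrite /index_iota subn0.
rewrite big_map /rows_cells big_allpairs_dep iotaE big_mkord.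
by apply: eq_bigr => i _; rewrite iotaE big_mkord.
Qed.

(* [d] is a junk value, taken outside [D]. *)
Definition tab_val D N (d : nat) (T : {ffun D -> 'I_N}) (c : cell) : nat :=
  if insub c is Some c' then T c' else d.

Lemma tab_valE D N d (T : {ffun D -> 'I_N}) (c : D) : tab_val d T (val c) = T c.
Proof. by rewrite /tab_val valK. Qed.

Lemma tab_val_out D N d (T : {ffun D -> 'I_N}) c : c \notin D -> tab_val d T c = d.
Proof. by move=> h; rewrite /tab_val insubN. Qed.

Lemma tab_val_lt D N d (T : {ffun D -> 'I_N}) c : c \in D -> (tab_val d T c < N)%N.
Proof. by move=> h; rewrite -[c]/(val (FSetSub h)) tab_valE. Qed.

Lemma ssyt_rowsP N nu m d (T : {ffun rows_diagram N nu -> 'I_m}) :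
  reflect (forall i j, (i < N)%N -> (j < nu i)%N ->
     (forall k, (k <= j)%N -> (tab_val d T (natcell (i, k)) <= tab_val d T (natcell (i, j)))%N) /\
     (forall h, (h < i)%N -> (j < nu h)%N ->
        (tab_val d T (natcell (h, j)) < tab_val d T (natcell (i, j)))%N))
    (ssyt T).
Proof.
apply: (iffP forallP) => [hT i j iN jnu|hT c].
  have cD : natcell (i, j) \in rows_diagram N nu by rewrite mem_rows_diagram iN.
  split=> [k kj|h hi jh].
    have kD : natcell (i, k) \in rows_diagram N nu.
      by rewrite mem_rows_diagram iN; apply: leq_ltn_trans jnu.
    have /forallP/(_ (FSetSub cD))/andP[+ _] := hT (FSetSub kD).
    rewrite -(tab_valE d T (FSetSub cD)) -(tab_valE d T (FSetSub kD)) /= eqxx lez_nat kj.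
    by [].
  have hD : natcell (h, j) \in rows_diagram N nu.
    by rewrite mem_rows_diagram jh andbT; apply: ltn_trans iN.
  have /forallP/(_ (FSetSub cD))/andP[_] := hT (FSetSub hD).
  rewrite -(tab_valE d T (FSetSub cD)) -(tab_valE d T (FSetSub hD)) /= eqxx ltz_nat hi.
  by [].
apply/forallP => c'; rewrite -!(tab_valE d T).
have [i [j [-> iN jnu]]] := rows_diagramP (valP c).
have [i' [j' [-> iN' jnu']]] := rows_diagramP (valP c').
rewrite /= !eqz_nat lez_nat ltz_nat; apply/andP; split; apply/implyP => /andP[/eqP e lt].
  by rewrite e; have [h _] := hT i' j' iN' jnu'; apply: h.
by rewrite e in jnu *; have [_ h] := hT i' j' iN' jnu'; apply: h.
Qed.

Definition tab_sum N nu : B :=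
  \sum_(T : {ffun rows_diagram N nu -> 'I_N} | ssyt T) \prod_(c : rows_diagram N nu) x (T c).

Lemma find_iota (P : pred nat) (m f : nat) : (f <= m)%N ->
  (forall k, (k < m)%N -> P k = (f <= k)%N) -> find P (iota 0 m) = f.
Proof.
move=> fm h; have [fp|pf|//] := ltngtP f (find P (iota 0 m)).
  have pm : (find P (iota 0 m) <= m)%N by rewrite -[X in (_ <= X)%N](size_iota 0 m) find_size.
  have := before_find 0%N fp; rewrite nth_iota ?add0n ?h ?leqnn //; lia.
have hp : has P (iota 0 m) by rewrite has_find size_iota; lia.
have := nth_find 0%N hp; rewrite nth_iota ?add0n ?h; lia.
Qed.

Lemma find_iotaP (P : pred nat) (m : nat) :
  (forall k, (k.+1 < m)%N -> P k -> P k.+1) ->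
  forall k, (k < m)%N -> P k = (find P (iota 0 m) <= k)%N.
Proof.
move=> h k km; have [kp|pk] := ltnP k (find P (iota 0 m)).
  by have := before_find 0%N kp; rewrite nth_iota ?add0n.
have hp : has P (iota 0 m) by rewrite has_find size_iota; lia.
have := nth_find 0%N hp; rewrite nth_iota ?add0n; last by lia.
move=> hP; suff pos d : (d + find P (iota 0 m) < m)%N -> P (d + find P (iota 0 m))%N.
  by rewrite -(subnK pk) in km *; rewrite pos.
elim: d => // d IH lt; rewrite addSn; apply: h => //; apply: IH; lia.
Qed.

Definition extend N K (f : {ffun 'I_N -> 'I_K}) (i : nat) : nat :=
  if insub i is Some o then f o else 0%N.

Lemma extendE N K (f : {ffun 'I_N -> 'I_K}) (i : 'I_N) : extend f i = f i.
Proof. by rewrite /extend valK. Qed.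

Definition interlacing N K nu (f : {ffun 'I_N -> 'I_K}) : bool :=
  [forall i : 'I_N, (nu i.+1 <= f i <= nu i)%N].

Lemma interlacingP N K nu (f : {ffun 'I_N -> 'I_K}) : interlacing nu f ->
  forall i, (i < N)%N -> (nu i.+1 <= extend f i <= nu i)%N.
Proof. by move=> /forallP h i iN; rewrite (extendE f (Ordinal iN)); apply: h. Qed.

Section Branching.
Variables (N K : nat) (nu : nat -> nat).
Hypotheses (nu_dec : forall i, (i < N)%N -> (nu i.+1 <= nu i)%N) (nu_K : (nu 0 <= K)%N).

Local Notation big := {ffun rows_diagram N.+1 nu -> 'I_N.+1}.

(** Length of row [i] once the cells with the largest entry [N] are deleted. *)
Definition cut (T : big) (i : nat) : nat :=
  find (fun k => (N <= tab_val 0 T (natcell (i, k)))%N) (iota 0 (nu i)).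

(** Inverse of the deletion: cells outside the smaller shape receive the junk value [N] of
    [tab_val]. *)
Definition glue f (T : {ffun rows_diagram N f -> 'I_N}) : big :=
  [ffun c => inord (tab_val N T (val c))].

Lemma glueE f (T : {ffun rows_diagram N f -> 'I_N}) d c : c \in rows_diagram N.+1 nu ->
  tab_val d (glue T) c = tab_val N T c.
Proof.
move=> h; rewrite -[c]/(val (FSetSub h)) tab_valE ffunE inordK //= ltnS.
have [cD|cD] := boolP (c \in rows_diagram N f); last by rewrite tab_val_out.
by apply/ltnW/tab_val_lt.
Qed.

Lemma nu_anti i j : (i <= j)%N -> (j <= N)%N -> (nu j <= nu i)%N.
Proof.
move=> ij; rewrite -(subnK ij); elim: (j - i)%N => [|d IH] // dN.
by apply: leq_trans (nu_dec _) (IH _); lia.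
Qed.

(** Columns increase strictly. For [i = N] the whole row consists of entries [N], so the deletion
    leaves only [N] rows. *)
Lemma ssyt_ge (T : big) i j : ssyt T -> (i <= N)%N -> (j < nu i)%N ->
  (i <= tab_val 0 T (natcell (i, j)))%N.
Proof.
move=> /(ssyt_rowsP 0) h; elim: i => // i IH iN jnu.
have ji : (j < nu i)%N by have := nu_dec iN; lia.
have [_ /(_ i (leqnn _) ji)] := h i.+1 j ltac:(by lia) jnu.
exact: leq_ltn_trans (IH (ltnW iN) ji).
Qed.

Lemma cut_le (T : big) i : (cut T i <= nu i)%N.
Proof. by rewrite -[X in (_ <= X)%N](size_iota 0 (nu i)) find_size. Qed.

Lemma cutP (T : big) i k : ssyt T -> (i <= N)%N -> (k < nu i)%N ->
  (tab_val 0 T (natcell (i, k)) < N)%N = (k < cut T i)%N.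
Proof.
move=> /(ssyt_rowsP 0) hT iN knu; rewrite !ltnNge; congr negb.
apply: (find_iotaP (P := fun k => (N <= tab_val 0 T (natcell (i, k)))%N)) => // k' k'm.
have [h _] := hT i k'.+1 iN k'm.
by have := h k' (leqnSn _) => h1 h2; apply: leq_trans h1.
Qed.

Lemma cut_interlacing (T : big) i : ssyt T -> (i < N)%N -> (nu i.+1 <= cut T i <= nu i)%N.
Proof.
move=> hT iN; rewrite cut_le andbT leqNgt; apply/negP => lt.
have lt' := leq_trans lt (nu_dec iN).
have := cutP hT (ltnW iN) lt'; rewrite ltnn => /negbT; rewrite -leqNgt => le.
move: (hT) => /(ssyt_rowsP 0)/(_ i.+1 (cut T i)) h.
have [_ /(_ i (leqnn _) lt')] := h ltac:(by lia) lt.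
suff : (tab_val 0 T (natcell (i.+1, cut T i)) < N.+1)%N by lia.
by apply: tab_val_lt; rewrite mem_rows_diagram ltnS iN.
Qed.

Lemma sub_rows_diagram f i k : (forall i, (i < N)%N -> (nu i.+1 <= f i <= nu i)%N) ->
  (i < N)%N && (k < f i)%N -> (i < N.+1)%N && (k < nu i)%N.
Proof. by move=> hf /andP[iN kf]; have := hf i iN; lia. Qed.

Lemma glue_val f (T : {ffun rows_diagram N f -> 'I_N}) d i k :
  (i <= N)%N -> (k < nu i)%N ->
  tab_val d (glue T) (natcell (i, k)) = if (i < N)%N && (k < f i)%N
    then tab_val 0 T (natcell (i, k)) else N.
Proof.
move=> iN knu; rewrite glueE ?mem_rows_diagram ?ltnS ?iN ?knu // /tab_val.
by rewrite -mem_rows_diagram; case: insubP => [u -> _|/negPf->].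
Qed.

Lemma glue_ssyt f (T : {ffun rows_diagram N f -> 'I_N}) :
  (forall i, (i < N)%N -> (nu i.+1 <= f i <= nu i)%N) -> ssyt T -> ssyt (glue T).
Proof.
move=> hf /(ssyt_rowsP 0) hT; apply/(ssyt_rowsP 0) => i j; rewrite ltnS => iN jnu.
have lt i' k : (i' < N)%N && (k < f i')%N -> (tab_val 0 T (natcell (i', k)) < N)%N.
  by move=> h; apply: tab_val_lt; rewrite mem_rows_diagram.
split=> [k kj|h hi jh].
  rewrite !glue_val //; last exact: leq_ltn_trans jnu.
  case: ifP => hk; case: ifP => hj //.
  - by case/andP: hj => iN' jf; have [h1 _] := hT i j iN' jf; apply: h1.
  - by apply/ltnW/lt.
  - by move: hk hj; case: ltnP => //= _; lia.
rewrite !glue_val //; last by lia.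
have hN : (h < N)%N by lia.
have jf : (j < f h)%N.
  by have /andP[+ _] := hf h hN; apply: leq_trans; apply: leq_trans jnu _; apply: nu_anti.
rewrite hN jf /=; case: ifP => hj; last by apply: lt; rewrite hN.
by case/andP: hj => iN' jf'; have [_ h1] := hT i j iN' jf'; apply: h1.
Qed.
Lemma glue_inj f : (forall i, (i < N)%N -> (nu i.+1 <= f i <= nu i)%N) ->
  injective (@glue f).
Proof.
move=> hf T1 T2 e; apply/ffunP => c; apply: val_inj => /=.
have [i [k [ec iN kf]]] := rows_diagramP (valP c).
have h : (i < N)%N && (k < f i)%N by rewrite iN.
have knu : (k < nu i)%N by have /andP[] := sub_rows_diagram hf h.
rewrite -!(tab_valE 0) ec.
have E T : tab_val 0 T (natcell (i, k)) = tab_val 0 (@glue f T) (natcell (i, k)).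
  by rewrite glue_val ?h //; apply: ltnW.
by rewrite !E e.
Qed.

Lemma glue_surj (f : nat -> nat) (T : big) :
  (forall i, (i < N)%N -> (nu i.+1 <= f i <= nu i)%N) ->
  ssyt T -> (forall i, (i < N)%N -> cut T i = f i) ->
  exists2 T' : {ffun rows_diagram N f -> 'I_N}, ssyt T' & T = glue T'.
Proof.
move=> hf hT hc.
have lt (c : rows_diagram N f) : (tab_val 0 T (val c) < N)%N.
  have [i [k [-> iN kf]]] := rows_diagramP (valP c).
  rewrite cutP ?hc //; first exact: ltnW.
  by have /andP[_] := @sub_rows_diagram f i k hf ltac:(by rewrite iN).
pose T' : {ffun rows_diagram N f -> 'I_N} := [ffun c => Ordinal (lt c)].
have T'E i k : (i < N)%N -> (k < f i)%N ->
    tab_val 0 T' (natcell (i, k)) = tab_val 0 T (natcell (i, k)).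
  move=> iN kf; have hD : natcell (i, k) \in rows_diagram N f by rewrite mem_rows_diagram iN.
  by rewrite -[natcell _]/(val (FSetSub hD)) tab_valE ffunE.
exists T'.
  apply/(ssyt_rowsP 0) => i j iN jf; move: (hT) => /(ssyt_rowsP 0) h.
  have [|h1 h2] := h i j (leqW iN); first by have := hf i iN; lia.
  split=> [k kj|k ki kf].
    by rewrite !T'E //; [apply: h1|apply: leq_ltn_trans jf].
  rewrite !T'E //; last exact: ltn_trans iN.
  by apply: h2 => //; have := hf k (ltn_trans ki iN); lia.
apply/ffunP => c; apply: val_inj => /=.
have [i [k [ec iN kf]]] := rows_diagramP (valP c).
rewrite -(tab_valE 0 T) -(tab_valE 0 (glue T')) ec glue_val //.
case: ifP => [/andP[iN' kf']|]; first by rewrite T'E.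
have [iN'|Ni] /= := ltnP i N.
  rewrite -hc // -cutP //; move/negbT; rewrite -leqNgt => h.
  have : (tab_val 0 T (natcell (i, k)) < N.+1)%N.
    by apply: tab_val_lt; rewrite mem_rows_diagram iN.
  lia.
move=> _; have ei : i = N by lia.
subst i; have := ssyt_ge hT (leqnn N) kf.
have : (tab_val 0 T (natcell (N, k)) < N.+1)%N.
  by apply: tab_val_lt; rewrite mem_rows_diagram iN.
lia.
Qed.

Lemma glue_weight (f : nat -> nat) (T : {ffun rows_diagram N f -> 'I_N}) :
  (forall i, (i < N)%N -> (nu i.+1 <= f i <= nu i)%N) ->
  \prod_c x (glue T c) = x N ^+ (nu N + \sum_(i < N) (nu i - f i)) * \prod_c x (T c).
Proof.
move=> hf.
under eq_bigr => c _ do rewrite -(tab_valE 0).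
under [in RHS]eq_bigr => c _ do rewrite -(tab_valE 0).
rewrite (prod_rows_diagram _ _ (fun c => x (tab_val 0 (glue T) c))).
rewrite (prod_rows_diagram _ _ (fun c => x (tab_val 0 T c))) big_ord_recr /=.
rewrite [X in _ * X](eq_bigr (fun=> x N)); last first.
  by move=> j _; rewrite glue_val ?ltnn.
rewrite prodr_const card_ord mulrC exprD -mulrA; congr (_ * _).
rewrite expr_sum -big_split /=; apply: eq_bigr => i _.
have /andP[_ fi] := hf i (ltn_ord i).
rewrite -(big_mkord xpredT (fun j => x (tab_val 0 (glue T) (natcell (i : nat, j))))).
rewrite (big_cat_nat (leq0n _) fi) //= mulrC; congr (_ * _).
  rewrite (eq_big_nat _ _ (F2 := fun=> x N)).
    by rewrite big_const_nat iter_mulr_1.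
  by move=> j /andP[h1 h2]; rewrite glue_val ?(ltnW (ltn_ord i)) // ltn_ord ltnNge h1.
rewrite big_mkord; apply: eq_bigr => j _.
rewrite glue_val ?(ltnW (ltn_ord i)) ?ltn_ord //.
exact: leq_trans fi.
Qed.

(** Tableaux are grouped by the shape [f] left after deleting the entries [N]; interlacing says that
    the deleted cells form a horizontal strip. *)
Lemma tab_sum_branch :
  tab_sum N.+1 nu = \sum_(f : {ffun 'I_N -> 'I_K.+1} | interlacing nu f)
     x N ^+ (nu N + \sum_(i < N) (nu i - f i)) * tab_sum N (extend f).
Proof.
have cutK (T : big) i : (i <= N)%N -> (cut T i < K.+1)%N.
  by move=> iN; rewrite ltnS; apply: leq_trans (cut_le T i) (leq_trans (nu_anti (leq0n i) iN) nu_K).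
pose cutf (T : big) : {ffun 'I_N -> 'I_K.+1} := [ffun i => inord (cut T (i : 'I_N))].
have cutfE T (i : 'I_N) : cutf T i = cut T i :> nat.
  by rewrite ffunE inordK // cutK // ltnW.
rewrite /tab_sum (partition_big cutf (interlacing nu)) /=; last first.
  by move=> T hT; apply/forallP => i; rewrite cutfE cut_interlacing.
apply: eq_bigr => f hf; have {hf}hf := interlacingP hf.
rewrite mulr_sumr.
transitivity (\sum_(T in (@glue (extend f)) @: [set T | ssyt T]) \prod_c x (T c)).
  apply: eq_bigl => T; apply/andP/imsetP => [[hT /eqP e]|[T' + ->]].
    have [|T' h1 h2] := @glue_surj (extend f) T hf hT.
      by move=> i iN; rewrite (extendE f (Ordinal iN)) -e cutfE.
    by exists T' => //; rewrite inE.
  rewrite inE => hT'; split; first exact: glue_ssyt.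
  apply/eqP/ffunP => i; apply: ord_inj; rewrite cutfE.
  have /andP[_ fi] := hf i (ltn_ord i).
  rewrite /cut (@find_iota _ _ (extend f i)) ?extendE //; first by rewrite -(extendE f).
  move=> k knu; rewrite glue_val ?(ltnW (ltn_ord i)) // ltn_ord extendE /=.
  case: ltnP => kf; last by rewrite leqnn.
  rewrite leqNgt; apply/negbTE; rewrite negbK; apply: tab_val_lt.
  by rewrite mem_rows_diagram ltn_ord extendE.
rewrite big_imset /=; last by move=> T1 T2 _ _ e; apply: (glue_inj hf e).
rewrite (eq_bigl (@ssyt (rows_diagram N (extend f)) N)); last by move=> T; rewrite inE.
apply: eq_bigr => T _; rewrite glue_weight //; congr (_ ^+ _ * _).
by congr (_ + _)%N; apply: eq_bigr => i _; rewrite extendE.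
Qed.

End Branching.
End Tableaux.

(** * The bialternant formula *)

Section Bialternant.
Variables (B : comNzRingType) (x : nat -> B).
Implicit Types (N : nat) (nu kap : nat -> nat).

Definition alternant N kap : B := \det (\matrix_(j < N, i < N) x i ^+ kap j).

Lemma big_ord_between (K a b : nat) (F : nat -> B) : (b <= K)%N ->
  \sum_(v < K.+1 | (a <= v <= b)%N) F v = \sum_(a <= v < b.+1) F v.
Proof.
move=> bK; rewrite -(big_mkord (fun v => (a <= v <= b)%N) F).
rewrite (big_nat_widen a _ K.+1 xpredT) // (big_nat_widenl a 0) //=.
by apply: eq_bigl => v; rewrite ltnS andbC.
Qed.

Lemma telescope_powers (X Y : B) (a b m : nat) : (a <= b)%N ->
  X ^+ (b + m.+1) - Y ^+ (b - a).+1 * X ^+ (a + m) =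
  (X - Y) * \sum_(a <= v < b.+1) X ^+ (v + m) * Y ^+ (b - v).
Proof.
move=> ab; rewrite -(subnK ab) addnK; elim: (b - a)%N => [|d IH].
  rewrite add0n big_nat1 subnn mulr1 expr1 mulrBl addnS exprS; ring.
rewrite big_nat_recr /=; last by lia.
rewrite subnn mulr1 addSn.
rewrite (eq_big_nat _ _ (F2 := fun v => X ^+ (v + m) * Y ^+ (d + a - v) * Y)); last first.
  by move=> v /andP[_ hv]; rewrite subSn ?exprSr ?mulrA.
rewrite -mulr_suml mulrDr mulrA -IH (_ : (d + a).+1 + m.+1 = ((d + a) + m.+1).+1)%N //.
rewrite (_ : (d + a).+1 + m = (d + a) + m.+1)%N ?addnS //.
by rewrite !exprS; ring.
Qed.

(** Row operations clear the last column except for its last entry. The other entries are then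
    divisible by [x i - x N], and the determinant of the quotients is expanded row by row, giving
    the branching of tableaux up to a product of differences. *)
Lemma alternant_branch N K nu : (forall i, (i < N)%N -> (nu i.+1 <= nu i)%N) ->
    (forall i, (i < N)%N -> (nu i <= K)%N) ->
  alternant N.+1 (fun j => nu j + (N - j))%N =
  \prod_(i < N) (x i - x N) * \sum_(f : {ffun 'I_N -> 'I_K.+1} | interlacing nu f)
     x N ^+ (nu N + \sum_(i < N) (nu i - f i)) *
     alternant N (fun j => extend f j + (N - j.+1))%N.
Proof.
move=> dec nuK; pose kap j := (nu j + (N - j))%N; pose y := x N.
pose A : 'M[B]_N.+1 := \matrix_(j, i) x i ^+ kap j.
(* Subtracts from each row the next one times the power of [y] that cancels the last column. *)
pose U : 'M[B]_N.+1 := \matrix_(j, k) ((k == j)%:R - (k == j.+1 :> nat)%:R * y ^+ (nu j - nu j.+1).+1).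
have detU : \det U = 1.
  rewrite -det_tr det_trig.
    rewrite big1 // => i _; rewrite !mxE eqxx.
    by rewrite (ltn_eqF (ltnSn i)) mul0r subr0.
  apply/is_trig_mxP => i j ij; rewrite !mxE.
  rewrite -val_eqE /= (ltn_eqF ij) (ltn_eqF (ltnW _)) ?mul0r ?subr0 //.
have UA j i : (U *m A) j i = if (j < N)%N
    then x i ^+ kap j - y ^+ (nu j - nu j.+1).+1 * x i ^+ kap j.+1 else x i ^+ kap j.
  rewrite mxE; under eq_bigr do rewrite !mxE mulrBl -mulrA.
  rewrite sumrB (bigD1 j) //= eqxx mul1r big1 ?addr0; last first.
    by move=> k /negPf->; rewrite mul0r.
  case: ltnP => jN; last first.
    rewrite big1 ?subr0 // => k _; rewrite (_ : (k == j.+1 :> nat) = false) ?mul0r //.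
    by apply/eqP; have := ltn_ord k; lia.
  have lt : (j.+1 < N.+1)%N by [].
  rewrite (bigD1 (Ordinal lt)) //= eqxx mul1r big1 ?addr0 // => k.
  by rewrite -val_eqE /= => /negPf->; rewrite mul0r.
pose M : 'M[B]_N := \matrix_(j, i) \sum_(v < K.+1 | (nu j.+1 <= v <= nu j)%N)
   x i ^+ (v + (N - j.+1)) * y ^+ (nu j - v).
have -> : alternant N.+1 kap = y ^+ nu N * (\prod_(i < N) (x i - y) * \det M).
  have -> : alternant N.+1 kap = \det (U *m A) by rewrite det_mulmx detU mul1r.
  rewrite (expand_det_col _ ord_max) (bigD1 ord_max) //= big1 ?addr0; last first.
    move=> j; rewrite -val_eqE /= => jN; have {}jN : (j < N)%N by have := ltn_ord j; lia.
    rewrite UA jN /= -exprD (_ : _ + kap j.+1 = kap j)%N ?subrr ?mul0r //.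
    by have := dec _ jN; rewrite /kap; lia.
  rewrite UA ltnn /kap subnn addn0 /cofactor -signr_odd oddD addbb mul1r; congr (_ * _).
  rewrite mulrC.
  have -> : \prod_(i < N) (x i - y) = \det (diag_mx (\row_(i < N) (x i - y))).
    by rewrite det_diag; apply: eq_bigr => i _; rewrite mxE.
  rewrite -det_mulmx; congr (\det _); apply/matrixP => j i.
  rewrite mul_mx_diag [LHS]mxE [LHS]mxE UA ![in RHS]mxE !lift_max ltn_ord /kap.
  rewrite (big_ord_between (nu j.+1) (fun v => x i ^+ (v + (N - j.+1)) * y ^+ (nu j - v)) (nuK _ (ltn_ord j))).
  rewrite [RHS]mulrC -telescope_powers ?dec //.
  by rewrite subnSK.
rewrite mulrCA; congr (_ * _).
under [in RHS]eq_bigr do rewrite exprD -mulrA.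
rewrite -mulr_sumr; congr (_ * _).
rewrite /determinant; under eq_bigr => s _.
  under eq_bigr do rewrite mxE.
  rewrite (bigA_distr_big_dep (fun (j : 'I_N) (v : 'I_K.+1) => (nu j.+1 <= v <= nu j)%N)) mulr_sumr.
over.
rewrite exchange_big /=; apply: eq_big => [f|f _].
  by apply/familyP/forallP => h i; have := h i; rewrite ?inE.
rewrite /alternant /determinant mulr_sumr; apply: eq_bigr => s _.
rewrite mulrCA; congr (_ * _); rewrite big_split mulrC /= expr_sum; congr (_ * _).
by apply: eq_bigr => j _; rewrite mxE extendE.
Qed.

Lemma tab_sum0 nu : tab_sum x 0 nu = 1.
Proof.
have no (c : rows_diagram 0 nu) : False by have [i [j []]] := rows_diagramP (valP c).
have T0 : {ffun rows_diagram 0 nu -> 'I_0} by apply: finfun => c; case: (no c).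
rewrite /tab_sum (big_pred1 T0) => [|T].
  by rewrite big1 // => c; case: (no c).
have -> : T = T0 by apply/ffunP => c; case: (no c).
by rewrite /= eqxx; apply: (introT forallP) => c; case: (no c).
Qed.

(** This is the branching of the zero shape, where [f = 0] is the only interlacing choice. *)
Lemma alternant_rho N :
  alternant N.+1 (fun j => N - j)%N = \prod_(i < N) (x i - x N) * alternant N (fun j => N - j.+1)%N.
Proof.
have := @alternant_branch N 0 (fun=> 0%N) (fun _ _ => isT) (fun _ _ => isT).
have int0 (f : {ffun 'I_N -> 'I_1}) : interlacing (fun=> 0%N) f.
  by apply/forallP => i; rewrite leq0n; case: (f i) => -[].
rewrite (eq_bigl _ _ int0).
rewrite (big_pred1 [ffun=> ord0]) => [|f]; last first.
  by apply/esym/eqP/ffunP => i; rewrite ffunE; apply: val_inj; case: (f i) => -[].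
move=> e; apply: etrans e _; congr (_ * _).
rewrite big1 => [|i _]; last exact: sub0n.
rewrite expr0 mul1r; congr (\det _).
by apply/matrixP => j i; rewrite !mxE extendE ffunE.
Qed.

Lemma bialternant N nu : (forall i, (i.+1 < N)%N -> (nu i.+1 <= nu i)%N) ->
  alternant N (fun j => N - j.+1)%N * tab_sum x N nu =
  alternant N (fun j => nu j + (N - j.+1))%N.
Proof.
elim: N nu => [|N IH] nu dec; first by rewrite tab_sum0 mulr1 /alternant !det_mx00.
have nu0 i : (i <= N)%N -> (nu i <= nu 0)%N.
  elim: i => // i IHi iN; apply: leq_trans (IHi (ltnW iN)); exact: dec.
rewrite (@tab_sum_branch B x N (nu 0) nu) // alternant_rho.
rewrite (@alternant_branch N (nu 0) nu) //; last by move=> i iN; apply/nu0/ltnW.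
rewrite -mulrA; congr (_ * _); rewrite mulr_sumr; apply: eq_bigr => f hf.
rewrite mulrCA IH // => i iN; have h := interlacingP hf.
by have := h i (ltnW iN); have := h i.+1 iN; lia.
Qed.
End Bialternant.

(** * Ribbon tableaux as words *)

Section Words.
Variables (B : comNzRingType) (x : nat -> B) (N : nat) (right : nat -> bool) (a : nat).

(** Entries weakly increase along a row; going up a column they strictly decrease. *)
Definition step_ok (t h h' : nat) : bool := if right t then (h <= h')%N else (h' < h)%N.

Definition good_word m (w : {ffun 'I_m -> 'I_N}) : bool :=
  [forall i : 'I_m, forall i' : 'I_m, (i' == i.+1 :> nat) ==> step_ok (a + i) (w i) (w i')].

Definition ends_before m (w : {ffun 'I_m -> 'I_N}) (h : nat) : bool :=
  [forall i : 'I_m, (i.+1 == m) ==> step_ok (a + i) (w i) h].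

Definition word_sum m : B := \sum_(w : {ffun 'I_m -> 'I_N} | good_word w) \prod_i x (w i).

Definition word_sum_before m h : B :=
  \sum_(w : {ffun 'I_m -> 'I_N} | good_word w && ends_before w h) \prod_i x (w i).

Definition rcons_word m (w : {ffun 'I_m -> 'I_N}) (h : 'I_N) : {ffun 'I_m.+1 -> 'I_N} :=
  [ffun i => if unlift ord_max i is Some i' then w i' else h].

Lemma sum_rcons_word m (P : pred {ffun 'I_m.+1 -> 'I_N}) (F : {ffun 'I_m.+1 -> 'I_N} -> B) :
  \sum_(w | P w) F w = \sum_(h < N) \sum_(w | P (rcons_word w h)) F (rcons_word w h).
Proof.
rewrite pair_big_dep /= (reindex (fun p : 'I_N * {ffun 'I_m -> 'I_N} => rcons_word p.2 p.1)) //=.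
exists (fun w : {ffun 'I_m.+1 -> 'I_N} => (w ord_max, [ffun i => w (lift ord_max i)])).
  move=> [h w] _; congr pair; first by rewrite ffunE unlift_none.
  by apply/ffunP => i; rewrite !ffunE liftK.
move=> w _; apply/ffunP => i; rewrite ffunE /=.
by case: unliftP => [j ->|->]; rewrite ?ffunE.
Qed.

Lemma rcons_word_max m (w : {ffun 'I_m -> 'I_N}) h : rcons_word w h ord_max = h.
Proof. by rewrite ffunE unlift_none. Qed.

Lemma rcons_word_lift m (w : {ffun 'I_m -> 'I_N}) h i : rcons_word w h (lift ord_max i) = w i.
Proof. by rewrite ffunE liftK. Qed.

Lemma good_rcons m (w : {ffun 'I_m -> 'I_N}) h :
  good_word (rcons_word w h) = good_word w && ends_before w h.
Proof.
apply/'forall_forallP/andP => [g|[/'forall_forallP g /forallP e] i i'].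
  split; first apply/'forall_forallP => i i'.
    have := g (lift ord_max i) (lift ord_max i').
    by rewrite !rcons_word_lift !lift_max.
  apply/forallP => i; have := g (lift ord_max i) ord_max.
  by rewrite rcons_word_lift rcons_word_max lift_max eq_sym.
case: (unliftP ord_max i) => [j ->|->]; last first.
  by apply/implyP => /= /eqP e'; have := ltn_ord i'; rewrite e' ltnn.
rewrite lift_max rcons_word_lift; case: (unliftP ord_max i') => [j' ->|->].
  by rewrite rcons_word_lift lift_max; apply: g.
by rewrite rcons_word_max eq_sym; apply: e.
Qed.

Lemma ends_rcons m (w : {ffun 'I_m -> 'I_N}) (h : 'I_N) h' :
  ends_before (rcons_word w h) h' = step_ok (a + m) h h'.
Proof.
apply/forallP/idP => [/(_ ord_max)|s i]; first by rewrite rcons_word_max eqxx.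
apply/implyP; rewrite eqSS => /eqP e.
have ei : i = ord_max by apply: val_inj.
by rewrite ei rcons_word_max.
Qed.

Lemma prod_rcons m (w : {ffun 'I_m -> 'I_N}) (h : 'I_N) :
  \prod_i x (rcons_word w h i) = x h * \prod_i x (w i).
Proof.
rewrite big_ord_recr /= rcons_word_max mulrC; congr (_ * _); apply: eq_bigr => i _.
rewrite (_ : widen_ord _ _ = lift ord_max i) ?rcons_word_lift //.
by apply: ord_inj; rewrite lift_max.
Qed.

Lemma word_sumS m : word_sum m.+1 = \sum_(h < N) x h * word_sum_before m h.
Proof.
rewrite /word_sum sum_rcons_word; apply: eq_bigr => h _; rewrite mulr_sumr.
by apply: eq_big => [w|w _]; rewrite ?good_rcons ?prod_rcons.
Qed.

Lemma word_sum_beforeS m h : word_sum_before m.+1 h =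
  \sum_(h' < N | step_ok (a + m) h' h) x h' * word_sum_before m h'.
Proof.
rewrite /word_sum_before sum_rcons_word [RHS]big_mkcond /=; apply: eq_bigr => h' _.
rewrite mulr_sumr; under eq_bigl do rewrite good_rcons ends_rcons.
case: ifP => s; last by rewrite big_pred0 // => w; rewrite andbF.
by apply: eq_big => [w|w _]; rewrite ?andbT ?prod_rcons.
Qed.

Lemma empty_word_unique (w w' : {ffun 'I_0 -> 'I_N}) : w = w'.
Proof. by apply/ffunP => -[]. Qed.

Lemma sum_empty_word (P : pred {ffun 'I_0 -> 'I_N}) :
  (forall w, P w) -> \sum_(w | P w) \prod_i x (w i) = 1.
Proof.
move=> hP; have w0 : {ffun 'I_0 -> 'I_N} by apply: finfun => -[].
rewrite (big_pred1 w0) => [|w]; first by rewrite big_ord0.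
by rewrite hP /= (empty_word_unique w w0) eqxx.
Qed.

Lemma word_sum0 : word_sum 0 = 1.
Proof. by apply: sum_empty_word => w; apply/forallP => -[]. Qed.

Lemma word_sum_before0 h : word_sum_before 0 h = 1.
Proof. by apply: sum_empty_word => w; apply/andP; split; apply/forallP => -[]. Qed.
End Words.

(** * Entries of the rows as generating functions of words *)

Section Entries.
Variables (C : numClosedFieldType) (n : nat) (B : comAlgType C) (x : nat -> B) (N : nat).
Variables (alpha : nat -> nat) (right : nat -> bool) (j : 'I_n).
Hypothesis alpha_gt0 : (0 < alpha j)%N.
Let z t h := zrow n N x alpha right t h 0 j.

Lemma zrowS t h : z t.+1 h = (alpha j == t.+1)%:R +
  \sum_(h' < N | step_ok right t h' h) x h' * z t h'.
Proof.
rewrite /z /= /step_ok mxE /srcv mxE; congr (_ + _); case: (right t).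
  rewrite summxE (eq_bigr (fun h' => x h' * z t h')); last by move=> h' _; rewrite mxE.
  rewrite (big_nat_widen 0 _ N xpredT) ?geq_minr // big_mkord /=.
  by apply: eq_bigl => i; rewrite leq_min ltnS ltn_ord andbT.
rewrite summxE (eq_bigr (fun h' => x h' * z t h')); last by move=> h' _; rewrite mxE.
by rewrite (big_nat_widenl h.+1 0) //= big_mkord.
Qed.

Lemma zrow_word m h : z (alpha j + m) h = word_sum_before x N right (alpha j) m h.
Proof.
have z0 t h' : (t < alpha j)%N -> z t h' = 0.
  elim: t h' => [|t IH] h' lt; first by rewrite /z mxE.
  rewrite zrowS (gtn_eqF lt) add0r big1 // => k _.
  by rewrite IH ?mulr0 // ltnW.
elim: m h => [|m IH] h.
  rewrite addn0 word_sum_before0 -(prednK alpha_gt0) zrowS prednK // eqxx.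
  by rewrite big1 ?addr0 // => k _; rewrite z0 ?mulr0 // prednK.
rewrite addnS zrowS word_sum_beforeS ltn_eqF ?ltnS ?leq_addr // add0r.
by apply: eq_bigr => h' _; rewrite IH.
Qed.

Lemma sinkv_word t : sinkv n N x alpha right t 0 j =
  if (alpha j <= t)%N then word_sum x N right (alpha j) (t - alpha j) else 0.
Proof.
case: t => [|t]; first by rewrite /= mxE leqn0 (gtn_eqF alpha_gt0).
have -> : sinkv n N x alpha right t.+1 0 j = (alpha j == t.+1)%:R + \sum_(h < N) x h * z t h.
  rewrite /= mxE /srcv mxE summxE big_mkord; congr (_ + _).
  by apply: eq_bigr => h _; rewrite mxE.
have z0 t' h' : (t' < alpha j)%N -> z t' h' = 0.
  elim: t' h' => [|t' IH] h' lt; first by rewrite /z mxE.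
  rewrite zrowS (gtn_eqF lt) add0r big1 // => k _.
  by rewrite IH ?mulr0 // ltnW.
case: ltngtP => [lt|lt|e].
- rewrite add0r subSn // word_sumS; apply: eq_bigr => h _.
  by rewrite -zrow_word subnKC.
- by rewrite add0r big1 // => h _; rewrite z0 ?mulr0 // ltnW.
- by rewrite e subnn word_sum0 big1 ?addr0 // => h _; rewrite z0 ?mulr0 // e.
Qed.
End Entries.

(** * Temperley-Lieb words acting on matchings *)

Section Matchings.
Variable P : finType.
Implicit Types (M : {ffun P -> P}) (x y z w p : P).

Definition matching M : bool := [forall p, (M p != p) && (M (M p) == p)].

Lemma matchingP M : reflect (forall p, M p <> p /\ M (M p) = p) (matching M).
Proof.
apply: (iffP forallP) => h p; first by case/andP: (h p) => /eqP ? /eqP.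
by case: (h p) => /eqP-> /eqP->.
Qed.

(** Effect of a generator on a diagram: [x] and [y] become partners, and so do their former
    partners. If they already were partners, a closed loop is dropped and [M] does not change. *)
Definition cup x y M : {ffun P -> P} :=
  [ffun p => if p == x then y else if p == y then x
             else if p == M x then M y else if p == M y then M x else M p].

Lemma cup_matching x y M : x <> y -> matching M -> matching (cup x y M).
Proof.
move=> xy /matchingP h; apply/matchingP => p; rewrite !ffunE.
have [hx hx'] := h x; have [hy hy'] := h y; have [hp hp'] := h p.
case: (p =P x) => [->|px].
  by rewrite (introF eqP (nesym xy)) eqxx; split=> // /esym.
case: (p =P y) => [->|py]; first by rewrite eqxx.
case: (p =P M x) => [pe|pn].
  have ->: (M y == x) = false by apply/eqP; congruence.
  have ->: (M y == y) = false by apply/eqP; congruence.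
  have ->: (M y == M x) = false by apply/eqP; congruence.
  by rewrite eqxx; split; congruence.
case: (p =P M y) => [pe|pn'].
  have ->: (M x == x) = false by apply/eqP; congruence.
  have ->: (M x == y) = false by apply/eqP; congruence.
  by rewrite eqxx; split; congruence.
do 4 (case: eqP => [?|?]; first by congruence).
by [].
Qed.

Lemma cup_sym x y M : x <> y -> matching M -> cup y x M = cup x y M.
Proof.
move=> xy /matchingP h; apply/ffunP=> p; rewrite !ffunE.
have [hx hx'] := h x; have [hy hy'] := h y.
by do !(case: eqP => //); congruence.
Qed.

Lemma cup_id x y M : matching M -> M x = y -> cup x y M = M.
Proof.
move=> /matchingP h e; apply/ffunP=> p; rewrite !ffunE.
have [hx hx'] := h x.
by do !(case: eqP => //); congruence.
Qed.

Lemma cup_x x y M : cup x y M x = y.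
Proof. by rewrite ffunE eqxx. Qed.

Lemma cup_y x y M : x <> y -> cup x y M y = x.
Proof. by move=> xy; rewrite ffunE (introF eqP (nesym xy)) eqxx. Qed.

(** The relation [t_i t_j t_i = t_i], on a matching that already has the arc made by the first
    [t_i]; the last cup closes no loop. *)
Lemma cup_adj x y z M : x <> y -> y <> z -> x <> z -> matching M -> M x = y ->
  cup x y (cup y z M) = M /\ cup y z M x <> y.
Proof.
move=> xy yz xz /matchingP h e.
have [hx hx'] := h x; have [hy hy'] := h y; have [hz hz'] := h z.
have E : cup y z M x = M z.
  by rewrite ffunE; do !(case: eqP => //); congruence.
split; last by rewrite E; congruence.
have Ey : cup y z M y = z by rewrite cup_x.
apply/ffunP => p; rewrite ffunE E Ey ffunE.
have [hp hp'] := h p.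
by do !(case: eqP => //); congruence.
Qed.

Lemma cup_far x y z w M : x <> y -> z <> w -> x <> z -> x <> w -> y <> z -> y <> w ->
    matching M ->
  cup x y (cup z w M) = cup z w (cup x y M) /\
  ((M z == w) + (cup z w M x == y) = (M x == y) + (cup x y M z == w))%N.
Proof.
move=> xy zw xz xw yz yw hM; have /matchingP h := hM.
have h1 q : M (M q) = q by case: (h q).
have h2 q : M q <> q by case: (h q).
case: (M x =P y) => [e|ne].
  have E : cup z w M x = y.
    by rewrite ffunE; do !(case: eqP => //); congruence.
  rewrite (cup_id hM e) (cup_id (cup_matching zw hM) E) E eqxx addnC.
  by split.
case: (M z =P w) => [e|ne'].
  have E : cup x y M z = w.
    by rewrite ffunE; do !(case: eqP => //); congruence.
  rewrite (cup_id hM e) (cup_id (cup_matching xy hM) E) E eqxx (introF eqP ne).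
  by split.
have [hx hx'] := h x; have [hy hy'] := h y; have [hz hz'] := h z; have [hw hw'] := h w.
pose val q c d := if q == M c then M d else if q == M d then M c else M q.
have valE q c d : q <> c -> q <> d -> cup c d M q = val q c d.
  by move=> /eqP/negPf qc /eqP/negPf qd; rewrite ffunE qc qd.
have Ex := valE x z w xz xw; have Ey := valE y z w yz yw.
have Ez := valE z x y (nesym xz) (nesym yz); have Ew := valE w x y (nesym xw) (nesym yw).
have swap a b : (a == M b) = (b == M a) by apply/eqP/eqP; congruence.
move: Ex Ey Ez Ew; rewrite /val {val valE}.
rewrite (swap x z) (swap x w) (swap y z) (swap y w) => Ex Ey Ez Ew.
have key : forall p, cup x y (cup z w M) p = cup z w (cup x y M) p.
  move=> p; have [hp hp'] := h p; rewrite !(ffunE _ p).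
  move: Ex Ey Ez Ew.
  case: (z =P M x) => ?; case: (w =P M x) => ?; case: (z =P M y) => ?;
    case: (w =P M y) => ? e1 e2 e3 e4; try congruence;
  rewrite ?(e1, e2, e3, e4); repeat (case: eqP => ?; try congruence).
split; first exact/ffunP.
rewrite Ex Ez.
by case: (z =P M x) => ?; case: (w =P M x) => ?; case: (z =P M y) => ?;
    case: (w =P M y) => ?; try congruence;
  repeat (case: eqP => ?; try congruence).
Qed.

(** The labels orient the arcs: the two ends of each carry opposite values. *)
Definition consistent M (L : P -> bool) : Prop := forall p, L (M p) = ~~ L p.

(** The former partners of [x] and [y], now joined, carry opposite labels, so they fit the labels of
    [x] and [y] in one of the two orders. *)
Lemma cup_consistent x y M (L : P -> bool) : x <> y -> matching M ->
    consistent (cup x y M) L ->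
  L x <> L y /\ (consistent M L \/ consistent M (fun p => L (tperm x y p))).
Proof.
move=> xy hM hL; have /matchingP h := hM.
have Lxy : L y = ~~ L x by rewrite -hL cup_x.
split; first by rewrite Lxy; case: (L x).
have [hx hx'] := h x; have [hy hy'] := h y.
case: (M x =P y) => [e|ne]; first by left; rewrite -(cup_id hM e).
have Lab : L (M y) = ~~ L (M x).
  rewrite -hL ffunE; congr L.
  by do !(case: eqP => //); congruence.
have Lo p : p <> x -> p <> y -> p <> M x -> p <> M y -> L (M p) = ~~ L p.
  by move=> /eqP/negPf p1 /eqP/negPf p2 /eqP/negPf p3 /eqP/negPf p4;
     rewrite -hL ffunE p1 p2 p3 p4.
have [La|La] := eqVneq (L (M x)) (~~ L x).
  left=> p; case: (p =P x) => [->//|px].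
  case: (p =P y) => [->|py]; first by rewrite Lab La Lxy.
  case: (p =P M x) => [->|pMx]; first by rewrite hx' La negbK.
  case: (p =P M y) => [->|pMy]; first by rewrite hy' Lab La negbK Lxy.
  exact: Lo.
have {}La : L (M x) = L x by move: La; case: (L (M x)); case: (L x).
right=> p.
have T q : q <> x -> q <> y -> tperm x y q = q by move=> *; apply: tpermD; apply/eqP/nesym.
have ne' : M y <> x by congruence.
case: (p =P x) => [->|px]; first by rewrite tpermL T // La Lxy negbK.
case: (p =P y) => [->|py]; first by rewrite tpermR T // Lab La.
case: (p =P M x) => [->|pMx]; first by rewrite hx' tpermL T // Lxy La.
case: (p =P M y) => [->|pMy]; first by rewrite hy' tpermR T // Lab La negbK.
have [hp hp'] := h p.
by rewrite !T ?Lo //; congruence.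
Qed.

Lemma consistent_cup x y M (L : P -> bool) : x <> y -> matching M ->
    L x <> L y -> consistent M (fun p => L (tperm x y p)) ->
  consistent (cup x y M) L.
Proof.
move=> xy hM Lxy hL; have /matchingP h := hM.
have {}Lxy : L y = ~~ L x by move: Lxy; case: (L x); case: (L y).
have [hx hx'] := h x; have [hy hy'] := h y.
have T q : q <> x -> q <> y -> tperm x y q = q by move=> *; apply: tpermD; apply/eqP/nesym.
case: (M x =P y) => [e|ne].
  rewrite (cup_id hM e) => p; case: (p =P x) => [->|px]; first by rewrite e.
  case: (p =P y) => [->|py]; first by rewrite -e hx' e Lxy negbK.
  by have [hp hp'] := h p; move: (hL p); rewrite !T //; congruence.
have ne' : M y <> x by congruence.
have La : L (M x) = L x by rewrite -[M x]T ?hL ?tpermL ?Lxy ?negbK.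
have Lb : L (M y) = L y by rewrite -[M y]T ?hL ?tpermR // Lxy.
move=> p; rewrite ffunE.
case: (p =P x) => [->//|px].
case: (p =P y) => [->|py]; first by rewrite Lxy negbK.
case: (p =P M x) => [->|pMx]; first by rewrite Lb La.
case: (p =P M y) => [->|pMy]; first by rewrite Lb La Lxy negbK.
by have [hp hp'] := h p; move: (hL p); rewrite !T //; congruence.
Qed.

End Matchings.

(** * Representation of TL_n(2) on perfect matchings *)

Section Words.
Variable n : nat.
Implicit Types (k : 'I_n.-1) (ks : seq 'I_n.-1) (u v : 'S_n) (I J : {set 'I_n}).

Notation point := ('I_n * bool)%type.
Implicit Type (M : {ffun point -> point}).

Definition ordl k : 'I_n := Ordinal (ltnW (adj_transp_subproof k)).
Definition ordr k : 'I_n := Ordinal (adj_transp_subproof k).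

Lemma adj_transpE k : adj_transp k = tperm (ordl k) (ordr k).
Proof. by []. Qed.

Lemma ordlr k : ordl k != ordr k.
Proof. by rewrite -val_eqE /=; lia. Qed.

Definition step M k := cup (ordl k, true) (ordr k, true) M.
Definition loop M k : nat := (M (ordl k, true) == (ordr k, true)).

Lemma points_neq k : (ordl k, true) <> (ordr k, true).
Proof. by case=> /eqP; rewrite eqn_leq ltnn andbF. Qed.

Lemma step_matching M k : matching M -> matching (step M k).
Proof. by apply: cup_matching; apply: points_neq. Qed.

Lemma foldl_step_matching M ks : matching M -> matching (foldl step M ks).
Proof. by elim: ks M => [|k ks IH] M hM; [|apply: (IH (step M k)); apply: step_matching]. Qed.

Fixpoint loops M ks : nat :=
  if ks is k :: ks' then (loop M k + loops (step M k) ks')%N else 0%N.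

Lemma loops_cat M ks ks' :
  loops M (ks ++ ks') = (loops M ks + loops (foldl step M ks) ks')%N.
Proof.
elim: ks M => [|k ks IH] M; first by rewrite add0n.
by rewrite cat_cons [LHS]/= IH addnA.
Qed.

Lemma loop_step M k : loop (step M k) k = 1%N.
Proof. by rewrite /loop /step cup_x eqxx. Qed.

Lemma step_step M k : matching M -> step (step M k) k = step M k.
Proof. by move=> hM; apply: cup_id; [apply: step_matching|apply: cup_x]. Qed.

Lemma step_adj M i j : matching M -> gen_dist i j = 1%N ->
  step (step (step M i) j) i = step M i /\
  (loop (step M i) j + loop (step (step M i) j) i = 0)%N.
Proof.
move=> /(step_matching i) hM; rewrite /gen_dist => ij.
have pneq (a b : 'I_n) c d : (a : nat) <> b -> (a, c) <> (b, d) by move=> ne [e]; case: ne;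
  rewrite e.
have Exy := cup_x (ordl i, true) (ordr i, true) M.
have Eyx := cup_y M (points_neq (k := i)).
rewrite -/(step M i) in Exy Eyx.
move: (step M i) hM Exy Eyx => {}M hM Exy Eyx; rewrite /loop /step.
have [e|e] : j = i.+1 :> nat \/ i = j.+1 :> nat by move: ij; lia.
- have -> : ordl j = ordr i by apply: val_inj; rewrite /= e.
  have [|||||-> /eqP/negPf->] := @cup_adj _ (ordl i, true) (ordr i, true) (ordr j, true) M.
  - exact: points_neq.
  - by apply: pneq => /=; lia.
  - by apply: pneq => /=; lia.
  - by [].
  - by [].
  by rewrite Eyx (introF eqP _) //; apply: pneq => /=; lia.
- have o : ordr j = ordl i by apply: val_inj; rewrite /= e.
  have nji : (ordl i, true) <> (ordl j, true) by apply: pneq => /=; lia.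
  rewrite o (cup_sym nji) // -(cup_sym (@points_neq i)); last exact: cup_matching.
  have [|||||-> ne] := @cup_adj _ (ordr i, true) (ordl i, true) (ordl j, true) M.
  - exact/nesym/points_neq.
  - exact: nji.
  - by apply: pneq => /=; lia.
  - by [].
  - by [].
  split=> //.
  have -> : (M (ordl j, true) == (ordl i, true)) = false.
    apply/eqP => h; have /matchingP/(_ (ordl j, true))[_] := hM.
    by rewrite h Exy => -[]; lia.
  case: eqP => // h; case: ne.
  by have /matchingP/(_ (ordl i, true))[_] := cup_matching nji hM; rewrite h.
Qed.

Lemma step_far M i j : matching M -> (1 < gen_dist i j)%N ->
  step (step M i) j = step (step M j) i /\
  (loop M i + loop (step M i) j = loop M j + loop (step M j) i)%N.
Proof.
move=> hM; rewrite /gen_dist => ij.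
have pneq (a b : 'I_n) c d : (a : nat) <> b -> (a, c) <> (b, d) by move=> ne [e]; case: ne;
  rewrite e.
rewrite /loop /step.
have [|||||||-> ->] := @cup_far _ (ordl j, true) (ordr j, true) (ordl i, true) (ordr i, true) M;
  first [exact: hM | by apply: pneq => /=; lia | by split].
Qed.


Variable C : numClosedFieldType.
Implicit Types (x y : free_alg C n).

(** Letters act from left to right. Functions that are not matchings get 0, so that [psi] is
    multiplicative with sums over all functions. *)
Definition weight M M' (m : fmonom 'I_n.-1) : C :=
  if matching M && (foldl step M m == M') then 2%:R ^+ loops M m else 0.

(* The matrix coefficient of [x] acting on perfect matchings of [2 * n] points:
   [t_k] joins two adjacent points by [cup], and a closed loop counts for 2. *)
Definition psi x M M' : C := monalg.mmap idfun (weight M M') x.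

Lemma psiB x y M M' : psi (x - y) M M' = psi x M M' - psi y M M'.
Proof. exact: (monalg.mmapB (f := idfun)). Qed.

Lemma psiD x y M M' : psi (x + y) M M' = psi x M M' + psi y M M'.
Proof. exact: (monalg.mmapD (f := idfun)). Qed.

Lemma psi0 M M' : psi 0 M M' = 0.
Proof. exact: (monalg.mmap0 (f := idfun)). Qed.

Lemma psiZ (c : C) x M M' : psi (c *: x) M M' = c * psi x M M'.
Proof.
rewrite /psi (monalg.mmapEw (monalg.msuppZ_le _ _)) monalg.mmapE mulr_sumr.
by apply: eq_bigr => m _; rewrite linearZ mulrA.
Qed.

Lemma psi_sum (I : finType) (p : pred I) (F : I -> free_alg C n) M M' :
  psi (\sum_(i | p i) F i) M M' = \sum_(i | p i) psi (F i) M M'.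
Proof. by apply: (big_morph (fun x => psi x M M')) => [x y|]; rewrite ?psiD ?psi0. Qed.

Lemma weightM M M' (m m' : fmonom 'I_n.-1) :
  weight M M' (monalg.mul m m') = \sum_M1 weight M M1 m * weight M1 M' m'.
Proof.
rewrite /weight; have -> : ((monalg.mul m m') : seq _) = m ++ m'.
  by rewrite fmM.
case hM: (matching M) => /=; last by rewrite big1 // => M1 _; rewrite mul0r.
rewrite (bigD1 (foldl step M m)) //= eqxx foldl_step_matching //= big1 ?addr0.
  by rewrite foldl_cat loops_cat; case: eqP => _; rewrite ?mulr0 ?exprD.
by move=> M1 /negPf ne; rewrite eq_sym ne mul0r.
Qed.

Lemma psiM x y M M' : psi (x * y) M M' = \sum_M1 psi x M M1 * psi y M1 M'.
Proof.
rewrite /psi [x * y]malgME raddf_sum /=.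
under [RHS]eq_bigr do rewrite mulr_suml.
rewrite exchange_big; apply: eq_bigr => m _ /=.
rewrite raddf_sum /=.
under [RHS]eq_bigr do rewrite mulr_sumr.
rewrite exchange_big; apply: eq_bigr => m' _ /=.
rewrite monalg.mmapU weightM mulr_sumr; apply: eq_bigr => M1 _ /=.
by rewrite mulrACA.
Qed.

Lemma psiU (m : fmonom 'I_n.-1) M M' : psi (mkmalgU m 1) M M' = weight M M' m.
Proof. by rewrite /psi (monalg.mmapU (f := idfun)) mul1r. Qed.

Lemma psi1 M M' : psi 1 M M' = ((matching M) && (M == M'))%:R.
Proof.
rewrite [1](_ : _ = mkmalgU (monalg.one : fmonom _) 1) // psiU /weight fm1 /=.
by case: ifP.
Qed.

Lemma psi_gens ks M M' : psi (\prod_(k <- ks) TL_gen C k) M M' =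
  if matching M && (foldl step M ks == M') then 2%:R ^+ loops M ks else 0.
Proof.
rewrite (_ : \prod_(k <- ks) TL_gen C k = mkmalgU (fmonom_of_seq fmonom_key ks) 1).
  by rewrite psiU /weight fmE.
elim: ks => [|k ks IH]; first by rewrite big_nil; congr mkmalgU.
rewrite big_cons IH /TL_gen [_ * _]fgmulUU mulr1; congr mkmalgU.
by apply: val_inj; rewrite /= fmM /fmu !fmE.
Qed.

Lemma psi_gen_id k M M' : psi (TL_gen C k) M M' =
  if matching M && (step M k == M') then 2%:R ^+ loop M k else 0.
Proof. by have := psi_gens [:: k] M M'; rewrite big_seq1 /= addn0. Qed.

Lemma psi_ideal x M M' : TL_ideal x -> psi x M M' = 0.
Proof.
move=> hx; elim: hx M M' => {x}
  [k|i j ij|i j ij||x y _ IHx _ IHy|x y z _ IHy] M M'.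
- have -> : TL_gen C k ^+ 2 = \prod_(i <- [:: k; k]) TL_gen C i.
    by rewrite !big_cons big_nil mulr1 expr2.
  rewrite psiB psi_gens psiZ psi_gen_id /=.
  case hM: (matching M); rewrite ?mulr0 ?subrr //=.
  rewrite step_step // loop_step addn0; case: eqP => _; rewrite ?mulr0 ?subrr //.
  by rewrite addn1 exprS subrr.
- have -> : TL_gen C i * TL_gen C j * TL_gen C i = \prod_(k <- [:: i; j; i]) TL_gen C k.
    by rewrite !big_cons big_nil mulr1 mulrA.
  rewrite psiB psi_gens psi_gen_id /=.
  case hM: (matching M); rewrite ?subrr //=.
  have [E1 E2] := step_adj hM ij.
  rewrite (addn0 (loop (step (step M i) j) i)) E2 (addn0 (loop M i)).
  apply/eqP; rewrite subr_eq0; apply/eqP.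
  exact: (congr1 (fun s => if s == M' then 2%:R ^+ _ else 0 : C) E1).
- have E k k' : TL_gen C k * TL_gen C k' = \prod_(i <- [:: k; k']) TL_gen C i.
    by rewrite !big_cons big_nil mulr1.
  rewrite !E psiB !psi_gens /=.
  case hM: (matching M); rewrite ?subrr //=.
  have [E1 E2] := step_far hM ij.
  rewrite (addn0 (loop (step M i) j)) (addn0 (loop (step M j) i)).
  move: E2; move: (loop M i + _)%N => p.
  move=> ->; apply/eqP; rewrite subr_eq0; apply/eqP.
  exact: (congr1 (fun s => if s == M' then 2%:R ^+ _ else 0 : C) E1).
- exact: psi0.
- by rewrite psiD IHx IHy addr0.
- rewrite psiM big1 // => M1 _; rewrite psiM big1 ?mul0r // => M2 _.
  by rewrite IHy mulr0.
Qed.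

Lemma psi_eq x y M M' : TL_eq x y -> psi x M M' = psi y M M'.
Proof. by move/(psi_ideal M M')/eqP; rewrite psiB subr_eq0 => /eqP. Qed.

End Words.

(** * Particle configurations carried by a word *)

Section Walks.
Variable n : nat.
Implicit Types (k : 'I_n.-1) (ks : seq 'I_n.-1) (u v : 'S_n) (I J : {set 'I_n}).

Notation point := ('I_n * bool)%type.

Definition matching0 : {ffun point -> point} := [ffun p => (p.1, ~~ p.2)].

Lemma matching0P : matching matching0.
Proof.
by apply/matchingP => -[i b]; rewrite !ffunE /= negbK; split=> // -[]; case: b.
Qed.

Definition tl_matching ks := foldl (@step n) matching0 ks.

Lemma tl_matchingP ks : matching (tl_matching ks).
Proof. exact: foldl_step_matching matching0P. Qed.

Lemma tl_matching_rcons ks k : tl_matching (rcons ks k) = step (tl_matching ks) k.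
Proof. exact: foldl_rcons. Qed.

(* [I] and [J] are configurations of particles at the two ends of a word. *)
Definition lab I J (p : point) : bool := if p.2 then p.1 \in J else p.1 \notin I.

Definition sumo J : nat := \sum_(j in J) j.

Lemma sumo_step k J :
  (sumo (adj_transp k @: J) + (ordr k \in J) = sumo J + (ordl k \in J))%N.
Proof.
have E (x : 'I_n) : ((x \in J) = \sum_(j in J) (j == x) :> nat)%N.
  case: (boolP (x \in J)) => xJ.
    by rewrite (bigD1 x) //= eqxx big1 // => j /andP[_ /negPf->].
  by rewrite big1 // => j jJ; case: eqP => // e; rewrite -e jJ in xJ.
rewrite /sumo big_imset /=; last by move=> i j _ _; apply: perm_inj.
rewrite !E -!big_split /=; apply: eq_bigr => j _.
rewrite adj_transp_val /swapn -!val_eqE /=.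
by do !case: eqP => /= ?; lia.
Qed.

Lemma imset_adj k J (i : 'I_n) : (i \in adj_transp k @: J) = (adj_transp k i \in J).
Proof. by rewrite -[in LHS](adj_transpK k i) mem_imset //; apply: perm_inj. Qed.

Lemma imset_adjK k J : adj_transp k @: (adj_transp k @: J) = J.
Proof. by apply/setP => i; rewrite !imset_adj adj_transpK. Qed.

Lemma lab_step k I J (p : point) :
  lab I J (tperm (ordl k, true) (ordr k, true) p) = lab I (adj_transp k @: J) p.
Proof.
rewrite /lab; case: p => i b; rewrite /= imset_adj adj_transpE.
case: tpermP => [[-> ->]|[-> ->]|] /=; rewrite ?tpermL ?tpermR //.
case: b => //= /eqP + /eqP; rewrite !xpair_eqE !andbT => h1 h2.
by rewrite tpermD // eq_sym.
Qed.

Lemma perm_rcons ks k (i : 'I_n) :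
  perm_of_word (rcons ks k) i = adj_transp k (perm_of_word ks i).
Proof. by rewrite /perm_of_word -cats1 big_cat big_seq1 permM. Qed.

Lemma imset_rcons ks k I :
  perm_of_word (rcons ks k) @: I = adj_transp k @: (perm_of_word ks @: I).
Proof. by rewrite -imset_comp; apply: eq_imset => i; rewrite perm_rcons. Qed.

Lemma sumo_word ks I : (sumo (perm_of_word ks @: I) <= sumo I + size ks)%N.
Proof.
elim/last_ind: ks => [|ks k IH].
  rewrite /perm_of_word big_nil addn0 (_ : _ @: I = I) //.
  by rewrite -[RHS]imset_id; apply: eq_imset => i; rewrite perm1.
have := sumo_step k (perm_of_word ks @: I); rewrite imset_rcons size_rcons; lia.
Qed.

(** Each letter leaves the configuration alone or exchanges its two places, raising the sum of
    positions by at most 1. Equality forces every letter to act as its transposition. *)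
Lemma walk_le ks I J : consistent (tl_matching ks) (lab I J) ->
  (sumo J <= sumo I + size ks)%N /\
  (sumo J = (sumo I + size ks)%N -> J = perm_of_word ks @: I).
Proof.
elim/last_ind: ks J => [|ks k IH] J.
  move=> h; have -> : J = I.
    by apply/setP => i; have := h (i, true); rewrite ffunE /lab /= => /negb_inj.
  rewrite addn0; split=> // _; rewrite /perm_of_word big_nil.
  by rewrite -[LHS]imset_id; apply: eq_imset => i; rewrite perm1.
rewrite tl_matching_rcons size_rcons => /(cup_consistent (points_neq (k := k)) (tl_matchingP ks)).
case=> _ [/IH[h1 h2]|h]; first by split; lia.
have /IH[h1 h2] : consistent (tl_matching ks) (lab I (adj_transp k @: J)).
  by move=> p; rewrite -!lab_step.
have E := sumo_step k (adj_transp k @: J); rewrite imset_adjK in E.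
split; first by lia.
by move=> e; rewrite imset_rcons -h2 ?imset_adjK //; lia.
Qed.

(** When the bound is reached, each letter really moves a particle, so its two places carry
    different labels and the new arc is consistent. *)
Lemma walk_ge ks I : sumo (perm_of_word ks @: I) = (sumo I + size ks)%N ->
  consistent (tl_matching ks) (lab I (perm_of_word ks @: I)).
Proof.
elim/last_ind: ks => [|ks k IH].
  move=> _; rewrite (_ : _ @: I = I) => [[i b]|]; first by rewrite ffunE /lab /=; case: b;
    rewrite ?negbK.
  rewrite -[RHS]imset_id; apply: eq_imset => i.
  by rewrite /perm_of_word big_nil perm1.
have E := sumo_step k (perm_of_word ks @: I); have b := sumo_word ks I.
rewrite imset_rcons size_rcons tl_matching_rcons => h.
apply: (consistent_cup (points_neq (k := k)) (tl_matchingP ks)).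
  rewrite /lab /= !imset_adj !adj_transpE tpermL tpermR; move: h E b.
  by case: (_ \in _); case: (_ \in _) => //; lia.
move=> p; rewrite !lab_step imset_adjK; apply: IH.
by move: h E b; case: (_ \in _); case: (_ \in _) => //; lia.
Qed.
End Walks.

(** * Inversions and 321-avoiding permutations *)

Section Inversions.
Variable n : nat.
Implicit Types (k : 'I_n.-1) (ks : seq 'I_n.-1) (u v : 'S_n) (i j a b c : 'I_n) (I : {set 'I_n}).

Definition inversions u : {set 'I_n * 'I_n} := [set p : 'I_n * 'I_n | (p.1 < p.2)%N && (u p.2 < u p.1)%N].

Lemma card_inversions_step k u : (u (ordl k) < u (ordr k))%N ->
  #|inversions (adj_transp k * u)%g| = #|inversions u|.+1.
Proof.
move=> lt; pose f (p : 'I_n * 'I_n) := (adj_transp k p.1, adj_transp k p.2).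
have fK : involutive f by case=> i j; rewrite /f /= !adj_transpK.
have -> : inversions (adj_transp k * u)%g = f @: ((ordr k, ordl k) |: inversions u).
  apply/setP => p; rewrite -[in RHS](fK p) mem_imset; last exact: inv_inj.
  rewrite -{1}[p]fK; case: (f p) => a b; rewrite !inE /= !permM !adj_transpK xpair_eqE.
  case: (ltnP (u b) (u a)) => ab; rewrite ?andbT ?andbF ?orbF; last first.
    by apply/esym/negbTE/negP => /andP[/eqP ? /eqP ?]; subst; lia.
  rewrite !adj_transp_val /swapn -!val_eqE /=.
  have ne : ~~ (((a : nat) == k) && ((b : nat) == k.+1)).
    apply/negP => /andP[/eqP ea /eqP eb].
    have ? : a = ordl k by apply: val_inj.
    have ? : b = ordr k by apply: val_inj.
    by subst; lia.
  by move: ne; do !case: eqP => /= ?; lia.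
rewrite card_imset; last exact: inv_inj.
by rewrite cardsU1 inE /= ltnNge leqnSn.
Qed.

Lemma card_inversions_desc k u : (u (ordr k) < u (ordl k))%N ->
  #|inversions u| = #|inversions (adj_transp k * u)%g|.+1.
Proof.
move=> lt; rewrite -(@card_inversions_step k); last by rewrite !permM adj_transpE tpermL tpermR.
by rewrite mulgA tperm2 mul1g.
Qed.

Lemma perm_of_word_cons k ks : perm_of_word (k :: ks) = (adj_transp k * perm_of_word ks)%g.
Proof. exact: big_cons. Qed.

Lemma card_inversions_le ks : (#|inversions (perm_of_word ks)| <= size ks)%N.
Proof.
elim: ks => [|k ks IH].
  rewrite /perm_of_word big_nil; apply: eq_leq; apply: eq_card0 => p.
  by rewrite !inE !perm1; case: ltngtP.
rewrite perm_of_word_cons; move: (perm_of_word ks) IH => u IH /=.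
have [lt|lt|/val_inj/perm_inj/eqP] := ltngtP (u (ordl k)) (u (ordr k)).
- by rewrite card_inversions_step.
- by rewrite (card_inversions_desc lt) in IH; apply/leqW/ltnW.
- by rewrite (negPf (ordlr k)).
Qed.

(** Such a [u] satisfies [i <= u i] for all [i], and both sides have the same sum. *)
Lemma no_descent u : (forall k, u (ordl k) < u (ordr k))%N -> u = 1%g.
Proof.
move=> h; have ge : forall i, (i <= u i)%N.
  case=> m; elim: m => // m IH ltm /=.
  have ltk : (m < n.-1)%N by lia.
  have := h (Ordinal ltk); have := IH (ltnW ltm).
  rewrite (_ : ordl _ = Ordinal (ltnW ltm)); last exact: val_inj.
  rewrite (_ : ordr _ = Ordinal ltm); last exact: val_inj.
  by move=> /=; lia.
have := @leqif_sum _ predT (fun i => i == u i :> nat) val (fun i => val (u i)) (fun i _ =>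
  leqif_eq (ge i)).
have E : (\sum_(i < n) val i = \sum_(i < n) val (u i))%N by apply: reindex_inj; apply: perm_inj.
case=> _; rewrite E eqxx => /esym/forallP e.
by apply/permP => i; rewrite perm1; apply/val_inj/esym/eqP/e.
Qed.

Lemma ex_word u : exists2 ks, perm_of_word ks = u & size ks = #|inversions u|.
Proof.
have [m] := ubnP #|inversions u|; elim: m u => // m IH u ltm.
have [/existsP[k lt]|/existsPn h] := boolP [exists k, u (ordr k) < u (ordl k)]%N.
  have E := card_inversions_desc lt.
  have [|ks e sz] := IH (adj_transp k * u)%g; first by lia.
  exists (k :: ks); last by rewrite /= sz.
  by rewrite perm_of_word_cons e mulgA tperm2 mul1g.
have u1 : u = 1%g.
  apply: no_descent => k; rewrite ltn_neqAle leqNgt h andbT.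
  by apply/eqP => /val_inj/perm_inj/eqP; rewrite (negPf (ordlr k)).
exists [::]; first by rewrite u1 /perm_of_word big_nil.
rewrite u1; apply/esym/eq_card0 => p; by rewrite !inE !perm1; case: ltngtP.
Qed.

Lemma reduced_wordP ks u :
  reduced_word ks u <-> perm_of_word ks = u /\ size ks = #|inversions u|.
Proof.
split=> [[e h]|[e sz]]; split=> //.
  have [ks' e' sz'] := ex_word u.
  by have := h ks' e'; have := card_inversions_le ks; rewrite e; lia.
by move=> ks' e'; have := card_inversions_le ks'; rewrite e'; lia.
Qed.

Lemma reduced_cons k ks u : (u (ordr k) < u (ordl k))%N ->
  reduced_word ks (adj_transp k * u)%g -> reduced_word (k :: ks) u.
Proof.
move=> lt /reduced_wordP[e sz]; apply/reduced_wordP.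
split; last by rewrite /= sz (card_inversions_desc lt).
by rewrite perm_of_word_cons e mulgA tperm2 mul1g.
Qed.

Lemma ord_pair a b : b = a.+1 :> nat -> exists k, a = ordl k /\ b = ordr k.
Proof.
move=> e; have lt : (a < n.-1)%N by have := ltn_ord b; lia.
by exists (Ordinal lt); split; apply: val_inj.
Qed.

(** Induction on [c - a]. While the positions are not adjacent, either the pattern shrinks inside
    [u], or a descent at [a] or [c] is stripped off and becomes the first letter. For adjacent
    positions the word begins with [k, k', k]. *)
Lemma pattern_infix u a b c : (a < b < c)%N -> (u c < u b < u a)%N ->
  exists ks (i j : 'I_n.-1), [/\ reduced_word ks u, gen_dist i j = 1%N & infix [:: i; j; i] ks].
Proof.
have [m] := ubnP (c - a); elim: m => // m IH in u a b c *.
rewrite ltnS => lem /andP[ab bc] /andP[ucb uba].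
have rec k a' b' c' : (u (ordr k) < u (ordl k))%N -> (c' - a' < m)%N -> (a' < b' < c')%N ->
    let u' := (adj_transp k * u)%g in (u' c' < u' b' < u' a')%N ->
    exists ks (i j : 'I_n.-1), [/\ reduced_word ks u, gen_dist i j = 1%N & infix [:: i; j; i] ks].
  move=> ltk ltm abc u' hu; have [ks [i [j [r d f]]]] := IH u' _ _ _ ltm abc hu.
  exists (k :: ks), i, j; split=> //; first exact: reduced_cons.
  by rewrite infix_consl f orbT.
have [cb|cb] := ltnP b.+1 c.
  have ltd : (c.-1 < n)%N by have := ltn_ord c; lia.
  pose d := Ordinal ltd.
  have [lt|ge] := ltnP (u d) (u b).
    by apply: (IH u a b d); rewrite /= ?lt ?ab ?uba //; lia.
  have [k [ed ec]] := @ord_pair d c ltac:(by rewrite /=; lia).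
  apply: (rec k a b d); rewrite -?ed -?ec /=; try lia.
  rewrite !permM adj_transpE -ed -ec tpermL !tpermD ?ucb ?uba //;
    by rewrite -val_eqE /=; lia.
have [ba|ba] := ltnP a.+1 b.
  have ltd : (a.+1 < n)%N by have := ltn_ord c; lia.
  pose d := Ordinal ltd.
  have [lt|ge] := ltnP (u b) (u d).
    by apply: (IH u d b c); rewrite /= ?lt ?bc ?ucb //; lia.
  have [k [ea ed]] := @ord_pair a d erefl.
  have ne : (u d < u b)%N.
    rewrite ltn_neqAle ge andbT; apply/eqP => /val_inj/perm_inj/(congr1 val) /=; lia.
  apply: (rec k d b c); rewrite -?ed -?ea /=; try lia.
  rewrite !permM adj_transpE -ed -ea tpermR !tpermD ?ucb ?uba //;
    by rewrite -val_eqE /=; lia.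
have [k [ea eb]] := @ord_pair a b ltac:(by lia).
have [k' [eb' ec]] := @ord_pair b c ltac:(by lia).
pose u1 := (adj_transp k * u)%g; pose u2 := (adj_transp k' * u1)%g.
have ac : a != c by rewrite -val_eqE /=; lia.
have ab' : a != b by rewrite -val_eqE /=; lia.
have bc' : b != c by rewrite -val_eqE /=; lia.
have [ks e sz] := ex_word (adj_transp k * u2)%g.
exists [:: k, k', k & ks], k, k'; split.
- apply: reduced_cons; first by rewrite -ea -eb.
  apply: reduced_cons.
    rewrite -eb' -ec !permM adj_transpE -ea -eb tpermR tpermD //.
    exact: ltn_trans uba.
  apply: reduced_cons; last exact/reduced_wordP.
  rewrite -ea -eb !permM !adj_transpE -ea -eb -eb' -ec tpermL.
  rewrite [tperm b c a]tpermD 1?eq_sym // tpermL [tperm a b c]tpermD //.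
- have := congr1 val ea; have := congr1 val eb; have := congr1 val eb'.
  by rewrite /gen_dist /=; lia.
- exact: (prefix_infix [:: k; k'; k] ks).
Qed.

Definition pattern321 u : Prop := exists a b c, (a < b < c)%N && (u c < u b < u a)%N.

Lemma avoids321_pattern u : avoids321 u -> ~ pattern321 u.
Proof.
move=> h [a [b [c /andP[abc uabc]]]].
by have [ks [i [j [r d f]]]] := pattern_infix abc uabc; move: (h ks i j r d); rewrite f.
Qed.

Lemma card_lt_ord (m : nat) : (m <= n)%N -> #|[set i : 'I_n | (i < m)%N]| = m.
Proof.
move=> le; have inj : injective (widen_ord le) by move=> i j /(congr1 val) /= /val_inj.
rewrite -[RHS]card_ord -(card_imset _ inj).
apply: eq_card => i; rewrite inE; apply/idP/imsetP => [lt|[j _ ->]]; last by rewrite /= ltn_ord.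
by exists (Ordinal lt) => //; apply: val_inj.
Qed.

Lemma card_lt_perm u (m : nat) : (m <= n)%N -> #|[set i : 'I_n | (u i < m)%N]| = m.
Proof.
move=> le; rewrite -[RHS](card_lt_ord le) -(card_imset (pred_of_set [set i | (u i < m)%N]) (@perm_inj _ u)).
apply: eq_card => i; rewrite inE; apply/imsetP/idP => [[j + ->]|lt]; first by rewrite inE.
by exists (u^-1 i)%g; rewrite ?inE permKV.
Qed.

(** Otherwise [u i < u j], and avoidance puts all values below [u i] before position [i]; counting
    them gives [u i <= i]. *)
Lemma exceedance_max u i j : ~ pattern321 u -> (i < u i)%N -> (j < i)%N -> (u j < u i)%N.
Proof.
move=> h exc ji; rewrite ltnNge; apply/negP; rewrite leq_eqVlt.
case/predU1P => [/val_inj/perm_inj e|lt]; first by rewrite e ltnn in ji.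
have : ([set p | (u p < u i)%N] \subset [set p : 'I_n | (p < i)%N]).
  apply/fintype.subsetP => k; rewrite !inE => uk; case: ltngtP => // [ik|/val_inj e].
    by case: h; exists j, i, k; rewrite ji ik uk lt.
  by rewrite e ltnn in uk.
move/subset_leq_card; rewrite card_lt_perm ?card_lt_ord; try exact: ltnW.
by rewrite leqNgt exc.
Qed.

Lemma nonexceedance_min u i (l : 'I_n) : ~ pattern321 u -> (u i <= i)%N -> (i < l)%N -> (u i < u l)%N.
Proof.
move=> h exc il; rewrite ltnNge; apply/negP; rewrite leq_eqVlt.
case/predU1P => [/val_inj/perm_inj e|lt]; first by rewrite e ltnn in il.
have : (l |: [set p : 'I_n | (p < i)%N]) \subset [set p | (u p < u i)%N].
  apply/fintype.subsetP => j; rewrite !inE => /predU1P[-> //|ji].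
  case: ltngtP => // [uj|/val_inj/perm_inj e].
    by case: h; exists j, i, l; rewrite ji il uj lt.
  by rewrite e ltnn in ji.
move/subset_leq_card; rewrite cardsU1 inE card_lt_perm ?card_lt_ord; try exact: ltnW.
by rewrite -leqNgt (ltnW il) /=; lia.
Qed.

Lemma card_inversions_sum u : #|inversions u| = (\sum_(i < n) #|[set j : 'I_n | (i < j)%N && (u j < u i)%N]|)%N.
Proof.
rewrite -sum1_card (eq_bigl (fun p : 'I_n * 'I_n =>
  true && ((p.1 < p.2)%N && (u p.2 < u p.1)%N))); last first.
  by move=> p; rewrite inE.
rewrite -(pair_big_dep xpredT (fun i j : 'I_n => (i < j)%N && (u j < u i)%N) (fun _ _ => 1%N)) /=.
by apply: eq_bigr => i _; rewrite sum1_card; apply: eq_card => j; rewrite inE.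
Qed.

(** Only exceedances begin inversions. An exceedance [i] exceeds all earlier values, so it begins
    one inversion for each value below [u i] not placed before [i]. *)
Lemma card_inversions_avoid u : ~ pattern321 u -> #|inversions u| = (\sum_(i < n) (u i - i))%N.
Proof.
move=> h; rewrite card_inversions_sum; apply: eq_bigr => i _.
have [le|lt] := leqP (u i) i.
  have -> : (u i - i = 0)%N by lia.
  apply: eq_card0 => j; rewrite !inE; apply/andP => -[ij uj].
  by have := nonexceedance_min h le ij; lia.
rewrite -[in RHS](@card_lt_perm u (u i)) 1?ltnW // -[X in (_ - X)%N](@card_lt_ord i) 1?ltnW //.
rewrite -cardsDS; last first.
  by apply/fintype.subsetP => j; rewrite !inE; apply: exceedance_max.
apply: eq_card => j; rewrite !inE -leqNgt; case: (ltngtP i j) => //= /val_inj->.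
by rewrite ltnn.
Qed.

Definition exceedances u : {set 'I_n} := [set i : 'I_n | (i < u i)%N].

Lemma sumo_imset u I : sumo (u @: I) = (\sum_(i in I) u i)%N.
Proof. by rewrite /sumo big_imset //= => i j _ _; apply: perm_inj. Qed.

Lemma sumo_exceedances u :
  sumo (u @: exceedances u) = (sumo (exceedances u) + \sum_(i < n) (u i - i))%N.
Proof.
rewrite sumo_imset /sumo (bigID (fun i => i \in exceedances u) predT) /= [X in (_ + (_ + X))%N]big1.
  rewrite addn0 -big_split /=; apply: eq_bigr => i; rewrite inE; lia.
by move=> i; rewrite inE; lia.
Qed.

(** The gain over [I] is at most the sum of the truncated differences, and reaching it means
    collecting all the positive ones. *)
Lemma exceedances_sub u I :
  sumo (u @: I) = (sumo I + \sum_(i < n) (u i - i))%N -> exceedances u \subset I.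
Proof.
rewrite sumo_imset /sumo (bigID (fun i => i \in I) predT) /= => h.
have le : (\sum_(i in I) u i <= \sum_(i in I) i + \sum_(i in I) (u i - i))%N.
  by rewrite -big_split /=; apply: leq_sum => i _; lia.
move: le; rewrite h leq_add2l -[X in (_ <= X)%N]addn0 leq_add2l leqn0.
rewrite sum_nat_eq0 => /forallP z; apply/fintype.subsetP => i; rewrite inE => exc.
by apply: contraTT exc => iI; have := z i; rewrite iI /=; lia.
Qed.

(** An increasing bijection is determined by ranks: [w i] has the rank in the image that [i] has in
    [I]. *)
Lemma eq_on_of_monotone u v (I : {set 'I_n}) :
  {in I &, forall i j, (i < j)%N -> (u i < u j)%N} ->
  {in I &, forall i j, (i < j)%N -> (v i < v j)%N} ->
  u @: I = v @: I -> {in I, u =1 v}.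
Proof.
have card (w : 'S_n) i : i \in I -> {in I &, forall i j, (i < j)%N -> (w i < w j)%N} ->
    #|[set y in w @: I | (y < w i)%N]| = #|[set j in I | (j < i)%N]|.
  move=> iI h; rewrite -(card_imset (pred_of_set [set j in I | (j < i)%N]) (@perm_inj _ w)).
  apply: eq_card => y; rewrite !inE; apply/andP/imsetP => [[/imsetP[j jI ->] lt]|[j + ->]].
    exists j => //; rewrite inE jI /= ltnNge; apply/negP; rewrite leq_eqVlt.
    by case/predU1P => [/val_inj e|/(h i j iI jI)]; [rewrite e ltnn in lt|lia].
  by rewrite inE => /andP[jI lt]; rewrite imset_f // h.
move=> hu hv e i iI.
have aux (w w' : 'S_n) : w @: I = w' @: I ->
    {in I &, forall i j, (i < j)%N -> (w i < w j)%N} ->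
    {in I &, forall i j, (i < j)%N -> (w' i < w' j)%N} -> ~~ (w i < w' i)%N.
  move=> e' hw hw'; apply/negP => lt.
  have : [set y in w @: I | (y < w i)%N] \proper [set y in w' @: I | (y < w' i)%N].
    apply/properP; split.
      by apply/fintype.subsetP => y; rewrite !inE e' => /andP[-> /ltn_trans->].
    by exists (w i); rewrite !inE -?e' imset_f ?lt ?ltnn.
  by move/proper_card; rewrite !card // ltnn.
by apply: val_inj; have := aux _ _ e hu hv; have := aux _ _ (esym e) hv hu; case: ltngtP.
Qed.

(** By avoidance, both permutations increase on the exceedances and on their complement. *)
Lemma eq_of_exceedances u v : ~ pattern321 u -> ~ pattern321 v ->
  exceedances u = exceedances v -> u @: exceedances u = v @: exceedances v -> u = v.
Proof.
move=> hu hv eI eJ; apply/permP => i.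
have mono (w : 'S_n) : ~ pattern321 w -> {in exceedances w &, forall i j,
  (i < j)%N -> (w i < w j)%N}.
  by move=> hw j k; rewrite !inE => _ hk; apply: exceedance_max.
have monoC (w : 'S_n) : ~ pattern321 w -> {in ~: exceedances w &, forall i j,
  (i < j)%N -> (w i < w j)%N}.
  by move=> hw j k; rewrite !inE -!leqNgt => hj _; apply: nonexceedance_min.
have [iI|iI] := boolP (i \in exceedances u).
  apply: (@eq_on_of_monotone u v (exceedances u)) => //; first exact: mono.
    by rewrite eI; apply: mono.
  by rewrite eJ eI.
apply: (@eq_on_of_monotone u v (~: exceedances u)); last by rewrite inE.
- exact: monoC.
- by rewrite eI; apply: monoC.
have imC (w : 'S_n) (I : {set 'I_n}) : w @: (~: I) = ~: (w @: I).
  apply/setP => y; rewrite -[y](permKV w) inE !mem_imset ?inE //; exact: perm_inj.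
by rewrite !imC eJ eI.
Qed.

(** Along [ks] the exceedances of [u] reach the bound of [walk_le], and the equality of matchings
    makes the same pair of configurations consistent along [ks']. Comparing in both directions gives
    equal lengths, exceedances and images. *)
Lemma tl_matching_inj u v ks ks' : avoids321 u -> avoids321 v ->
  reduced_word ks u -> reduced_word ks' v -> tl_matching ks = tl_matching ks' -> u = v.
Proof.
move=> /avoids321_pattern hu /avoids321_pattern hv.
move=> /reduced_wordP[eu su] /reduced_wordP[ev sv] e.
have aux w w' ls ls' : ~ pattern321 w -> perm_of_word ls = w -> size ls = #|inversions w| ->
   ~ pattern321 w' -> perm_of_word ls' = w' -> size ls' = #|inversions w'| ->
   tl_matching ls = tl_matching ls' -> (size ls <= size ls')%N /\
   (size ls = size ls' -> exceedances w' \subset exceedances w /\ w @: exceedances w = w' @: exceedances w).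
  move=> hw ew sw hw' ew' sw' em.
  have E : sumo (perm_of_word ls @: exceedances w) = (sumo (exceedances w) + size ls)%N.
    by rewrite ew sw card_inversions_avoid // sumo_exceedances.
  have := walk_ge E; rewrite em => /walk_le[h1 h2]; split; first by lia.
  move=> es; have h := h2 (etrans E (congr1 (addn _) es)).
  rewrite ew ew' in h; rewrite ew in E; split=> //; apply: exceedances_sub.
  by rewrite -h E es sw' card_inversions_avoid.
have [le1 h1] := aux _ _ _ _ hu eu su hv ev sv e.
have [le2 h2] := aux _ _ _ _ hv ev sv hu eu su (esym e).
have es : size ks = size ks' by apply/anti_leq; rewrite le1.
have [s1 e1] := h1 es; have [s2 _] := h2 (esym es).
have eI : exceedances u = exceedances v by apply/eqP; rewrite finset.eqEsubset s2.
by apply: eq_of_exceedances => //; rewrite e1 eI.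
Qed.
End Inversions.

(** * Positivity of Temperley-Lieb coefficients *)

Section Coefficients.
Variables (C : numClosedFieldType) (n : nat).
Implicit Types (k : 'I_n.-1) (ks : seq 'I_n.-1) (u v w : 'S_n).

Lemma some_reduced_wordP u : reduced_word (some_reduced_word u) u.
Proof.
apply: (@xgetPex _ [::] [set ks | reduced_word ks u]%classic).
by have [ks e s] := ex_word u; exists ks; apply/reduced_wordP.
Qed.

Definition basis_matching u := tl_matching (some_reduced_word u).

Definition basis_loops u := loops (matching0 n) (some_reduced_word u).

(** Distinct basis elements send [matching0] to distinct matchings, so a coefficient can be read off
    up to a power of 2. *)
Lemma psi_basis u v : avoids321 u -> avoids321 v ->
  psi (TL_basis C v) (matching0 n) (basis_matching u) =
  if v == u then 2%:R ^+ basis_loops v else 0.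
Proof.
move=> hu hv; rewrite /TL_basis psi_gens matching0P /=.
case: eqP => [e|ne].
  suff -> : v = u by rewrite eqxx.
  exact: tl_matching_inj hv hu (some_reduced_wordP v) (some_reduced_wordP u) e.
by case: eqP => // e; case: ne; rewrite e.
Qed.

Lemma psi_coef u (c : 'S_n -> C) : avoids321 u ->
  \sum_(v | `[< avoids321 v >]) c v * psi (TL_basis C v) (matching0 n) (basis_matching u) =
  c u * 2%:R ^+ basis_loops u.
Proof.
move=> hu; rewrite (bigD1 u) ?psi_basis ?eqxx //=; last exact/asboolP.
rewrite big1 ?addr0 // => v /andP[/asboolP hv /negPf ne].
by rewrite psi_basis // ne mulr0.
Qed.

Variables (f : {ffun 'S_n -> {ffun 'S_n -> C}}) (th : 'S_n -> free_alg C n).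
Hypotheses (th_theta : is_theta th)
  (th_coefs : forall w, TL_eq (th w) (\sum_(u | `[< avoids321 u >]) f w u *: TL_basis C u)).

(** The outermost [tl_act k] replaces [w] by [w] and [s_k * w], which inserts [t_k] directly before
    [theta w]; hence the reversed word. *)
Lemma psi_tl_acts ks w M M' :
  \sum_(v | `[< avoids321 v >]) tl_acts ks (f^~ v) w * psi (TL_basis C v) M M' =
  psi ((\prod_(k <- rev ks) TL_gen C k) * th w) M M'.
Proof.
case: th_theta => _ thM th_gen.
elim: ks w => [|k ks IH] w.
  rewrite big_nil mul1r (psi_eq _ _ (th_coefs w)) psi_sum.
  by apply: eq_bigr => v _; rewrite psiZ.
rewrite /= /tl_act; under eq_bigr do rewrite mulrDl.
rewrite big_split /= !IH rev_cons -cats1 big_cat big_seq1 /=.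
set W := \prod_(i <- rev ks) _.
have key : psi (W * th (adj_transp k * w)%g) M M' = psi (W * ((TL_gen C k - 1) * th w)) M M'.
  rewrite [LHS]psiM [RHS]psiM; apply: eq_bigr => M1 _; apply: (congr1 ( *%R _)).
  rewrite (psi_eq _ _ (thM _ _)) [LHS]psiM [RHS]psiM; apply: eq_bigr => M2 _.
  by apply: (congr1 ( *%R^~ _)); exact: psi_eq.
apply: etrans (congr1 (+%R _) key) _.
rewrite -psiD -mulrA.
have -> : W * th w + W * ((TL_gen C k - 1) * th w) = W * (TL_gen C k * th w) by rewrite -mulrDr mulrBl mul1r addrC subrK.
reflexivity.
Qed.

Lemma tl_positive_coef u : avoids321 u -> tl_positive (f^~ u).
Proof.
case: th_theta => th1 thM th_gen hu.
have pos2 : 0 < (2%:R : C) ^+ basis_loops u by rewrite exprn_gt0 // ltr0n.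
have E ks w : tl_acts ks (f^~ u) w * 2%:R ^+ basis_loops u =
    psi ((\prod_(k <- rev ks) TL_gen C k) * th w) (matching0 n) (basis_matching u).
  by rewrite -psi_tl_acts (psi_coef (fun v => tl_acts ks (f^~ v) w)).
split=> [ks|ks i j ij w].
  rewrite -(pmulr_lge0 _ pos2) E psiM sumr_ge0 // => M1 _.
  (* At the identity only a word of generators remains, whose matrix coefficients are powers of 2 or
     0. *)
  rewrite (psi_eq _ _ th1) psi_gens psi1 mulr_ge0 ?ler0n //.
  by case: ifP => _ //; rewrite exprn_ge0 ?ler0n.
apply: (mulIf (lt0r_neq0 pos2)).
have := E [:: i, j, i & ks] w; rewrite /= => ->; have := E (i :: ks) w; rewrite /= => ->.
rewrite !rev_cons -!cats1 -!catA !big_cat /= !big_cons !big_nil.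
rewrite !mulr1 [LHS]psiM [RHS]psiM; apply: eq_bigr => M1 _; apply: (congr1 ( *%R^~ _)).
rewrite [LHS]psiM [RHS]psiM; apply: eq_bigr => M2 _; apply: (congr1 ( *%R _)).
apply: psi_eq; rewrite mulrA; apply: TL_ideal_adj.
by rewrite /gen_dist ij; lia.
Qed.
End Coefficients.

Lemma tl_positive_TL_coef (C : numClosedFieldType) (n : nat) (u : 'S_n) :
  avoids321 u -> tl_positive (TL_coef C u).
Proof.
move=> hu; rewrite /TL_coef.
have [ex|nex] := pselect (exists f, @is_TL_coefs C n f).
  set f := xget _ _; have [th h1 h2] : is_TL_coefs f by exact: xgetPex.
  have := tl_positive_coef h1 h2 hu; exact.
(* Otherwise [xget] returns its default, the zero function, which satisfies both conditions. *)
rewrite xgetPN => [|f hf]; last by case: nex; exists f.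
have E (ks : seq 'I_n.-1) (w : 'S_n) : tl_acts ks (fun w : 'S_n =>
  [ffun=> [ffun=> 0 : C]] w u) w = 0.
  elim: ks w => [|k ks IH] w; first by rewrite /= !ffunE.
  by rewrite /= /tl_act !IH addr0.
split=> [ks|ks i j _ w]; first by rewrite E.
by have := E [:: i, j, i & ks] w; rewrite /= => ->; have := E (i :: ks) w; rewrite /= => ->.
Qed.

(** * Expansion in alternants *)

Section Alternants.
Variables (C : numClosedFieldType) (N : nat).
Implicit Types (F G : {mpoly C[N]}) (kap : nat -> nat) (s : 'S_N).

(** The value 0 beyond the range is also what makes [restrict] set the extra variables to 0. *)
Definition var (h : nat) : {mpoly C[N]} := if insub h is Some i then 'X_i else 0.

Lemma varE (i : 'I_N) : var i = 'X_i.
Proof. by rewrite /var valK. Qed.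

Lemma msym_var s (i : 'I_N) : msym s (var i) = var (s i).
Proof.
rewrite !varE msymX; congr mpolyX; apply/mnmP => j; rewrite mnmE !mnm1E.
by rewrite -(inj_eq (@perm_inj _ s)) permKV.
Qed.

Definition antisymmetrize F : {mpoly C[N]} := \sum_(s : 'S_N) (-1) ^+ s *: msym s F.

Fact antisymmetrize_is_additive : additive antisymmetrize.
Proof.
move=> F G; rewrite /antisymmetrize -sumrB; apply: eq_bigr => s _.
by rewrite raddfB scalerBr.
Qed.

HB.instance Definition _ := GRing.isAdditive.Build {mpoly C[N]} {mpoly C[N]}
  antisymmetrize antisymmetrize_is_additive.

Lemma antisymmetrize_msym s F : antisymmetrize (msym s F) = (-1) ^+ s *: antisymmetrize F.
Proof.
rewrite /antisymmetrize [in RHS](reindex_inj (mulgI s)) scaler_sumr /=.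
apply: eq_bigr => s' _; rewrite msymMm scalerA odd_permM signr_addb mulrA.
by rewrite -expr2 sqrr_sign mul1r.
Qed.

Lemma antisymmetrize_mul F G : (forall s, msym s G = G) ->
  antisymmetrize (F * G) = antisymmetrize F * G.
Proof.
move=> hG; rewrite /antisymmetrize mulr_suml; apply: eq_bigr => s _.
by rewrite msymM hG scalerAl.
Qed.

Lemma antisymmetrize_mon kap : antisymmetrize (mon N var kap) = alternant var N kap.
Proof.
rewrite /antisymmetrize /alternant /determinant; apply: eq_bigr => s _.
rewrite scaler_sign mulr_sign /mon rmorph_prod /=.
rewrite (eq_bigr (fun j => (\matrix_(j < N, i < N) var i ^+ kap j) j (s j))) //.
by move=> i _; rewrite rmorphXn /= msym_var mxE.
Qed.

Definition simple_transp (i : nat) : 'S_N :=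
  if insub i is Some k then adj_transp k else 1%g.

Lemma simple_transpE i : (i.+1 < N)%N -> exists2 k : 'I_N.-1,
  k = i :> nat & simple_transp i = adj_transp k.
Proof.
move=> iN; have lt : (i < N.-1)%N by lia.
by exists (Ordinal lt) => //; rewrite /simple_transp insubT.
Qed.

Lemma msym_simple_var i h : (i.+1 < N)%N -> msym (simple_transp i) (var h) = var (swapn i h).
Proof.
move=> iN; have [k ek ->] := simple_transpE iN.
have [hN|hN] := ltnP h N.
  by rewrite -[h]/(nat_of_ord (Ordinal hN)) msym_var adj_transp_val ek.
have -> : swapn i h = h by rewrite /swapn; do !case: eqP => ?; lia.
by rewrite /var insubF ?raddf0 //; lia.
Qed.

Lemma antisymmetrize_simple i F : (i.+1 < N)%N ->
  antisymmetrize (msym (simple_transp i) F) = - antisymmetrize F.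
Proof.
move=> iN; have [k _ ->] := simple_transpE iN; rewrite antisymmetrize_msym.
by rewrite adj_transpE odd_tperm ordlr expr1 scaleN1r.
Qed.

Lemma symmetric_of_simple F : (forall i, (i.+1 < N)%N -> msym (simple_transp i) F = F) ->
  forall s, msym s F = F.
Proof.
move=> h s; have [ks <- _] := ex_word s; elim: ks => [|k ks IH].
  by rewrite /perm_of_word big_nil msym1m.
rewrite perm_of_word_cons msymMm -[RHS]IH; congr (msym _ _).
have lt : (k.+1 < N)%N by have := ltn_ord k; lia.
by have [k' /val_inj-> e] := simple_transpE lt; rewrite -e h.
Qed.

Definition strict kap := forall i j, (i < j)%N -> (j < N)%N -> (kap j < kap i)%N.

Lemma strictP kap : (forall h, (h.+1 < N)%N -> (kap h.+1 < kap h)%N) -> strict kap.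
Proof.
move=> h i j ij; rewrite -(subnK ij); elim: (j - i.+1)%N => [|d IH] lt; first exact: h.
by rewrite addSn in lt *; apply: ltn_trans (h _ lt) (IH (ltnW lt)).
Qed.

Definition monom kap : 'X_{1..N} := [multinom kap i | i < N].

(** Among the rearrangements of a strict exponent vector only the vector itself is strict, because a
    permutation without descents is the identity. *)
Lemma mcoeff_alternant kap kap' : strict kap -> strict kap' ->
  (alternant var N kap)@_(monom kap') = (monom kap == monom kap')%:R.
Proof.
move=> hk hk'; rewrite -antisymmetrize_mon.
have -> : mon N var kap = 'X_[monom kap].
  by rewrite mpolyXE_id; apply: eq_bigr => i _; rewrite varE mnmE.
rewrite /antisymmetrize raddf_sum (bigD1 1%g) //= odd_perm1 expr0 scale1r msym1m mcoeffX.
rewrite big1 ?addr0 // => s s1; rewrite msymX linearZ /= mcoeffX.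
case: eqP => [/mnmP e|_]; last by rewrite mulr0.
case/eqP: s1; apply: no_descent => k; rewrite ltnNge leq_eqVlt; apply/negP.
case/predU1P => [/val_inj/perm_inj/esym/eqP|lt]; first by rewrite (negPf (ordlr k)).
have E (j : 'I_N) : kap j = kap' (s j) by have := e (s j); rewrite !mnmE permK.
have := hk' _ _ lt (ltn_ord _); rewrite -!E.
by have := hk k k.+1 (leqnn _) (ltn_ord (ordr k)) => /= h1 h2; have := ltn_trans h1 h2;
  rewrite ltnn.
Qed.

Inductive alternant_positive : {mpoly C[N]} -> Prop :=
| alternant_positive0 : alternant_positive 0
| alternant_positive_add c kap F : 0 <= c -> strict kap -> alternant_positive F ->
    alternant_positive (c *: alternant var N kap + F).

Lemma alternant_positiveD F G :
  alternant_positive F -> alternant_positive G -> alternant_positive (F + G).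
Proof.
move=> hF hG; elim: hF => [|c kap F' c0 hk _ IH]; first by rewrite add0r.
by rewrite -addrA; constructor.
Qed.

Lemma alternant_positive_coef F kap : alternant_positive F -> strict kap -> 0 <= F@_(monom kap).
Proof.
move=> hF hk; elim: hF => [|c kap' F' c0 hk' _ IH]; first by rewrite mcoeff0.
by rewrite mcoeffD mcoeffZ mcoeff_alternant // addr_ge0 // mulr_ge0 // ler0n.
Qed.

(** Nonnegative terms cannot cancel: a coefficient that vanishes in the sum vanishes in each term,
    which carries the last hypothesis through the induction. *)
Lemma alternant_positive_sum (T : finType) (p : pred T) (kaps : T -> nat -> nat) F :
  alternant_positive F -> (forall f, p f -> strict (kaps f)) ->
  {in p &, forall f f', monom (kaps f) = monom (kaps f') -> f = f'} ->
  (forall kap, strict kap -> (forall f, p f -> monom (kaps f) <> monom kap) -> F@_(monom kap) = 0) ->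
  F = \sum_(f | p f) F@_(monom (kaps f)) *: alternant var N (kaps f).
Proof.
move=> hF hp inj; elim: hF => [|c kap F' c0 hk hF' IH] hz.
  by rewrite big1 // => f _; rewrite mcoeff0 scale0r.
have zero kap' : strict kap' -> (forall f, p f -> monom (kaps f) <> monom kap') ->
    c * (monom kap == monom kap')%:R = 0 /\ F'@_(monom kap') = 0.
  move=> hk' hn; have := hz kap' hk' hn.
  rewrite mcoeffD mcoeffZ mcoeff_alternant // => /eqP.
  by rewrite paddr_eq0 ?mulr_ge0 ?ler0n ?alternant_positive_coef // => /andP[/eqP-> /eqP->].
rewrite {1}IH => [|kap' hk' hn]; last by have [] := zero kap' hk' hn.
under [in RHS]eq_bigr do rewrite mcoeffD scalerDl.
rewrite big_split /=; congr (_ + _).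
have [/existsP[f /andP[pf /eqP e]]|/existsPn hn] :=
  boolP [exists f, p f && (monom (kaps f) == monom kap)].
  rewrite (bigD1 f) //= mcoeffZ mcoeff_alternant //; last exact: hp.
  rewrite e eqxx mulr1 big1 ?addr0 => [|f' /andP[pf' ne]].
    congr (_ *: \det _); apply/matrixP => j i; rewrite !mxE; congr (_ ^+ _).
    by have /mnmP/(_ j) := e; rewrite !mnmE.
  rewrite mcoeffZ mcoeff_alternant //; last exact: hp.
  case: eqP => [e'|_]; last by rewrite mulr0 scale0r.
  by case/eqP: ne; apply: inj => //; rewrite -e' e.
have hn' f : p f -> monom (kaps f) <> monom kap.
  by move=> pf e; have := hn f; rewrite pf e eqxx.
have [+ _] := zero kap hk hn'; rewrite eqxx mulr1 => ->.
by rewrite scale0r big1 // => f _; rewrite mcoeff0 scale0r.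
Qed.

End Alternants.

(** * Expansion in Schur functions *)

Section Truncations.
Variable C : numClosedFieldType.

Definition restrict (N0 N : nat) (p : {mpoly C[N0]}) : {mpoly C[N]} :=
  p \mPo [tuple var C N i | i < N0].

Lemma restrict_var N0 N (i : 'I_N0) : restrict N 'X_i = var C N i.
Proof. by rewrite /restrict comp_mpolyXU -tnth_nth tnth_mktuple. Qed.

Lemma restrict_skew_schur N0 N D : (N <= N0)%N ->
  restrict N (skew_schur C D N0) = skew_schur C D N.
Proof.
move=> le; rewrite /skew_schur /restrict raddf_sum /=.
under eq_bigr => T _.
  rewrite rmorph_prod /=; under eq_bigr do rewrite -/(restrict N _) restrict_var.
over.
pose widen (T : {ffun D -> 'I_N}) : {ffun D -> 'I_N0} := [ffun c => widen_ord le (T c)].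
have widen_inj : injective widen.
  move=> T T' /ffunP e; apply/ffunP => c; apply: val_inj.
  by have := congr1 val (e c); rewrite !ffunE.
have widen_ssyt T : ssyt (widen T) = ssyt T.
  by apply: eq_forallb => c; apply: eq_forallb => c'; rewrite !ffunE.
(* A tableau with an entry at least [N] contains a variable that is set to 0. *)
rewrite (bigID (fun T => T \in widen @: finset.setT)) /= [X in _ + X]big1 ?addr0; last first.
  move=> T /andP[_ /imsetP nT].
  have [/forallP lt|/forallPn[c]] := boolP [forall c, (T c < N)%N].
    by case: nT; exists [ffun c => Ordinal (lt c)]; first (by rewrite finset.in_setT);
      apply/ffunP => c; rewrite !ffunE; apply: val_inj.
  rewrite -leqNgt => ge; rewrite (bigD1 c) //= /var insubF ?mul0r //.
  by apply/negbTE; rewrite -leqNgt.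
rewrite (eq_bigl (fun T => (T \in widen @: [set T' | ssyt T']))); last first.
  move=> T; apply/andP/imsetP => [[hT /imsetP[T' _ e]]|[T' + ->]].
    by exists T' => //; rewrite inE -widen_ssyt -e.
  by rewrite inE -widen_ssyt => hT; split=> //; apply: imset_f.
rewrite big_imset /=; last by move=> T T' _ _; apply: widen_inj.
apply: eq_big => [T|T _]; first by rewrite inE.
by apply: eq_bigr => c _; rewrite ffunE -varE.
Qed.

Lemma skew_schur_tab_sum N nu : skew_schur C (rows_diagram N nu) N = tab_sum (var C N) N nu.
Proof. by apply: eq_bigr => T _; apply: eq_bigr => c _; rewrite varE. Qed.

Section Expansion.
Variable K : nat.
Implicit Type f : {ffun 'I_K -> 'I_K.+1}.

(** These are the partitions in a [K] by [K] box, among them all partitions of size at most [K]: a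
    finite type to sum over. *)
Definition decreasing f : bool := [forall i : 'I_K, forall j : 'I_K, (i <= j)%N ==> (f j <= f i)%N].

Lemma extend_out f i : (K <= i)%N -> extend f i = 0%N.
Proof. by move=> h; rewrite /extend insubF // ltnNge h. Qed.

Lemma decreasingP f i j : decreasing f -> (i <= j)%N -> (extend f j <= extend f i)%N.
Proof.
move=> hf ij; have [jK|Kj] := ltnP j K; last by rewrite extend_out.
have iK := leq_ltn_trans ij jK.
rewrite (extendE f (Ordinal jK)) (extendE f (Ordinal iK)).
by have /forallP/(_ (Ordinal iK))/forallP/(_ (Ordinal jK))/implyP := hf; apply.
Qed.

Definition shape f : seq nat := [seq y <- [seq extend f i | i <- iota 0 K] | (0 < y)%N].

Lemma nth_filter_pos (s : seq nat) i : sorted geq s ->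
  nth 0%N [seq y <- s | (0 < y)%N] i = nth 0%N s i.
Proof.
elim: s i => //= y s IH i hs.
have hs' : sorted geq s by apply: path_sorted hs.
case: (posnP y) => [y0|y_gt0]; last by case: i => //= i; apply: IH.
have all0 : forall z, z \in s -> z = 0%N.
  move=> z zs; have geq_trans : transitive geq by move=> a b c h1 h2; apply: leq_trans h2 h1.
  by have := order_path_min geq_trans hs => /allP/(_ z zs); rewrite y0 /= leqn0 => /eqP.
have -> : [seq y <- s | (0 < y)%N] = [::].
  by apply/eqP; rewrite -[_ == _]negbK -has_filter -all_predC; apply/allP => z /all0->.
rewrite nth_nil y0; case: i => //= i; have [h|h] := ltnP i (size s); last by rewrite nth_default.
by apply/esym/all0/mem_nth.
Qed.

Lemma shape_sorted f : decreasing f -> sorted geq [seq extend f i | i <- iota 0 K].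
Proof.
move=> hf; rewrite sorted_map; apply: sub_sorted (iota_sorted 0 K) => i j ij.
exact: decreasingP.
Qed.

Lemma nth_shape f i : decreasing f -> nth 0%N (shape f) i = extend f i.
Proof.
move=> hf; rewrite /shape nth_filter_pos ?shape_sorted //.
have [iK|Ki] := ltnP i K; last by rewrite nth_default ?size_map ?size_iota // extend_out.
by rewrite (nth_map 0%N) ?size_iota // nth_iota.
Qed.

Lemma shape_partition f : decreasing f -> is_partition (shape f).
Proof.
move=> hf; rewrite /is_partition mem_filter ltnn andbT.
by apply: sorted_filter; [move=> a b c h1 h2; apply: leq_trans h2 h1|apply: shape_sorted].
Qed.

Lemma diagram_shape N f : decreasing f -> (K <= N)%N ->
  diagram (shape f) = rows_diagram N (extend f).
Proof.
move=> hf KN; apply/fsetP => c; rewrite !inE /=.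
apply/allpairsPdep/mapP => [[i [j [+ + ->]]]|[[i j] + ->]].
  rewrite !mem_iota !add0n nth_shape //= => hi hj; exists (i, j) => //.
  rewrite mem_rows_cells hj andbT; apply: leq_trans KN.
  by rewrite ltnNge; apply/negP => /(extend_out f) e; rewrite e in hj.
rewrite mem_rows_cells => /andP[_ hj]; exists i, j; rewrite !mem_iota !add0n nth_shape //=.
split=> //; rewrite ltnNge; apply/negP => h.
by have := nth_shape i hf; rewrite nth_default // => e; rewrite -e in hj.
Qed.

Definition shifted N f (j : nat) : nat := (extend f j + (N - j.+1))%N.

Lemma shifted_strict N f : decreasing f -> strict N (shifted N f).
Proof. by move=> hf i j ij jN; have := decreasingP hf (ltnW ij); rewrite /shifted; lia. Qed.

Lemma shifted_inj N f f' : (K <= N)%N -> monom N (shifted N f) = monom N (shifted N f') -> f = f'.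
Proof.
move=> KN /mnmP e; apply/ffunP => i; apply: ord_inj.
by have := e (widen_ord KN i); rewrite !mnmE /shifted /= !extendE; lia.
Qed.

(** Removing the staircase from [kap] leaves a partition [mu] of size at most [K]. Its parts satisfy
    [j.+1 * mu j <= K], so it fits in the box. *)
Lemma shifted_surj N kap : (K <= N)%N -> strict N kap ->
  (\sum_(j < N) kap j <= \sum_(j < N) (N - j.+1) + K)%N ->
  exists2 f, decreasing f & monom N (shifted N f) = monom N kap.
Proof.
move=> KN hk hs.
have ge d : (d < N)%N -> (d <= kap (N - d.+1))%N.
  elim: d => // d IH lt; have := IH (ltnW lt).
  by have := hk (N - d.+2)%N (N - d.+1)%N ltac:(by lia) ltac:(by lia); lia.
pose mu j := (kap j - (N - j.+1))%N.
have kapE j : (j < N)%N -> kap j = (mu j + (N - j.+1))%N.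
  move=> jN; have := ge (N - j.+1)%N ltac:(by lia).
  by rewrite (_ : N - (N - j.+1).+1 = j)%N /mu; lia.
have mu_dec i j : (i <= j)%N -> (j < N)%N -> (mu j <= mu i)%N.
  move=> ij; rewrite -(subnK ij); elim: (j - i)%N => [|d IH] // lt.
  rewrite addSn in lt *; have := IH (ltnW lt).
  have := hk (d + i)%N (d + i).+1 (leqnn _) lt.
  by rewrite !kapE //; [lia|apply: ltnW].
have sum_mu : (\sum_(j < N) mu j <= K)%N.
  rewrite -(leq_add2l (\sum_(j < N) (N - j.+1))) -big_split /=.
  by apply: leq_trans hs; apply: eq_leq; apply: eq_bigr => j _; rewrite kapE // addnC.
have muK j : (j < N)%N -> (j.+1 * mu j <= K)%N.
  move=> jN; apply: leq_trans sum_mu.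
  rewrite (bigID (fun i : 'I_N => (i <= j)%N)) /=; apply: leq_trans (leq_addr _ _).
  apply: (@leq_trans (\sum_(i < N | (i <= j)%N) mu j)); last first.
    by apply: leq_sum => i ij; apply: mu_dec.
  rewrite sum_nat_const leq_mul2r; apply/orP; right.
  rewrite -[X in (X <= _)%N](card_lt_ord (n := N) jN); apply: subset_leq_card.
  by apply/fintype.subsetP => i; rewrite inE.
exists [ffun i : 'I_K => inord (mu i)].
  apply/'forall_forallP => i j; apply/implyP => ij.
  have iN : (i < N)%N := leq_trans (ltn_ord i) KN; have jN : (j < N)%N := leq_trans (ltn_ord j) KN.
  rewrite !ffunE !inordK ?mu_dec //; first by have := muK i iN; nia.
  by have := muK j jN; nia.
apply/mnmP => j; rewrite !mnmE /shifted [RHS]kapE //; congr (_ + _)%N.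
have [jK|Kj] := ltnP j K.
  rewrite -[nat_of_ord j]/(nat_of_ord (Ordinal jK)) extendE ffunE inordK //=.
  by have := muK j (ltn_ord j); nia.
by rewrite extend_out //; have := muK j (ltn_ord j); nia.
Qed.

Lemma msize_alternant N kap : (msize (alternant (var C N) N kap) <= (\sum_(j < N) kap j).+1)%N.
Proof.
rewrite -antisymmetrize_mon.
have -> : mon N (var C N) kap = 'X_[monom N kap].
  by rewrite mpolyXE_id; apply: eq_bigr => i _; rewrite varE mnmE.
apply: leq_trans (mmeasure_sum _ _ _ _) _; apply/bigmax_leqP => s _.
apply: leq_trans (msizeZ_le _ _) _; rewrite msymX msizeX ltnS mdegE.
rewrite (reindex_inj (@perm_inj _ s)) /=; apply: eq_leq; apply: eq_bigr => i _.
by rewrite !mnmE permK.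
Qed.

Definition rho N (j : nat) : nat := (N - j.+1)%N.

Lemma rho_strict N : strict N (rho N).
Proof. by move=> i j ij jN; rewrite /rho; lia. Qed.

Lemma alternant_rho_neq0 N : alternant (var C N) N (rho N) != 0.
Proof.
apply/eqP => e; have := @mcoeff_alternant C N (rho N) (rho N) (@rho_strict N) (@rho_strict N).
by rewrite e mcoeff0 eqxx => /esym/eqP; rewrite oner_eq0.
Qed.

Lemma schur_shape N f : decreasing f -> (K <= N)%N ->
  alternant (var C N) N (rho N) * schur C (shape f) N = alternant (var C N) N (shifted N f).
Proof.
move=> hf KN; rewrite /schur (diagram_shape hf KN) skew_schur_tab_sum bialternant //.
by move=> i _; apply: decreasingP.
Qed.

(** Alternants from outside the box are excluded by degree; [msize] is the degree plus one, or 0 for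
    the zero polynomial. *)
Lemma schur_expansion N F : (K <= N)%N -> (msize F <= K.+1)%N ->
  alternant_positive (alternant (var C N) N (rho N) * F) ->
  F = \sum_(f | decreasing f)
    (alternant (var C N) N (rho N) * F)@_(monom N (shifted N f)) *: schur C (shape f) N.
Proof.
move=> KN szF hF; apply: (mulfI (alternant_rho_neq0 N)).
rewrite mulr_sumr.
under [RHS]eq_bigr => f hf do rewrite -scalerAr schur_shape //.
apply: alternant_positive_sum => // [f|f f' _ _|kap hk hn]; first exact: shifted_strict.
  exact: shifted_inj.
apply/eqP; rewrite mcoeff_eq0; apply: contraT; rewrite negbK => /msize_mdeg_lt lt.
have [F0|F0] := eqVneq F 0; first by rewrite F0 mulr0 msize0 in lt.
have [|f hf e] := shifted_surj KN hk; last by case: (hn f hf).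
move: lt; rewrite msizeM ?alternant_rho_neq0 //.
have E : (\sum_(i < N) monom N kap i = \sum_(i < N) kap i)%N.
  by apply: eq_bigr => i _; rewrite mnmE.
have := msize_alternant N (rho N); rewrite mdegE E /rho => h1 h2.
apply: contraTT h2; rewrite -ltnNge -leqNgt => h3.
by move: (msize _) h1 (msize F) szF => a h1 b szF; lia.
Qed.

Lemma schur_free N (d : {ffun 'I_K -> 'I_K.+1} -> C) : (K <= N)%N ->
  \sum_(f | decreasing f) d f *: schur C (shape f) N = 0 -> forall f, decreasing f -> d f = 0.
Proof.
move=> KN e f hf; have := congr1 (fun p => (alternant (var C N) N (rho N) * p)@_(monom N (shifted N f))) e.
rewrite /= mulr0 mcoeff0 mulr_sumr raddf_sum (bigD1 f) //= big1 ?addr0.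
  by rewrite -scalerAr schur_shape // mcoeffZ mcoeff_alternant ?eqxx ?mulr1 //;
    apply: shifted_strict.
move=> f' /andP[hf' ne]; rewrite -scalerAr schur_shape // mcoeffZ mcoeff_alternant;
  try exact: shifted_strict.
case: eqP => [/(shifted_inj KN) e'|_]; last by rewrite mulr0.
by rewrite e' eqxx in ne.
Qed.

(** For [N >= K], restriction to [K] variables and the freeness of Schur polynomials show that the
    coefficients do not depend on [N]. Fewer variables are reached by restriction. *)
Lemma schur_positive_of_alternants (F : symfun C) :
  (forall N, (msize (F N) <= K.+1)%N) ->
  (forall N0 N, (N <= N0)%N -> restrict N (F N0) = F N) ->
  (forall N, alternant_positive (alternant (var C N) N (rho N) * F N)) ->
  schur_positive F.
Proof.
move=> szF resF posF.
pose coef N f := (alternant (var C N) N (rho N) * F N)@_(monom N (shifted N f)).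
have expand N : (K <= N)%N -> F N = \sum_(f | decreasing f) coef N f *: schur C (shape f) N.
  by move=> KN; apply: schur_expansion.
have res_sum N0 N (d : {ffun 'I_K -> 'I_K.+1} -> C) : (N <= N0)%N ->
    restrict N (\sum_(f | decreasing f) d f *: schur C (shape f) N0) =
    \sum_(f | decreasing f) d f *: schur C (shape f) N.
  move=> le; rewrite /restrict raddf_sum; apply: eq_bigr => f _ /=.
  by rewrite linearZ /= -/(restrict N _) restrict_skew_schur.
have coefE N f : (K <= N)%N -> decreasing f -> coef N f = coef K f.
  move=> KN hf; apply/eqP; rewrite -subr_eq0; apply/eqP.
  apply: (@schur_free K (fun f => coef N f - coef K f)) => //.
  under eq_bigr do rewrite scalerBl.
  by rewrite sumrB -(res_sum N K) // -expand // resF // -expand // subrr.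
(* Nonnegativity is required at every list [nu], so the value is replaced by 0 where it could
   fail. *)
pose c (nu : seq nat) : C :=
  let z := (alternant (var C K) K (rho K) * F K)@_(monom K (fun j => (nth 0 nu j + rho K j)%N)) in
  if 0 <= z then z else 0.
have cE f : decreasing f -> c (shape f) = coef K f.
  move=> hf; rewrite /c.
  have -> : monom K (fun j => (nth 0 (shape f) j + rho K j)%N) = monom K (shifted K f).
    by apply/mnmP => j; rewrite !mnmE nth_shape.
  by rewrite ifT //; apply: alternant_positive_coef => //; apply: shifted_strict.
exists [seq shape f | f <- enum decreasing], c; split=> [|nu|N].
- by apply/allP => nu /mapP[f + ->]; rewrite mem_enum; apply: shape_partition.
- by rewrite /c; case: ifP.
rewrite big_map big_enum /=.
have FN : F N = \sum_(f | decreasing f) coef K f *: schur C (shape f) N.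
  have [NK|KN] := leqP N K; first by rewrite -(resF K N) // (expand K) // res_sum.
  by rewrite expand ?(ltnW KN) //; apply: eq_bigr => f hf; rewrite coefE ?(ltnW KN).
by rewrite FN; apply: eq_bigr => f hf; rewrite cE.
Qed.
End Expansion.
End Truncations.

(** * Ribbons and skew diagrams *)

Section Ribbon.
Variables (R : infinite_ribbon) (c0 : int).

(** Contents become natural numbers, counted from [c0]. *)
Definition rcell (t : nat) : cell := R (c0 + t%:Z).

Definition right_step (t : nat) : bool := (rcell t.+1).1 == (rcell t).1.

Lemma rcellS t : rcell t.+1 = if right_step t then ((rcell t).1, (rcell t).2 + 1)
  else ((rcell t).1 - 1, (rcell t).2).
Proof.
rewrite /right_step /rcell; have := rib_step R (c0 + t.+1%:Z).
have -> : c0 + t.+1%:Z - 1 = c0 + t%:Z by lia.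
by case=> [->|->] /=; rewrite ?eqxx // ifF //; lia.
Qed.

Lemma content_rcell t : (rcell t).2 - (rcell t).1 = c0 + t%:Z.
Proof. exact: rib_content. Qed.

Lemma rcell_mono s t : (s <= t)%N -> (rcell t).1 <= (rcell s).1 /\ (rcell s).2 <= (rcell t).2.
Proof.
move=> st; rewrite -(subnK st); elim: (t - s)%N => [|d [IH1 IH2]] //.
by rewrite addSn rcellS; case: (right_step _) => /=; lia.
Qed.

Lemma rcell_near s t u : (u <= s <= u.+1)%N -> (u <= t <= u.+1)%N ->
  (rcell s).1 <= (rcell t).1 + 1 /\ (rcell s).2 <= (rcell t).2 + 1.
Proof.
move=> hs ht; have := rcellS u.
have [->|->] : s = u \/ s = u.+1 by lia.
all: have [->|->] : t = u \/ t = u.+1 by lia.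
all: by case: (right_step u) => e; rewrite ?e /=; lia.
Qed.

Section Interval.
Variables a m : nat.
Let D := ribbon_interval R (c0 + a%:Z) (c0 + (a + m)%:Z).

Lemma mem_ribbon_interval (c : cell) :
  reflect (exists2 i : nat, (i < m)%N & c = rcell (a + i)) (c \in D).
Proof.
rewrite inE /=; have -> : `|(c0 + (a + m)%:Z - (c0 + a%:Z))%R|%N = m by lia.
apply: (iffP mapP) => [[i + ->]|[i im ->]].
  by rewrite mem_iota add0n => /= im; exists i => //; rewrite /rcell; congr (rib _ _); lia.
by exists i; rewrite ?mem_iota //= /rcell; congr (rib _ _); lia.
Qed.

Lemma interval_cell_subproof (i : 'I_m) : rcell (a + i) \in D.
Proof. by apply/mem_ribbon_interval; exists i. Qed.

Definition interval_cell (i : 'I_m) : D := FSetSub (interval_cell_subproof i).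

Lemma interval_index_subproof (c : D) : (`|(content (val c) - (c0 + a%:Z))%R| < m)%N.
Proof.
have /mem_ribbon_interval[i im ->] := valP c.
by rewrite /content content_rcell; lia.
Qed.

Definition interval_index (c : D) : 'I_m := Ordinal (interval_index_subproof c).

Lemma interval_cellK : cancel interval_cell interval_index.
Proof. by move=> i; apply: ord_inj; rewrite /= /content content_rcell; lia. Qed.

Lemma interval_indexK : cancel interval_index interval_cell.
Proof.
move=> c; apply: val_inj; have /mem_ribbon_interval[i im e] := valP c.
by rewrite /= e /content content_rcell; congr rcell; lia.
Qed.

Variables (C : numClosedFieldType) (N : nat).

(** Conditions between neighbouring cells suffice: since the ribbon is monotone, all its cells
    between two cells of one row or column lie in that row or column, and the inequalities
    compose. *)
Lemma ssyt_good_word (w : {ffun 'I_m -> 'I_N}) :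
  ssyt [ffun c => w (interval_index c)] = good_word right_step a w.
Proof.
apply/forallP/'forall_forallP => [h i i'|g c].
  apply/implyP => /eqP e; rewrite /step_ok.
  have E k : [ffun c => w (interval_index c)] (interval_cell k) = w k.
    by rewrite ffunE interval_cellK.
  have es := rcellS (a + i).
  case: ifP => hr; rewrite hr in es.
    have /forallP/(_ (interval_cell i'))/andP[/implyP+ _] := h (interval_cell i).
    by rewrite !E /= e addnS es /= eqxx lerDl; apply.
  have /forallP/(_ (interval_cell i))/andP[_ /implyP] := h (interval_cell i').
  by rewrite !E /= e addnS es /= eqxx ltrBlDr ltrDl; apply.
have row d : forall i i' : 'I_m, i' = (i + d)%N :> nat ->
    (rcell (a + i)).1 = (rcell (a + i')).1 -> (w i <= w i')%N.
  elim: d => [|d IH] i i' e er.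
    by have -> : i' = i by apply: ord_inj; rewrite e addn0.
  have [k ek'] : exists k : 'I_m, i' = k.+1 :> nat.
    have lt : (i'.-1 < m)%N by have := ltn_ord i'; lia.
    by exists (Ordinal lt) => /=; lia.
  have ek : (a + i' = (a + k).+1)%N by lia.
  have [m1 _] := rcell_mono (s := a + i) (t := a + k) ltac:(by lia).
  have es := rcellS (a + k); rewrite ek in er.
  case hr: (right_step (a + k)); rewrite hr in es; last by rewrite es /= in er; lia.
  rewrite es /= in er.
  apply: leq_trans (IH i k _ er) _; first by rewrite /=; lia.
  have /implyP := g k i'; rewrite /step_ok hr; apply; apply/eqP => /=; lia.
have col d : forall i i' : 'I_m, i' = (i + d.+1)%N :> nat ->
    (rcell (a + i)).2 = (rcell (a + i')).2 -> (w i' < w i)%N.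
  elim: d => [|d IH] i i' e er.
    have es := rcellS (a + i); rewrite -addnS -addn1 -e in es.
    case hr: (right_step (a + i)); rewrite hr in es; first by rewrite es /= in er; lia.
    by have /implyP := g i i'; rewrite /step_ok hr; apply; apply/eqP; lia.
  have [k ek'] : exists k : 'I_m, i' = k.+1 :> nat.
    have lt : (i'.-1 < m)%N by have := ltn_ord i'; lia.
    by exists (Ordinal lt) => /=; lia.
  have ek : (a + i' = (a + k).+1)%N by lia.
  have [_ m1] := rcell_mono (s := a + i) (t := a + k) ltac:(by lia).
  have es := rcellS (a + k); rewrite ek in er.
  case hr: (right_step (a + k)); rewrite hr in es; first by rewrite es /= in er; lia.
  rewrite es /= in er.
  have h1 := IH i k ltac:(by lia) er; apply: ltn_trans h1.
  by have /implyP := g k i'; rewrite /step_ok hr; apply; apply/eqP => /=; lia.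
apply/forallP => c'; rewrite !ffunE.
rewrite -(interval_indexK c) -(interval_indexK c') !interval_cellK.
move: (interval_index c) (interval_index c') => i i' /=.
have hi := content_rcell (a + i); have hi' := content_rcell (a + i').
apply/andP; split; apply/implyP => /andP[/eqP e le].
  by apply: (row (i' - i)%N) => //; lia.
by apply: (col (i - i').-1%N) => //; lia.
Qed.

Lemma skew_schur_ribbon : skew_schur C D N = word_sum (var C N) N right_step a m.
Proof.
rewrite /skew_schur /word_sum (reindex (fun w : {ffun 'I_m -> 'I_N} => [ffun c =>
  w (interval_index c)])) /=.
  apply: eq_big => [w|w _]; first exact: ssyt_good_word.
  rewrite (reindex interval_cell) /=; last first.
    by exists interval_index => c _; rewrite ?interval_cellK ?interval_indexK.
  by apply: eq_bigr => i _; rewrite ffunE interval_cellK varE.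
exists (fun T : {ffun D -> 'I_N} => [ffun i => T (interval_cell i)]) => f _; apply/ffunP => c;
  by rewrite !ffunE ?interval_cellK ?interval_indexK.
Qed.
End Interval.
End Ribbon.

(** * Convexity of skew diagrams *)

Section Geometry.

Lemma mem_diagram nu (c : cell) : (c \in diagram nu) =
  [&& 0 <= c.1, 0 <= c.2 & (`|c.2| < nth 0%N nu `|c.1|)%N].
Proof.
rewrite inE /=; apply/allpairsPdep/and3P => [[i [j [+ + ->]]]|].
  by rewrite !mem_iota !add0n /= => _ hj.
case: c => c1 c2 /= [h1 h2 lt]; exists `|c1|%N, `|c2|%N; rewrite !gez0_abs //.
rewrite !mem_iota !add0n /= lt; split=> //.
by rewrite ltnNge; apply/negP => h; rewrite nth_default in lt.
Qed.

Lemma mem_diagram_le nu (c c' : cell) : is_partition nu ->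
  0 <= c.1 <= c'.1 -> 0 <= c.2 <= c'.2 -> c' \in diagram nu -> c \in diagram nu.
Proof.
move=> /andP[dec _] /andP[h1 h1'] /andP[h2 h2']; rewrite !mem_diagram => /and3P[_ _ lt].
rewrite h1 h2 /=; apply: leq_ltn_trans (leq_trans lt _); first by lia.
have [h|h] := ltnP `|c'.1| (size nu); last by rewrite [X in (X <= _)%N]nth_default.
have gt : transitive geq by move=> x y z h3 h4; apply: leq_trans h4 h3.
apply: (sorted_leq_nth gt (fun x => leqnn x) 0%N dec); rewrite ?inE //; lia.
Qed.

Lemma skew_diagram_convex lambda mu (c c' c'' : cell) :
  is_partition lambda -> is_partition mu ->
  c.1 <= c'.1 <= c''.1 -> c.2 <= c'.2 <= c''.2 ->
  c \in skew_diagram lambda mu -> c'' \in skew_diagram lambda mu ->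
  c' \in skew_diagram lambda mu.
Proof.
move=> hl hm /andP[h1 h1'] /andP[h2 h2']; rewrite !in_fsetD => /andP[nm cl] /andP[_ cl''].
have /and3P[p1 p2 _] : [&& 0 <= c.1, 0 <= c.2 & (`|c.2| < nth 0%N lambda `|c.1|)%N].
  by rewrite -mem_diagram.
apply/andP; split; last by apply: mem_diagram_le cl''; lia.
by apply: contra nm; apply: mem_diagram_le => //; lia.
Qed.
End Geometry.

(** * The ribbon decomposition matrix *)

Section Degrees.
Variables (C : numClosedFieldType) (N : nat).
Implicit Types p q : {mpoly C[N]}.

Lemma msizeM_bound p q d e : (msize p <= d.+1)%N -> (msize q <= e.+1)%N ->
  (msize (p * q) <= (d + e).+1)%N.
Proof.
move=> hp hq; have [->|p0] := eqVneq p 0; first by rewrite mul0r msize0.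
have [->|q0] := eqVneq q 0; first by rewrite mulr0 msize0.
by rewrite msizeM //; move: (msize p) (msize q) hp hq => x y; lia.
Qed.

Lemma msize_prod_bound (I : finType) (F : I -> {mpoly C[N]}) (d : I -> nat) :
  (forall i, msize (F i) <= (d i).+1)%N -> (msize (\prod_i F i) <= (\sum_i d i).+1)%N.
Proof.
move=> h; apply: (big_ind2 (fun p e => msize p <= e.+1)%N) => [|p e q e' hp hq|i _] //.
  by rewrite msize1.
exact: msizeM_bound.
Qed.

Lemma msize_sum_bound (I : finType) (P : pred I) (F : I -> {mpoly C[N]}) d :
  (forall i, P i -> msize (F i) <= d)%N -> (msize (\sum_(i | P i) F i) <= d)%N.
Proof. by move=> h; apply: leq_trans (mmeasure_sum _ _ _ _) _; apply/bigmax_leqP. Qed.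

Lemma msize_skew_schur D : (msize (skew_schur C D N) <= #|{: D}|.+1)%N.
Proof.
apply: msize_sum_bound => T _; rewrite -sum1_card; apply: msize_prod_bound => c.
by rewrite msizeX mdeg1.
Qed.
End Degrees.

(** * From the copies of the ribbon to active ribbons at a content *)

Section Main.
Variables (C : numClosedFieldType) (R : infinite_ribbon) (lambda mu : seq nat).
Hypotheses (hlambda : is_partition lambda) (hmu : is_partition mu).
Variables (n : nat) (a b k : 'I_n -> int).
Let D := skew_diagram lambda mu.
Hypotheses (k_inc : forall i j : 'I_n, (i < j)%N -> k i < k j) (ab : forall i, a i < b i)
  (copyP : forall i c, (copy R (k i) c \in D) = (a i <= c < b i)).

(** Strictly below every [a i], so that all offsets of sources are positive and no ribbon is active
    at content 0. *)
Definition base : int := - (\sum_(i < n) `|a i|) - 1.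

Lemma base_lt i : base < a i.
Proof.
rewrite /base; have : `|a i| <= \sum_(j < n) `|a j|.
  by rewrite (bigD1 i) //= lerDl sumr_ge0.
have := ler_norm (- a i); rewrite normrN; lia.
Qed.

Definition offset (f : 'I_n -> int) (i : nat) : nat :=
  if insub i is Some o then `|(f o - base)%R|%N else 0%N.

Lemma offsetE f (i : 'I_n) : base <= f i -> base + (offset f i)%:Z = f i.
Proof. by move=> h; rewrite /offset valK; lia. Qed.

Lemma offset_a (i : 'I_n) : base + (offset a i)%:Z = a i.
Proof. exact/offsetE/ltW/base_lt. Qed.

Lemma offset_b (i : 'I_n) : base + (offset b i)%:Z = b i.
Proof. by apply/offsetE/ltW; apply: lt_trans (ab i); apply: base_lt. Qed.

Lemma offset_ab i : (i < n)%N -> (0 < offset a i < offset b i)%N.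
Proof.
move=> lt; have := offset_a (Ordinal lt); have := offset_b (Ordinal lt).
by have := ab (Ordinal lt); have := base_lt (Ordinal lt) => /=; lia.
Qed.

Lemma activeP t (i : 'I_n) :
  active (offset a) (offset b) t i = (copy R (k i) (base + t%:Z) \in D).
Proof.
rewrite copyP /active; have := offset_a i; have := offset_b i; lia.
Qed.

Definition cell_le (c c' : cell) : Prop := c.1 <= c'.1 /\ c.2 <= c'.2.

Lemma copy_between (i i' j' : 'I_n) (s s' t' : nat) :
  copy R (k i) (base + s%:Z) \in D -> copy R (k j') (base + t'%:Z) \in D ->
  cell_le (copy R (k i) (base + s%:Z)) (copy R (k i') (base + s'%:Z)) ->
  cell_le (copy R (k i') (base + s'%:Z)) (copy R (k j') (base + t'%:Z)) ->
  copy R (k i') (base + s'%:Z) \in D.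
Proof.
move=> h1 h2 [h3 h4] [h5 h6].
by apply: skew_diagram_convex h1 h2 => //; apply/andP.
Qed.

(** A diagonal shift by at least one outweighs the difference between two cells of the ribbon with
    contents [t] or [t.+1]. *)
Lemma cell_le_copies (i j : 'I_n) (s s' t : nat) : (i < j)%N ->
  (t <= s <= t.+1)%N -> (t <= s' <= t.+1)%N ->
  cell_le (copy R (k i) (base + s%:Z)) (copy R (k j) (base + s'%:Z)).
Proof.
move=> /k_inc; rewrite /copy /diag_shift -/(rcell R base s) -/(rcell R base s') => kij hs hs'.
have [h1 h2] := rcell_near R base hs hs'; clear - h1 h2 kij.
by split=> /=; lia.
Qed.

(** Of the neighbouring cells of contents [t] and [t.+1], the content of the southeast one;
    [step_northwest] is that of the other. *)
Definition step_southeast t : nat := if right_step R base t then t.+1 else t.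
Definition step_northwest t : nat := if right_step R base t then t else t.+1.

Lemma cell_le_step (i : 'I_n) (s t : nat) : (t <= s <= t.+1)%N ->
  cell_le (copy R (k i) (base + s%:Z)) (copy R (k i) (base + (step_southeast t)%:Z)) /\
  cell_le (copy R (k i) (base + (step_northwest t)%:Z)) (copy R (k i) (base + s%:Z)).
Proof.
rewrite /copy /diag_shift -!/(rcell R base _) /step_southeast /step_northwest => hs.
have e := rcellS R base t.
have [->|->] : s = t \/ s = t.+1 by clear - hs; lia.
all: rewrite /cell_le; case: (right_step R base t) in e *; rewrite ?e /=; clear; split; split; lia.
Qed.

Lemma chain_cells t (i j : 'I_n) : (i < j)%N ->
  active (offset a) (offset b) t i || active (offset a) (offset b) t.+1 i ->
  active (offset a) (offset b) t j || active (offset a) (offset b) t.+1 j ->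
  exists s s', [/\ (t <= s <= t.+1)%N, (t <= s' <= t.+1)%N,
    copy R (k i) (base + s%:Z) \in D & copy R (k j) (base + s'%:Z) \in D].
Proof.
rewrite !activeP => ij hi hj.
have [s hs cs] : exists2 s, (t <= s <= t.+1)%N & copy R (k i) (base + s%:Z) \in D.
  by case/orP: hi => h; [exists t|exists t.+1]; rewrite ?leqnn ?leqnSn.
have [s' hs' cs'] : exists2 s, (t <= s <= t.+1)%N & copy R (k j) (base + s%:Z) \in D.
  by case/orP: hj => h; [exists t|exists t.+1]; rewrite ?leqnn ?leqnSn.
by exists s, s'.
Qed.

(** The southeast cell of copy [i] and the northwest cell of copy [j] lie between a cell of the
    shape in copy [i] and one in copy [j], so convexity puts them in the shape. *)
Lemma chain_step t (i j : 'I_n) : (i < j)%N ->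
  active (offset a) (offset b) t i || active (offset a) (offset b) t.+1 i ->
  active (offset a) (offset b) t j || active (offset a) (offset b) t.+1 j ->
  active (offset a) (offset b) (step_southeast t) i &&
  active (offset a) (offset b) (step_northwest t) j.
Proof.
move=> ij hi hj; have [s [s' [hs hs' cs cs']]] := chain_cells ij hi hj.
have ht : (t <= step_southeast t <= t.+1)%N by rewrite /step_southeast; case: ifP => _;
  rewrite ?leqnn ?leqnSn.
have hb : (t <= step_northwest t <= t.+1)%N by rewrite /step_northwest; case: ifP => _;
  rewrite ?leqnn ?leqnSn.
rewrite !activeP; apply/andP; split; apply: (copy_between cs cs').
- by have [] := cell_le_step i hs.
- exact: cell_le_copies ij ht hs'.
- exact: cell_le_copies ij hs hb.
- by have [] := cell_le_step j hs'.
Qed.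

Lemma chain_middle t (i l j : 'I_n) : (i < l)%N -> (l < j)%N ->
  active (offset a) (offset b) t i || active (offset a) (offset b) t.+1 i ->
  active (offset a) (offset b) t j || active (offset a) (offset b) t.+1 j ->
  active (offset a) (offset b) t l && active (offset a) (offset b) t.+1 l.
Proof.
move=> il lj hi hj; have [s [s' [hs hs' cs cs']]] := chain_cells (ltn_trans il lj) hi hj.
have h0 : (t <= t <= t.+1)%N by rewrite leqnn leqnSn.
have h1 : (t <= t.+1 <= t.+1)%N by rewrite leqnn leqnSn.
by rewrite !activeP; apply/andP; split; apply: (copy_between cs cs');
  apply: cell_le_copies; eassumption.
Qed.

Notation rows N := [seq sinkv n N (var C N) (offset a) (right_step R base) (offset b i)
                   | i <- index_iota 0 n].

Lemma TL_imm_rows N (u : 'S_n) :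
  TL_imm u (ribbon_matrix C R a b N) = imm (TL_coef C u) (rows N).
Proof.
rewrite /imm size_map size_iota subn0 eqxx; apply: eq_bigr => w _; congr (_ *: _).
apply: eq_bigr => i _; rewrite mxE (nth_map 0%N) ?size_iota ?subn0 // nth_iota ?subn0 // add0n.
have /andP[a0 _] := offset_ab (ltn_ord (w i)).
rewrite sinkv_word // -(offset_a (w i)) -(offset_b i) lerD2l lez_nat.
case: leqP => // le; rewrite -[in LHS](subnKC le); exact: skew_schur_ribbon.
Qed.

Definition simple_msym N (i : nat) : {lrmorphism {mpoly C[N]} -> {mpoly C[N]}} :=
  msym (simple_transp N i).

Lemma msym_imm_rows N (g : 'S_n -> C) (s : 'S_N) : msym s (imm g (rows N)) = imm g (rows N).
Proof.
move: s; apply: symmetric_of_simple => i iN.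
rewrite -[msym _ _]/(simple_msym N i _) imm_map -map_comp; congr (imm _ _).
apply: eq_map => l /=.
have tau_var i' h : (i'.+1 < N)%N -> simple_msym N i' (var C N h) = var C N (swapn i' h).
  exact: msym_simple_var.
exact: (@sinkv_sym C n _ N (var C N) (simple_msym N) tau_var _ _ _ i iN).
Qed.

Lemma antisymmetrizeZ N (c : C) (F : {mpoly C[N]}) :
  antisymmetrize (c *: F) = c *: antisymmetrize F.
Proof.
rewrite /antisymmetrize scaler_sumr; apply: eq_bigr => s _.
by rewrite linearZ /= !scalerA mulrC.
Qed.

Lemma TL_imm_alternant_positive N (u : 'S_n) : avoids321 u ->
  alternant_positive (alternant (var C N) N (rho N) * TL_imm u (ribbon_matrix C R a b N)).
Proof.
move=> hu; rewrite TL_imm_rows -antisymmetrize_mon.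
rewrite -antisymmetrize_mul; last exact: msym_imm_rows.
apply: (@sink_pos C n _ N (var C N) (simple_msym N) (@antisymmetrize C N) (@alternant_positive C N)).
- by move=> i h iN; apply: msym_simple_var.
- by move=> i F iN; apply: antisymmetrize_simple.
- exact: alternant_positive0.
- exact: alternant_positiveD.
- exact: offset_ab.
- move=> t i j hr ij jn; have := @chain_step t (Ordinal (ltn_trans ij jn)) (Ordinal jn).
  by rewrite /step_southeast /step_northwest /= hr; apply.
- move=> t i j /negPf hr ij jn; have := @chain_step t (Ordinal (ltn_trans ij jn)) (Ordinal jn).
  by rewrite /step_southeast /step_northwest /= hr; apply.
- move=> t i l j il lj jn.
  have ln := ltn_trans lj jn; have iN := ltn_trans il ln.
  exact: (@chain_middle t (Ordinal iN) (Ordinal ln) (Ordinal jn)).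
- move=> c kap c0 /strictP hk; rewrite /= antisymmetrizeZ antisymmetrize_mon -[_ *: _]addr0.
  by constructor => //; constructor.
- exact: tl_positive_TL_coef.
- by move=> h hN; rewrite /rho; lia.
Qed.

Lemma restrict_TL_imm N0 N (u : 'S_n) : (N <= N0)%N ->
  restrict N (TL_imm u (ribbon_matrix C R a b N0)) = TL_imm u (ribbon_matrix C R a b N).
Proof.
move=> le; rewrite /TL_imm /restrict raddf_sum; apply: eq_bigr => w _ /=.
rewrite linearZ /= rmorph_prod; congr (_ *: _); apply: eq_bigr => i _ /=.
by rewrite !mxE; case: ifP => _; [apply: restrict_skew_schur|rewrite raddf0].
Qed.

(** A crude bound; what matters is that it does not depend on [N]. *)
Lemma msize_TL_imm N (u : 'S_n) : (msize (TL_imm u (ribbon_matrix C R a b N)) <=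
  (\sum_(i < n) \sum_(j < n) #|{: ribbon_interval R (a j) (b i)}|).+1)%N.
Proof.
apply: msize_sum_bound => w _; apply: leq_trans (msizeZ_le _ _) _.
apply: msize_prod_bound => i; rewrite mxE; case: ifP => _; last by rewrite msize0.
apply: leq_trans (msize_skew_schur _ _ _) _.
by rewrite ltnS (bigD1 (w i)) //= leq_addr.
Qed.
End Main.

Theorem theorem1p1 (C : numClosedFieldType) (R : infinite_ribbon)
    (lambda mu : seq nat)
    (hlambda : is_partition lambda) (hmu : is_partition mu)
    (hsub : fsubset (diagram mu) (diagram lambda))
    (hcompat : compatible R (skew_diagram lambda mu))
    (n : nat) (a b : 'I_n -> int)
    (hab : ending_starting_tuples R (skew_diagram lambda mu) a b)
    (u : 'S_n) (hu : avoids321 u) :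
  schur_positive (fun N => TL_imm u (ribbon_matrix C R a b N)).
Proof.
have [k [k_inc _ ab copyP]] := hab.
apply: schur_positive_of_alternants => [N|N0 N|N]; first exact: msize_TL_imm.
  exact: restrict_TL_imm.
exact: (TL_imm_alternant_positive C hlambda hmu k_inc ab copyP N hu).
Qed.
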